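(* Let $F(\xi,x)=f(\xi)+\sum_{\langle\boldsymbol{k},\boldsymbol{w}\rangle\leq d-1}c_{\boldsymbol{k}}(x)\xi^{\boldsymbol{k}}$ be a semi-quasielliptic polynomial, with $f$ quasielliptic of degree $d$ with respect to $\boldsymbol{w}=(w_1,\ldots,w_n)$. There is a constant $M_0\in\mathbb{N}$, for which there exist $A_0,A_1>0$ with $$A_0\,\Xi(\xi)\leq|F(\xi,x)|_p\leq A_1\,\Xi(\xi)\quad\text{for all } x\in\mathbb{Q}_p^n \text{ and } \|\xi\|_p\geq p^{M_0},$$ such that the following holds for all $\alpha>0$ and $\beta\geq\alpha$. The operator $$\boldsymbol{F}(D;\alpha;x):\widetilde{H}_{(\beta,M_0)}\to\widetilde{H}_{(\beta-\alpha,M_0)},\qquad\varphi\mapsto\boldsymbol{F}(D;\alpha;x)\varphi,$$ is a bicontinuous isomorphism of Banach spaces. In addition, if $\beta>\alpha+\frac{n\max_i\{w_i\}}{2d}$ and $\phi\in\widetilde{H}_{(\beta,M_0)}$, then $\phi$ is a uniformly continuous function.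
   Context: $p$ is a prime, $|\cdot|_p$ the $p$-adic absolute value on $\mathbb{Q}_p$, $\|\xi\|_p=\max_i|\xi_i|_p$. A non-constant polynomial $f(\xi)\in\mathbb{Q}_p[\xi_1,\ldots,\xi_n]$ is called quasielliptic of degree $d$ with respect to $\boldsymbol{w}\in(\mathbb{N}\setminus\{0\})^n$ if: (Q1) $f(\lambda^{w_1}\xi_1,\ldots,\lambda^{w_n}\xi_n)=\lambda^d f(\xi)$ for all $\lambda\in\mathbb{Q}_p^\times$; and (Q2) $f(\xi)=0\Leftrightarrow \xi=0$. By convention all quasielliptic polynomials are assumed to have coefficients in $\mathbb{Z}_p$. $F(\xi,x)=f(\xi)+\sum_{\langle\boldsymbol{k},\boldsymbol{w}\rangle\leq d-1}c_{\boldsymbol{k}}(x)\xi^{\boldsymbol{k}}$ (with $\boldsymbol{k}\in\mathbb{N}^n$ and $\langle\cdot,\cdot\rangle$ the usual inner product) is semi-quasielliptic if $f$ is quasielliptic of degree $d$ with respect to $\boldsymbol{w}$ and each $c_{\boldsymbol{k}}:\mathbb{Q}_p^n\to\mathbb{Q}_p$ satisfies $\sup_{x}|c_{\boldsymbol{k}}(x)|_p<\infty$. Set $\Xi(\xi)=\sum_{i=1}^n|\xi_i|_p^{d/w_i}$. $S$ is the space of Schwartz--Bruhat functions on $\mathbb{Q}_p^n$. $\Psi:\mathbb{Q}_p\to\mathbb{C}^\times$ is the standard additive character, $(\mathcal{F}\phi)(\xi)=\int_{\mathbb{Q}_p^n}\Psi(-x\cdot\xi)\phi(x)\,d^nx$,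 with $d^nx$ the Haar measure normalized by $\mathrm{vol}(\mathbb{Z}_p^n)=1$. For a real $\beta\geq0$ and $\phi\in S$ put $\|\phi\|_{(\beta,\Xi)}^2=\int_{\mathbb{Q}_p^n}[\max(1,\Xi(\xi))]^{2\beta}|\mathcal{F}(\phi)(\xi)|^2d^n\xi$. For $M_0\in\mathbb{N}$ let $\Phi_{M_0}=\{\phi\in S:\mathcal{F}(\phi)(\xi)=0\text{ for all }\|\xi\|_p\leq p^{M_0}\}$, and let $\widetilde{H}_{(\beta,M_0)}$ be the completion of $(\Phi_{M_0},\|\cdot\|_{(\beta,\Xi)})$; since $\|\phi\|_{L^2}\leq\|\phi\|_{(\beta,\Xi)}$, its elements are regarded as (a.e.-classes of) functions in $L^2(\mathbb{Q}_p^n)$. The operator is defined on $\Phi_{M_0}$ by $(\boldsymbol{F}(D;\alpha;x)\phi)(x)=\int_{\mathbb{Q}_p^n}\Psi(x\cdot\xi)|F(\xi,x)|_p^\alpha\mathcal{F}(\phi)(\xi)\,d^n\xi$, i.e. $\boldsymbol{F}(D;\alpha;x)\phi=\mathcal{F}^{-1}(|F(\xi,x)|_p^\alpha\mathcal{F}(\phi))$, and is extended by density to $\widetilde{H}_{(\beta,M_0)}$. *)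

(* Defs.v *)
From HB Require Import structures.
From mathcomp Require Import all_boot all_order all_algebra.
From mathcomp Require Import generic_quotient ring_quotient.
From mathcomp Require Import all_classical all_reals all_analysis.
From mathcomp Require Import complex.
From mathcomp Require Import -(notations) mpoly.
Set Implicit Arguments.
Unset Strict Implicit.
Unset Printing Implicit Defensive.
Import Order.TTheory GRing.Theory Num.Theory.
Import numFieldNormedType.Exports.
Local Open Scope classical_set_scope.
Local Open Scope ring_scope.

Section RationalPadicAbs.
Variables (R : realType) (p : nat).

Definition ratord (x : rat) : int :=
  (logn p `|numq x|%N)%:Z - (logn p `|denq x|%N)%:Z.

Definition ratabs (x : rat) : R := if x == 0 then 0 else p%:R ^ (- ratord x).

Hypothesis p_prime : prime p.

Let p_gt0 : 0 < p%:R :> R. Proof. by rewrite ltr0n prime_gt0. Qed.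
Let p_gt1 : 1 < p%:R :> R. Proof. by rewrite ltr1n prime_gt1. Qed.

Lemma ratord_div (a b : int) : a != 0 -> b != 0 ->
  ratord (a%:Q / b%:Q) = (logn p `|a|%N)%:Z - (logn p `|b|%N)%:Z.
Proof.
move=> a0 b0; rewrite /ratord; set x := a%:Q / b%:Q.
have x0 : x != 0 by rewrite mulf_neq0 ?invr_neq0 ?intr_eq0.
have n0 : numq x != 0 by rewrite numq_eq0.
have d0 : denq x != 0 by [].
have E : (numq x * b)%R = (a * denq x)%R.
  apply: (@intr_inj rat); rewrite !intrM.
  have := divq_num_den x; rewrite {3}/x => /eqP.
  by rewrite eqr_div ?intr_eq0 // => /eqP.
have := congr1 (fun z : int => logn p `|z|%N) E.
rewrite !abszM !lognM ?absz_gt0 // => /(congr1 Posz).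
rewrite !PoszD => H.
by apply/eqP; rewrite subr_eq addrAC eq_sym subr_eq -H.
Qed.

Lemma ratordM x y : x != 0 -> y != 0 -> ratord (x * y) = ratord x + ratord y.
Proof.
move=> x0 y0; rewrite -{1}(divq_num_den x) -{1}(divq_num_den y).
rewrite mulf_div -!intrM ratord_div ?mulf_neq0 ?numq_eq0 ?denq_neq0 //.
rewrite !abszM !lognM ?absz_gt0 ?numq_eq0 ?denq_neq0 // !PoszD /ratord.
by rewrite opprD addrACA.
Qed.

Lemma ratordD x y : x != 0 -> y != 0 -> x + y != 0 ->
  Num.min (ratord x) (ratord y) <= ratord (x + y).
Proof.
move=> x0 y0; rewrite -{1 3}(divq_num_den x) -{1 3}(divq_num_den y).
rewrite addf_div ?intr_eq0 ?denq_neq0 // -!intrM -intrD => xy0.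
set a := numq x * denq y; set b := numq y * denq x; set d := denq x * denq y.
have ab0 : a + b != 0 by move: xy0; rewrite mulf_eq0 intr_eq0; case/norP.
rewrite ratord_div ?mulf_neq0 ?denq_neq0 //.
have -> : ratord x = (logn p `|a|%N)%:Z - (logn p `|d|%N)%:Z.
  rewrite -ratord_div ?mulf_neq0 ?numq_eq0 ?denq_neq0 // !intrM.
  by rewrite invfM mulrACA divff ?intr_eq0 ?denq_neq0 // mulr1 divq_num_den.
have -> : ratord y = (logn p `|b|%N)%:Z - (logn p `|d|%N)%:Z.
  rewrite -ratord_div ?mulf_neq0 ?numq_eq0 ?denq_neq0 // /d (mulrC (denq x)).
  by rewrite !intrM invfM mulrACA divff ?intr_eq0 ?denq_neq0 // mulr1 divq_num_den.
have a0 : a != 0 by rewrite mulf_neq0 ?numq_eq0 ?denq_neq0.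
have b0 : b != 0 by rewrite mulf_neq0 ?numq_eq0 ?denq_neq0.
rewrite -addr_minl lerD2r.
suff H k : (k <= logn p `|a|)%N -> (k <= logn p `|b|)%N ->
    (k <= logn p `|(a + b)%R|)%N.
  rewrite minEle; case: ifPn => [ab|]; first by rewrite lez_nat; exact: H.
  by rewrite -ltNge => /ltW ba; rewrite lez_nat; apply: H => //; rewrite -lez_nat.
rewrite -!pfactor_dvdn ?absz_gt0 // => ka kb.
have : ((p ^ k)%N%:Z %| a + b)%Z by apply: rpredD; rewrite /= dvdzE.
by rewrite dvdzE.
Qed.

Lemma ratabs0 : ratabs 0 = 0. Proof. by rewrite /ratabs eqxx. Qed.

Lemma ratabs_gt0 x : x != 0 -> 0 < ratabs x.
Proof. by move=> x0; rewrite /ratabs (negbTE x0) exprz_gt0. Qed.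

Lemma ratabs_ge0 x : 0 <= ratabs x.
Proof.
by have [->|/ratabs_gt0/ltW//] := eqVneq x 0; rewrite ratabs0.
Qed.

Lemma ratabs_eq0 x : ratabs x = 0 -> x = 0.
Proof.
move=> x0; apply/eqP; apply: contraTT isT => /ratabs_gt0.
by rewrite x0 ltxx.
Qed.

Lemma ratabsM x y : ratabs (x * y) = ratabs x * ratabs y.
Proof.
have [->|x0] := eqVneq x 0; first by rewrite mul0r ratabs0 mul0r.
have [->|y0] := eqVneq y 0; first by rewrite mulr0 ratabs0 mulr0.
rewrite /ratabs mulf_eq0 (negbTE x0) (negbTE y0) /= ratordM //.
by rewrite opprD expfzDr // gt_eqF.
Qed.

Lemma ratabs1 : ratabs 1 = 1.
Proof.
by rewrite /ratabs oner_eq0 /ratord (_ : numq 1 = 1) // (_ : denq 1 = 1) // subrr.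
Qed.

Lemma ratabsN x : ratabs (- x) = ratabs x.
Proof.
by rewrite /ratabs oppr_eq0 /ratord numqN denqN abszN.
Qed.

Lemma ratabsV x : ratabs x^-1 = (ratabs x)^-1.
Proof.
have [->|x0] := eqVneq x 0; first by rewrite invr0 ratabs0 invr0.
apply: (mulfI (lt0r_neq0 (ratabs_gt0 x0))).
by rewrite -ratabsM !divff ?ratabs1 // gt_eqF // ratabs_gt0.
Qed.

Lemma ratabsD_max x y : ratabs (x + y) <= Num.max (ratabs x) (ratabs y).
Proof.
have [->|x0] := eqVneq x 0; first by rewrite add0r le_max lexx orbT.
have [->|y0] := eqVneq y 0; first by rewrite addr0 le_max lexx.
have [->|xy0] := eqVneq (x + y) 0; first by rewrite ratabs0 le_max ratabs_ge0.
have := ratordD x0 y0 xy0.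
rewrite /ratabs (negbTE x0) (negbTE y0) (negbTE xy0) ge_min le_max.
case/orP => H; apply/orP.
  by left; rewrite ler_weXz2l ?lerN2 ?(ltW p_gt1).
by right; rewrite ler_weXz2l ?lerN2 ?(ltW p_gt1).
Qed.

Lemma ratabsD x y : ratabs (x + y) <= ratabs x + ratabs y.
Proof.
apply: le_trans (ratabsD_max x y) _.
by rewrite ge_max lerDl lerDr !ratabs_ge0.
Qed.

Lemma ratabsB_sub x y : `|ratabs x - ratabs y| <= ratabs (x - y).
Proof.
have H u v : ratabs u - ratabs v <= ratabs (u - v).
  by rewrite lerBlDr -{1}(subrK v u) ratabsD.
rewrite ler_norml; apply/andP; split; last exact: H.
by rewrite lerNl opprB -(ratabsN (x - y)) opprB H.
Qed.

End RationalPadicAbs.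

(* Q_p is the completion of Q for the p-adic absolute value: the ring of
   Cauchy sequences modulo the (prime) ideal of null sequences. *)
Section CauchySequences.
Variables (R : realType) (p : nat).
Local Notation nq := (ratabs R p).

Definition padic_cauchy (s : nat -> rat) : Prop :=
  forall e : R, 0 < e -> exists N, forall m n, (N <= m)%N -> (N <= n)%N ->
    nq (s m - s n) < e.

Definition padic_null (s : nat -> rat) : Prop :=
  forall e : R, 0 < e -> exists N, forall n, (N <= n)%N -> nq (s n) < e.

Definition is_cauchyb : pred (nat -> rat) := fun s => `[< padic_cauchy s >].

Hypothesis p_prime : prime p.

Lemma padic_cauchy_bounded s : padic_cauchy s ->
  exists2 B : R, 0 < B & forall n, nq (s n) <= B.
Proof.
move=> /(_ 1 ltr01) [N HN].
exists (1 + \sum_(i < N.+1) nq (s i)).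
  by rewrite ltr_pwDl // sumr_ge0 // => i _; exact: ratabs_ge0.
have le_sum (i : 'I_N.+1) : nq (s i) <= \sum_(j < N.+1) nq (s j).
  by rewrite (bigD1 i) //= lerDl sumr_ge0 // => j _; exact: ratabs_ge0.
move=> n; case: (ltnP n N.+1) => [nN|Nn].
  apply: le_trans (le_sum (Ordinal nN)) _; by rewrite lerDr.
rewrite -{1}(subrK (s N) (s n)).
apply: le_trans (ratabsD _ p_prime _ _) _; apply: lerD.
  by apply/ltW/HN => //; exact: ltnW.
exact: (le_sum ord_max).
Qed.

Lemma padic_null_cauchy s : padic_null s -> padic_cauchy s.
Proof.
move=> s0 e e0; have [N HN] := s0 _ e0; exists N => m n Nm Nn.
apply: le_lt_trans (ratabsD_max _ p_prime _ _) _.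
by rewrite ratabsN gt_max !HN.
Qed.

Lemma padic_cauchy_subring : subring_closed (is_cauchyb : {pred nat -> rat}).
Proof.
split.
- apply/asboolP => e e0; exists 0%N => m n _ _.
  by rewrite (_ : 1 m - 1 n = 0 :> rat) ?ratabs0 // subrr.
- move=> s t /asboolP cs /asboolP ct; apply/asboolP => e e0.
  have [N HN] := cs _ e0; have [M HM] := ct _ e0.
  exists (maxn N M) => m n; rewrite !geq_max => /andP[Nm Mm] /andP[Nn Mn].
  have -> : (s - t) m - (s - t) n = (s m - s n) - (t m - t n).
    by rewrite !opprD !opprK addrACA.
  apply: le_lt_trans (ratabsD_max _ p_prime _ _) _.
  by rewrite ratabsN gt_max HN // HM.
- move=> s t /asboolP cs /asboolP ct; apply/asboolP => e e0.
  have [A A0 HA] := padic_cauchy_bounded cs.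
  have [B B0 HB] := padic_cauchy_bounded ct.
  have [N HN] := cs _ (divr_gt0 e0 B0); have [M HM] := ct _ (divr_gt0 e0 A0).
  exists (maxn N M) => m n; rewrite !geq_max => /andP[Nm Mm] /andP[Nn Mn].
  have -> : (s * t) m - (s * t) n = (s m - s n) * t m + s n * (t m - t n).
    by rewrite mulrBl mulrBr addrA subrK.
  apply: le_lt_trans (ratabsD_max _ p_prime _ _) _.
  rewrite gt_max !ratabsM // ; apply/andP; split.
    apply: le_lt_trans (ler_wpM2l (ratabs_ge0 _ p_prime _) (HB m)) _.
    by rewrite -ltr_pdivlMr // HN.
  apply: le_lt_trans (ler_wpM2r (ratabs_ge0 _ p_prime _) (HA n)) _.
  by rewrite mulrC -ltr_pdivlMr // HM.
Qed.

End CauchySequences.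

Section Padic.
Variables (R : realType) (p : nat) (p_prime : prime p).
Local Notation nq := (ratabs R p).

Definition cauchy_pred (_ : prime p) : pred (nat -> rat) := @is_cauchyb R p.

HB.instance Definition _ := GRing.isSubringClosed.Build (nat -> rat)
  (cauchy_pred p_prime) (padic_cauchy_subring R p_prime).

Record cauchy_seq := CauchySeq {
  cseq :> nat -> rat ;
  cseqP : cseq \in cauchy_pred p_prime }.

HB.instance Definition _ := [isSub for cseq].
HB.instance Definition _ := [Choice of cauchy_seq by <:].
HB.instance Definition _ := [SubChoice_isSubComNzRing of cauchy_seq by <:].

Definition null_pred : pred cauchy_seq := fun s => `[< padic_null R p s >].

Lemma cauchy_seqP (s : cauchy_seq) : padic_cauchy R p s.
Proof. by have /asboolP := cseqP s. Qed.

Lemma not_null (s : cauchy_seq) : s \notin null_pred ->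
  exists e : R, 0 < e /\ exists N, forall n, (N <= n)%N -> e <= nq (s n).
Proof.
move=> /asboolPn; rewrite /padic_null => /existsNP[e /not_implyP[e0 H]].
have [N HN] := cauchy_seqP s e0; exists e; split=> //; exists N => n Nn.
rewrite leNgt; apply/negP => sn; apply: H; exists N => m Nm.
rewrite -(subrK (s n) (s m)); apply: le_lt_trans (ratabsD_max _ p_prime _ _) _.
by rewrite gt_max sn HN.
Qed.

Lemma null_idealr : idealr_closed (null_pred : {pred cauchy_seq}).
Proof.
split.
- by apply/asboolP => e e0; exists 0%N => n _; rewrite /= ratabs0.
- apply/asboolPn => /(_ 1 ltr01)[N /(_ N (leqnn _))].
  by rewrite /= (_ : _ N = 1) // ratabs1 // ltxx.
- move=> a u v /asboolP u0 /asboolP v0; apply/asboolP => e e0.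
  have [A A0 HA] := padic_cauchy_bounded p_prime (cauchy_seqP a).
  have [N HN] := u0 _ (divr_gt0 e0 A0); have [M HM] := v0 _ e0.
  exists (maxn N M) => n; rewrite !geq_max => /andP[Nn Mn].
  rewrite (_ : cseq _ n = a n * u n + v n) //.
  apply: le_lt_trans (ratabsD_max _ p_prime _ _) _.
  rewrite gt_max HM // andbT ratabsM //.
  apply: le_lt_trans (ler_wpM2r (ratabs_ge0 _ p_prime _) (HA n)) _.
  by rewrite mulrC -ltr_pdivlMr // HN.
Qed.

HB.instance Definition _ := isIdealr.Build cauchy_seq null_pred null_idealr.

Definition null_ideal : idealr cauchy_seq := null_pred.

Definition padic := Quotient.quot null_ideal.

HB.instance Definition _ := GRing.ComNzRing.on padic.
HB.instance Definition _ := EqQuotient.on padic.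

Lemma padic_pi_eq (s t : cauchy_seq) :
  (\pi_padic s = \pi_padic t)%qT <-> padic_null R p (s - t : cauchy_seq).
Proof.
split=> [/eqP|H]; last apply/eqP.
  by rewrite -(Quotient.idealrBE null_ideal) => /asboolP.
by rewrite -(Quotient.idealrBE null_ideal); apply/asboolP.
Qed.

Lemma padic_pi1 : (\pi_padic 1 = 1)%qT. Proof. by rewrite piE. Qed.
Lemma padic_piM (s t : cauchy_seq) :
  (\pi_padic (s * t) = \pi_padic s * \pi_padic t)%qT.
Proof. by rewrite piE. Qed.
Lemma padic_piD (s t : cauchy_seq) :
  (\pi_padic (s + t) = \pi_padic s + \pi_padic t)%qT.
Proof. by rewrite piE. Qed.
Lemma padic_piN (s : cauchy_seq) : (\pi_padic (- s) = - \pi_padic s)%qT.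
Proof. by rewrite piE. Qed.
Lemma padic_pi0 : (\pi_padic 0 = 0)%qT. Proof. by rewrite piE. Qed.

Lemma padic_pi_eq0 (s : cauchy_seq) :
  (\pi_padic s == 0)%qT = (s \in null_pred).
Proof. by rewrite -padic_pi0 -(Quotient.idealrBE null_ideal) subr0. Qed.

Definition inv_seq (s : cauchy_seq) : cauchy_seq :=
  insubd (0 : cauchy_seq) (fun k => (s k)^-1).

Lemma inv_seqE (s : cauchy_seq) : s \notin null_pred ->
  forall k, inv_seq s k = (s k)^-1.
Proof.
move=> /not_null[e [e0 [N HN]]] k; rewrite -[cseq _]/(val _) /inv_seq.
rewrite val_insubd ifT //; apply/asboolP => d d0.
have [M HM] := cauchy_seqP s (mulr_gt0 d0 (mulr_gt0 e0 e0)).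
exists (maxn N M) => m n; rewrite !geq_max => /andP[Nm Mm] /andP[Nn Mn].
have nz i : (N <= i)%N -> s i != 0.
  move=> Ni; apply: contraTneq (HN _ Ni) => ->.
  by rewrite ratabs0 -ltNge.
have -> : (s m)^-1 - (s n)^-1 = (s n - s m) * ((s m)^-1 * (s n)^-1).
  by rewrite mulrBl mulrCA divff ?nz // mulr1 mulrA divff ?nz // mul1r.
rewrite !ratabsM // !ratabsV // -invfM ltr_pdivrMr; last first.
  by rewrite mulr_gt0 // ratabs_gt0 ?nz.
apply: lt_le_trans (HM _ _ Mn Mm) _.
apply: ler_wpM2l; first exact: ltW.
by apply: ler_pM; rewrite ?HN // ltW.
Qed.

Definition padic_inv (x : padic) : padic :=
  if x == 0 then 0 else (\pi_padic (inv_seq (repr x)))%qT.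

Lemma padic_mulVf (x : padic) : x != 0 -> padic_inv x * x = 1.
Proof.
move=> x0; rewrite /padic_inv (negbTE x0) -{2}[x]reprK -padic_piM -padic_pi1.
have nx : repr x \notin null_pred by rewrite -padic_pi_eq0 reprK.
apply/padic_pi_eq => e e0.
have [d [d0 [N HN]]] := not_null nx; exists N => n Nn.
have sn : repr x n != 0.
  by apply: contraTneq (HN _ Nn) => ->; rewrite ratabs0 -ltNge.
rewrite (_ : cseq _ n = inv_seq (repr x) n * repr x n - 1) //.
by rewrite inv_seqE // mulVf // subrr ratabs0.
Qed.

Lemma padic_inv0 : padic_inv 0 = 0. Proof. by rewrite /padic_inv eqxx. Qed.

HB.instance Definition _ := GRing.ComNzRing_isField.Build padic
  padic_mulVf padic_inv0.

Definition padic_abs (x : padic) : R := limn (fun k => nq (repr x k)).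

Lemma ratabs_cvg (s : cauchy_seq) : cvgn (fun k => nq (s k)).
Proof.
apply: cauchy_cvg; apply/cauchy_exP => e e0.
have [N HN] := cauchy_seqP s e0; exists (nq (s N)); exists N => // k /= Nk.
by apply: le_lt_trans (ratabsB_sub _ p_prime _ _) _; exact: HN.
Qed.

Lemma padic_absE (s : cauchy_seq) :
  padic_abs (\pi_padic s)%qT = limn (fun k => nq (s k)).
Proof.
apply/cvg_lim => //; set t := repr _.
have /padic_pi_eq st : (\pi_padic t = \pi_padic s)%qT by rewrite reprK.
rewrite -[X in _ --> X]add0r.
rewrite (_ : (fun k => nq (t k)) =
  (fun k => (nq (t k) - nq (s k)) + nq (s k))); last first.
  by apply/funext => k; rewrite subrK.
apply: cvgD; last exact: ratabs_cvg.
apply/cvgrPdist_lt => e e0; have [N HN] := st _ e0; exists N => // k /= Nk.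
rewrite sub0r normrN; apply: le_lt_trans (ratabsB_sub _ p_prime _ _) _.
exact: HN.
Qed.

Lemma padic_abs_ge0 x : 0 <= padic_abs x.
Proof.
by apply: limr_ge; [exact: ratabs_cvg|apply: nearW => k; exact: ratabs_ge0].
Qed.

Lemma padic_abs0 : padic_abs 0 = 0.
Proof.
rewrite -padic_pi0 padic_absE; apply/cvg_lim => //.
rewrite (_ : (fun k => _) = cst 0); first exact: cvg_cst.
by apply/funext => k; rewrite ratabs0.
Qed.

Lemma padic_abs_eq0 x : padic_abs x = 0 -> x = 0.
Proof.
move=> x0; apply/eqP; rewrite -[x]reprK padic_pi_eq0.
apply: contraTT isT => /not_null[e [e0 [N HN]]].
have : e <= padic_abs x.
  by apply: limr_ge; [exact: ratabs_cvg|exists N].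
by rewrite x0 leNgt e0.
Qed.

Lemma padic_absN x : padic_abs (- x) = padic_abs x.
Proof.
rewrite -[x]reprK -padic_piN !padic_absE.
by congr (limn _); apply/funext => k /=; rewrite ratabsN.
Qed.

Lemma padic_absD x y : padic_abs (x + y) <= padic_abs x + padic_abs y.
Proof.
rewrite -[x]reprK -[y]reprK -padic_piD !padic_absE.
rewrite -limD; try exact: ratabs_cvg.
apply: ler_lim; first exact: ratabs_cvg.
  by apply: is_cvgD; exact: ratabs_cvg.
by apply: nearW => k; exact: ratabsD.
Qed.

Definition padic_dist (x y : padic) : R := padic_abs (x - y).

Lemma padic_distxx x : padic_dist x x = 0.
Proof. by rewrite /padic_dist subrr padic_abs0. Qed.

Lemma padic_dist_eq0 x y : padic_dist x y = 0 -> x = y.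
Proof. by move=> /padic_abs_eq0/eqP; rewrite subr_eq0 => /eqP. Qed.

Lemma padic_distC x y : padic_dist x y = padic_dist y x.
Proof. by rewrite /padic_dist -padic_absN opprB. Qed.

Lemma padic_dist_triangle y x z :
  padic_dist x z <= padic_dist x y + padic_dist y z.
Proof. by rewrite /padic_dist -{1}(subrK y x) -addrA padic_absD. Qed.

HB.instance Definition _ := isMetric.Build R padic
  padic_distxx padic_dist_eq0 padic_distC padic_dist_triangle.
HB.instance Definition _ := isPointed.Build padic 0.

End Padic.

Section PadicAnalysis.
Variables (R : realType) (p : nat) (p_prime : prime p) (n : nat).
Local Notation Qp := (padic R p_prime).
Local Notation V := 'rV[Qp]_n.
Local Notation C := R[i].

Definition padic_norm (xi : V) : R := \big[Num.max/0]_(i < n) padic_abs (xi 0 i).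

(* The p-adic fractional part: the element r of Z[1/p] with 0 <= r < 1 and
   x - r in Z_p; existence and uniqueness hold, 0 is a dummy default. *)
Definition padic_frac (x : Qp) : rat :=
  xget 0 [set r : rat | [/\ 0 <= r < 1,
    exists m : nat, r * p%:R ^+ m \is a Num.int &
    padic_abs (x - ratr r) <= 1]].

Definition padic_char (x : Qp) : C :=
  let t : R := 2 * pi * ratr (padic_frac x) in Complex (cos t) (sin t).

Definition dot (x xi : V) : Qp := \sum_(i < n) x 0 i * xi 0 i.

Definition borelV := g_sigma_algebraType (@open V).

(* Translation-invariant Borel measure with mu(Z_p^n) = 1: unique, hence the
   normalized Haar measure. *)
Definition normalized_haar (mu : {measure set borelV -> \bar R}) : Prop :=
  (forall (a : V) (A : set V), measurable (A : set borelV) ->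
     mu [set a + x | x in A] = mu A) /\
  mu [set x : V | padic_norm x <= 1] = 1%E.

Definition schwartz_bruhat (phi : V -> C) : Prop :=
  (forall x : V, \forall y \near x, phi y = phi x) /\
  compact (closure [set x : V | phi x != 0]).

Variable mu : {measure set borelV -> \bar R}.

Definition Cintegral (g : V -> C) : C :=
  Complex (Rintegral mu setT (fun x => complex.Re (g x)))
          (Rintegral mu setT (fun x => complex.Im (g x))).

Definition fourier (phi : V -> C) (xi : V) : C :=
  Cintegral (fun x => padic_char (- dot x xi) * phi x).

Definition Phi_space (M0 : nat) : set (V -> C) :=
  [set phi | schwartz_bruhat phi /\
    forall xi : V, padic_norm xi <= p%:R ^+ M0 -> fourier phi xi = 0].

Definition Xi (d : nat) (w : 'I_n -> nat) (xi : V) : R :=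
  \sum_(i < n) padic_abs (xi 0 i) `^ (d%:R / (w i)%:R).

Definition sobolev_norm d w (beta : R) (phi : V -> C) : R :=
  Num.sqrt (Rintegral mu setT (fun xi : borelV =>
    Num.max 1 (Xi d w xi) `^ (2 * beta) *
    ComplexField.Normc.normc (fourier phi xi) ^+ 2)).

(* A completion of (Phi_space M0, sobolev_norm); any two are canonically
   isometrically isomorphic. The values of the embedding outside Phi_space M0
   are irrelevant. *)
Record sobolev_completion (d : nat) (w : 'I_n -> nat) (M0 : nat) (beta : R) := {
  sobolev_carrier :> completeNormedModType C ;
  sobolev_emb : (V -> C) -> sobolev_carrier ;
  sobolev_emb_linear : forall (a : C) (phi psi : V -> C),
    Phi_space M0 phi -> Phi_space M0 psi ->
    sobolev_emb (fun x => a * phi x + psi x) =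
      a *: sobolev_emb phi + sobolev_emb psi ;
  sobolev_emb_norm : forall phi : V -> C, Phi_space M0 phi ->
    `|sobolev_emb phi| = real_complex R (sobolev_norm d w beta phi) ;
  sobolev_emb_dense : dense (sobolev_emb @` Phi_space M0) }.

(* The inclusion of the completion in L^2: g is an L^2 limit of a sequence of
   elements of Phi_space M0 that converges to u in the completion. *)
Definition represents d w M0 beta (H : sobolev_completion d w M0 beta)
    (u : H) (g : V -> C) : Prop :=
  [/\ measurable_fun setT (fun x : borelV => complex.Re (g x)),
      measurable_fun setT (fun x : borelV => complex.Im (g x)) &
      exists phi : nat -> V -> C,
        [/\ forall k, Phi_space M0 (phi k),
            (fun k => sobolev_emb H (phi k)) @ \oo --> u &
            (fun k => \int[mu]_x
               ((ComplexField.Normc.normc (phi k x - g x) ^+ 2)%:E))%E @ \oo --> 0%E]].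

Definition poly_eval (f : mpoly n Qp) (xi : V) : Qp :=
  meval (fun i => xi 0 i) f.

(* The third clause is the standing convention that quasielliptic polynomials
   have coefficients in Z_p. *)
Definition quasielliptic (f : mpoly n Qp) (d : nat) (w : 'I_n -> nat) :=
  [/\ forall i, (0 < w i)%N,
      forall a : Qp, f <> mpolyC n a,
      forall m, padic_abs (mcoeff m f) <= 1,
      forall (lambda : Qp) (xi : V), lambda != 0 ->
        poly_eval f (\row_i (lambda ^+ w i * xi 0 i)) =
          lambda ^+ d * poly_eval f xi &
      forall xi : V, poly_eval f xi = 0 <-> xi = 0].

Definition weight (w : 'I_n -> nat) (k : multinom n) : nat :=
  (\sum_(i < n) k i * w i)%N.

(* Since the weights are positive, <k, w> <= d - 1 forces |k| < d, so that the
   sum over bounded multi-indices ranges over all k with <k, w> <= d - 1. *)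
Definition symbol (f : mpoly n Qp) (d : nat) (w : 'I_n -> nat)
    (c : multinom n -> V -> Qp) (xi x : V) : Qp :=
  poly_eval f xi +
  \sum_(k : bmultinom n d | (weight w k < d)%N)
     c k x * mmap1 (fun i => xi 0 i) k.

Definition semi_quasielliptic (f : mpoly n Qp) (d : nat) (w : 'I_n -> nat)
    (c : multinom n -> V -> Qp) : Prop :=
  quasielliptic f d w /\
  forall k, (weight w k < d)%N ->
    exists B : R, forall x : V, padic_abs (c k x) <= B.

(* F xi x is the value at the frequency xi and the point x. *)
Definition pseudo_diff (F : V -> V -> Qp) (alpha : R) (phi : V -> C) (x : V) : C :=
  Cintegral (fun xi => padic_char (dot x xi) *
    real_complex R (padic_abs (F xi x) `^ alpha) * fourier phi xi).

End PadicAnalysis.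

(* Main.v *)
(* By the ultrametric inequality the lower order terms of F(xi, x) are
   negligible for large xi: |F(xi, x)| = |f(xi)| there, independently of x, and
   |f| is comparable to Xi by weighted homogeneity (dilation by powers of p) and
   compactness. On Phi_M0 the operator is therefore the Fourier multiplier
   |f|^alpha, a bijection of Phi_M0 (inverse: |f|^(-alpha)) with two-sided bounds
   between the Sobolev norms of orders beta and beta - alpha, and it extends to
   an isomorphism of the completions. If beta is large, summing
   max(1, Xi)^(-2 beta) over the p-adic shells gives a convergent geometric
   series, so the sup norm of phi is bounded by its Sobolev norm: elements of the
   completion are uniform limits of functions that are invariant under
   translation by some ball. *)

Require Import Defs.
From HB Require Import structures.
From mathcomp Require Import all_boot all_order all_algebra.
From mathcomp Require Import all_classical all_reals all_analysis.
From mathcomp Require Import measurable_realfun.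
From mathcomp Require Import complex.
From mathcomp Require Import -(notations) mpoly.
From mathcomp Require Import ring lra zify.
Import Order.TTheory GRing.Theory Num.Theory.
Import numFieldNormedType.Exports.
Local Open Scope classical_set_scope.
Local Open Scope ring_scope.

Set Implicit Arguments.
Unset Strict Implicit.
Unset Printing Implicit Defensive.

(** * The p-adic numbers and their additive character *)

(** The measure is known only through translation invariance and the volume of Z_p^n, so all Fourier
    analysis is reduced to indicators of balls. Volumes come from cutting balls along digits; shift
    invariance, inversion and Parseval are linear or sesquilinear in the test functions, and become
    explicit computations in which the ball of radius p^k is dual to the ball of radius p^(-k). The
    vanishing condition in [Phi_space] is what keeps the operator inside the test functions:
    |f|^alpha is locally constant away from the origin only, and the transforms vanish around the
    origin. It also makes the negative power harmless. The completions are abstract Banach spaces,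
    not function spaces, so the extended operator is built from the closure of a graph and meets
    functions only through [represents]. A uniform limit of approximants has still to be recognized
    as their L^2 limit; Fatou's lemma does this without completeness of L^2. The supremum bound uses
    a weighted arithmetic-geometric inequality with a free parameter in place of Cauchy-Schwarz. *)

Section PadicNumbers.
Context {R : realType} {p : nat} {p_prime : prime p}.
Local Notation Qp := (padic R p_prime).
Implicit Types x y z : Qp.

Lemma prime_gt1R : 1 < p%:R :> R. Proof. by rewrite ltr1n prime_gt1. Qed.
Lemma prime_gt0R : 0 < p%:R :> R. Proof. by rewrite ltr0n prime_gt0. Qed.
Hint Resolve prime_gt1R prime_gt0R : core.

Lemma padic_abs1 : padic_abs (1 : Qp) = 1.
Proof.
rewrite -padic_pi1 padic_absE (_ : (fun k => _) = cst 1) ?lim_cst//.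
by apply/funext => k; exact: ratabs1.
Qed.

Lemma padic_absM x y : padic_abs (x * y) = padic_abs x * padic_abs y.
Proof.
rewrite -[x]reprK -[y]reprK -padic_piM !padic_absE.
rewrite -limM; [|exact: ratabs_cvg|exact: ratabs_cvg].
by congr (limn _); apply/funext => k /=; rewrite -ratabsM.
Qed.

Lemma padic_abs_gt0 x : (0 < padic_abs x) = (x != 0).
Proof.
rewrite lt_def padic_abs_ge0 andbT; congr negb; apply/eqP/eqP => [|->].
  exact: padic_abs_eq0.
exact: padic_abs0.
Qed.

Lemma padic_absV x : padic_abs x^-1 = (padic_abs x)^-1.
Proof.
have [->|x0] := eqVneq x 0; first by rewrite invr0 padic_abs0 invr0.
have ax : padic_abs x != 0 by rewrite gt_eqF ?padic_abs_gt0.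
by apply: (mulfI ax); rewrite -padic_absM !divff// padic_abs1.
Qed.

Lemma padic_absX x k : padic_abs (x ^+ k) = padic_abs x ^+ k.
Proof.
elim: k => [|k IH]; first by rewrite !expr0 padic_abs1.
by rewrite !exprS padic_absM IH.
Qed.

Lemma padic_absXz x (k : int) : padic_abs (x ^ k) = padic_abs x ^ k.
Proof.
case: k => k; first exact: padic_absX.
by rewrite /exprz padic_absV padic_absX.
Qed.

Lemma padic_abs_max x y :
  padic_abs (x + y) <= Num.max (padic_abs x) (padic_abs y).
Proof.
rewrite -[x]reprK -[y]reprK -padic_piD !padic_absE.
set a := limn (fun k => ratabs R p (repr x k)).
set b := limn (fun k => ratabs R p (repr y k)).
have cm : (fun k => Num.max (ratabs R p (repr x k)) (ratabs R p (repr y k)))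
    @ \oo --> Num.max a b.
  (* The maximum is written as half of a + b + |a - b|, which is continuous in a and b. *)
  rewrite maxr_absE; under eq_fun do rewrite maxr_absE.
  apply: cvgMr_tmp; apply: cvgD; first by apply: cvgD; exact: ratabs_cvg.
  by apply: cvg_norm; apply: cvgB; exact: ratabs_cvg.
rewrite -(cvg_lim _ cm)//; apply: ler_lim; first exact: ratabs_cvg.
  by apply/cvg_ex; eexists; exact: cm.
by apply: nearW => k; exact: ratabsD_max.
Qed.

Lemma padic_absB_max x y :
  padic_abs (x - y) <= Num.max (padic_abs x) (padic_abs y).
Proof. by rewrite -(padic_absN y) padic_abs_max. Qed.

Lemma padic_abs_sum_le (I : finType) (P : pred I) (F : I -> Qp) (M : R) :
  0 <= M -> (forall i, P i -> padic_abs (F i) <= M) ->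
  padic_abs (\sum_(i | P i) F i) <= M.
Proof.
move=> M0 FM; elim/big_rec: _ => [|i y Pi yM]; first by rewrite padic_abs0.
by rewrite (le_trans (padic_abs_max _ _))// ge_max FM.
Qed.

Lemma padic_abs_sum_lt (I : finType) (P : pred I) (F : I -> Qp) (M : R) :
  0 < M -> (forall i, P i -> padic_abs (F i) < M) ->
  padic_abs (\sum_(i | P i) F i) < M.
Proof.
move=> M0 FM; elim/big_rec: _ => [|i y Pi yM]; first by rewrite padic_abs0.
by rewrite (le_lt_trans (padic_abs_max _ _))// gt_max FM.
Qed.

Lemma padic_absD_lt x y : padic_abs y < padic_abs x ->
  padic_abs (x + y) = padic_abs x.
Proof.
move=> yx; apply/eqP; rewrite eq_le (le_trans (padic_abs_max _ _))//=; last first.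
  by rewrite ge_max lexx ltW.
have := padic_absB_max (x + y) y; rewrite addrK le_max => /orP[//|].
by rewrite leNgt yx.
Qed.

Lemma rat_const_cauchy (r : rat) : (fun=> r) \in @cauchy_pred R p p_prime.
Proof.
by apply/asboolP => e e0; exists 0%N => m n _ _; rewrite subrr ratabs0.
Qed.

(** Constant Cauchy sequences: on them the ring operations and the absolute value are read off from
    Q. By [rat_padicE] this is the embedding [ratr] that [padic_frac] uses. *)
Definition rat_padic (r : rat) : Qp :=
  (\pi_(padic R p_prime) (CauchySeq (rat_const_cauchy r)))%qT.

Lemma rat_padicD : {morph rat_padic : a b / a + b}.
Proof.
move=> a b; rewrite -padic_piD; congr (\pi_(padic R p_prime) _)%qT.
exact/val_inj/funext.
Qed.

Lemma rat_padicN : {morph rat_padic : a / - a}.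
Proof.
move=> a; rewrite -padic_piN; congr (\pi_(padic R p_prime) _)%qT.
exact/val_inj/funext.
Qed.

Lemma rat_padicM : {morph rat_padic : a b / a * b}.
Proof.
move=> a b; rewrite -padic_piM; congr (\pi_(padic R p_prime) _)%qT.
exact/val_inj/funext.
Qed.

Lemma rat_padic1 : rat_padic 1 = 1.
Proof.
rewrite -padic_pi1; congr (\pi_(padic R p_prime) _)%qT.
exact/val_inj/funext.
Qed.

Lemma rat_padic_zmod : zmod_morphism rat_padic.
Proof. by move=> a b; rewrite rat_padicD rat_padicN. Qed.

Lemma rat_padic_monoid : monoid_morphism rat_padic.
Proof. by split; [exact: rat_padic1|exact: rat_padicM]. Qed.

HB.instance Definition _ := GRing.isZmodMorphism.Build rat Qp rat_padic rat_padic_zmod.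
HB.instance Definition _ := GRing.isMonoidMorphism.Build rat Qp rat_padic rat_padic_monoid.

Lemma rat_padicE (r : rat) : ratr r = rat_padic r.
Proof.
rewrite -[in RHS](divq_num_den r) fmorph_div !rmorph_int /=.
by rewrite /ratr.
Qed.

Lemma ratr_padicB (r s : rat) : ratr (r - s) = ratr r - ratr s :> Qp.
Proof. by rewrite !rat_padicE rmorphB. Qed.

Lemma padic_abs_rat (r : rat) : padic_abs (ratr r : Qp) = ratabs R p r.
Proof. by rewrite rat_padicE padic_absE /= lim_cst. Qed.

Opaque padic_abs.

Lemma padic_approx x (e : R) : 0 < e -> exists r : rat, padic_abs (x - ratr r) < e.
Proof.
move=> e0; rewrite -[x]reprK; set s := repr x.
have e20 : 0 < e / 2 by rewrite divr_gt0.
have [N HN] := cauchy_seqP s e20; exists (s N).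
rewrite rat_padicE /rat_padic -padic_piN -padic_piD padic_absE.
apply: (@le_lt_trans _ _ (e / 2)); last by rewrite gtr_pMr// invf_lt1// ltr1n.
apply: limr_le; first exact: ratabs_cvg.
by exists N => // k /= Nk; apply/ltW/HN.
Qed.

Lemma ratabs_pvalue (r : rat) : r != 0 -> exists k : int, ratabs R p r = p%:R ^ k.
Proof. by rewrite /ratabs => /negbTE ->; eexists. Qed.

(** The value group does not grow under completion: a rational closer to x than |x| has the absolute
    value of x, by the isosceles property [padic_absD_lt]. *)
Lemma padic_abs_value x : x != 0 -> exists k : int, padic_abs x = p%:R ^ k.
Proof.
move=> x0; have ax : 0 < padic_abs x by rewrite padic_abs_gt0.
have [r rx] := padic_approx x ax.
have E : padic_abs x = ratabs R p r.
  rewrite -padic_abs_rat -[in RHS](subrK x (ratr r)) addrC padic_absD_lt//.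
  by rewrite -padic_absN opprB.
rewrite E; apply: ratabs_pvalue; apply: contraTneq ax => r0.
by rewrite E r0 ratabs0 ltxx.
Qed.

Lemma ratabs_p : ratabs R p p%:R = p%:R^-1.
Proof.
have p0 : (p%:R : rat) != 0 by rewrite pnatr_eq0 -lt0n prime_gt0.
rewrite /ratabs (negbTE p0).
have -> : (p%:R : rat) = (p%:Z)%:Q / (1%:Z)%:Q by rewrite divr1.
rewrite ratord_div ?oner_eq0//; last by rewrite eqz_nat -lt0n prime_gt0.
by rewrite /= logn1 subr0 logn_prime// eqxx exprN1.
Qed.

Lemma padic_abs_p : padic_abs (p%:R : Qp) = p%:R^-1.
Proof.
have -> : (p%:R : Qp) = ratr p%:R by rewrite rat_padicE rmorph_nat.
by rewrite padic_abs_rat ratabs_p.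
Qed.

Lemma padic_p_neq0 : (p%:R : Qp) != 0.
Proof. by rewrite -padic_abs_gt0 padic_abs_p invr_gt0. Qed.

Lemma padic_abs_pz (k : int) : padic_abs ((p%:R : Qp) ^ k) = p%:R ^ (- k).
Proof. by rewrite padic_absXz padic_abs_p exprz_inv. Qed.

(** Discreteness of the value group: an open ball is the closed ball of the next smaller
    exponent. *)
Lemma padic_abs_le_pred x (k : int) :
  (padic_abs x < p%:R ^ k) = (padic_abs x <= p%:R ^ (k - 1)).
Proof.
have [->|x0] := eqVneq x 0.
  by rewrite padic_abs0 exprz_gt0// exprz_ge0// ltW.
have [j ->] := padic_abs_value x0.
by rewrite ltr_eXz2l// ler_eXz2l//; lia.
Qed.

Lemma ratabs_int_le1 (z : int) : ratabs R p z%:~R <= 1.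
Proof.
have [->|z0] := eqVneq z 0; first by rewrite ratabs0.
rewrite /ratabs intr_eq0 (negbTE z0) /ratord numq_int denq_int/= logn1 subr0.
by rewrite -exprnN invf_le1 ?exprn_gt0// exprn_ege1// ltW.
Qed.

Lemma ratabs_int_dvd (z : int) (m : nat) :
  ratabs R p z%:~R <= p%:R ^- m -> ((p ^ m)%N %| `|z|)%N.
Proof.
have [->|z0] := eqVneq z 0; first by rewrite dvdn0.
rewrite /ratabs intr_eq0 (negbTE z0) /ratord numq_int denq_int/= logn1 subr0.
rewrite -exprnN lef_pV2 ?posrE ?exprn_gt0// ler_eXn2l// => mz.
by rewrite pfactor_dvdn// absz_gt0.
Qed.

(** Z[1/p] and Z_p meet in Z: in z / p^m the numerator must absorb the whole denominator. Uniqueness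
    of the fractional part and additivity of the character both come from this. *)
Lemma rat_int_of_ratabs (r : rat) (m : nat) :
  r * p%:R ^+ m \is a Num.int -> ratabs R p r <= 1 -> r \is a Num.int.
Proof.
have p0 : (p%:R : rat) != 0 by rewrite pnatr_eq0 -lt0n prime_gt0.
move=> /intrP[z zr] r1; have rE : r = z%:~R / p%:R ^+ m.
  by rewrite -zr mulfK// expf_neq0.
have : ratabs R p z%:~R <= p%:R ^- m.
  rewrite -zr ratabsM// -natrX.
  have -> : ratabs R p (p ^ m)%:R = p%:R ^- m.
    rewrite -padic_abs_rat rat_padicE natrX rmorphXn/= padic_absX rmorph_nat padic_abs_p.
    by rewrite exprVn.
  by rewrite ler_piMl// invr_ge0 exprn_ge0// ltW.
move=> /ratabs_int_dvd; rewrite -[(p ^ m)%N]absz_nat -dvdzE => /dvdzP[q qz].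
have -> : r = q%:~R; last exact: intr_int.
by rewrite rE qz intrM -pmulrn natrX mulfK// expf_neq0.
Qed.

Lemma ratabs_coprime (b : nat) : coprime p b -> ratabs R p b%:R = 1.
Proof.
move=> cpb; have b0 : b != 0%N.
  by apply: contraTneq cpb => ->; rewrite /coprime gcdn0 neq_ltn prime_gt1 ?orbT.
rewrite /ratabs pnatr_eq0 (negbTE b0).
have -> : (b%:R : rat) = b%:Z%:~R by [].
rewrite /ratord numq_int denq_int/= logn1 subr0.
by rewrite logn_coprime.
Qed.

Lemma ratr_padic_nat (m : nat) : ratr m%:R = m%:R :> Qp.
Proof. by rewrite rat_padicE rmorph_nat. Qed.

Lemma padic_abs_nat_le1 (m : nat) : padic_abs (m%:R : Qp) <= 1.
Proof. by rewrite -ratr_padic_nat padic_abs_rat; exact: (ratabs_int_le1 m%:Z). Qed.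

Definition is_frac x (r : rat) := [/\ 0 <= r < 1,
  exists m : nat, r * p%:R ^+ m \is a Num.int & padic_abs (x - ratr r) <= 1].

(** A rational r0 = a / (b' p^m) near x, with b' prime to p, is split into partial fractions: Bezout
    coefficients of b' and p^m give the numerator over p^m, reduced modulo p^m; what remains has
    denominator b' and is a p-adic integer. *)
Lemma frac_exists x : exists r, is_frac x r.
Proof.
have [r0 r0x] := padic_approx x ltr01.
set a := numq r0; set b := `|denq r0|%N.
have bgt0 : (0 < b)%N by rewrite absz_gt0.
have bE : denq r0 = b%:Z by rewrite gez0_abs.
have [b' cpb' bb'] := pfactor_coprime p_prime bgt0; set m := logn p b in bb'.
have cbm : coprimez b'%:Z (p ^ m)%N%:Z.
  by rewrite coprimezE/= coprime_sym coprimeXl.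
have [[u v] /= uv] := coprimezP _ _ cbm.
set P := (p ^ m)%N%:Z in cbm uv.
have P0 : P != 0 by rewrite eqz_nat -lt0n expn_gt0 prime_gt0.
have Pgt0 : 0 < P by rewrite ltz_nat expn_gt0 prime_gt0.
have b'0 : (b'%:R : rat) != 0.
  rewrite pnatr_eq0; apply: contraTneq bgt0 => b'0.
  by rewrite bb' b'0 mul0n.
pose c := ((a * u) %% P)%Z; exists (c%:~R / P%:~R); split.
- rewrite divr_ge0 ?ler0z ?modz_ge0 ?ltW// ltr_pdivrMr ?ltr0z// mul1r ltr_int.
  by rewrite ltz_pmod.
- exists m; rewrite [P%:~R](natrX _ p m) divfK ?intr_int//.
  by rewrite -natrX pnatr_eq0 -lt0n expn_gt0 prime_gt0.
have -> : x - ratr (c%:~R / P%:~R) =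
    (x - ratr r0) + ratr (r0 - c%:~R / P%:~R).
  rewrite !rat_padicE [rat_padic (r0 - _)]rmorphB/=; ring.
rewrite (le_trans (padic_abs_max _ _))// ge_max (ltW r0x)/= padic_abs_rat.
have [q cE] : exists q, c = a * u - q * P.
  by exists ((a * u) %/ P)%Z.
have -> : r0 - c%:~R / P%:~R = (a * v + q * b'%:Z)%:~R / b'%:R.
  rewrite -[r0]divq_num_den -/a bE bb' PoszM -/P.
  have -> : (a * v + q * b'%:Z) = ((a - c * b'%:Z) %/ P)%Z.
    rewrite cE; have -> : a - (a * u - q * P) * b'%:Z = (a * v + q * b'%:Z) * P.
      rewrite -{1}(mulr1 a) -uv; ring.
    by rewrite mulzK.
  have : a - c * b'%:Z = ((a - c * b'%:Z) %/ P)%Z * P.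
    rewrite divzK//; apply/dvdzP; exists (a * v + q * b'%:Z).
    rewrite cE -{1}(mulr1 a) -uv; ring.
  set N := (_ %/ _)%Z => /(congr1 (fun z : int => z%:~R : rat)).
  rewrite intrD intrN !intrM => NE.
  have PQ : (P%:~R : rat) != 0 by rewrite intr_eq0.
  rewrite -pmulrn in NE *; apply: (mulIf PQ); apply: (mulIf b'0).
  rewrite mulrAC -[RHS]mulrAC divfK// -NE; field.
  by rewrite b'0 PQ.
rewrite ratabsM// ratabsV// ratabs_coprime// invr1 mulr1.
exact: ratabs_int_le1.
Qed.

Lemma is_frac_uniq x r s : is_frac x r -> is_frac x s -> r = s.
Proof.
move=> [/andP[r0 r1] [m rm] xr] [/andP[s0 s1] [k sk] xs].
have : r - s \is a Num.int.
  apply: (@rat_int_of_ratabs _ (m + k)).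
    have -> : (r - s) * p%:R ^+ (m + k) =
        r * p%:R ^+ m * p%:R ^+ k - s * p%:R ^+ k * p%:R ^+ m by rewrite exprD; ring.
    by rewrite rpredB// rpredM// -natrX; exact: natr_int.
  rewrite -padic_abs_rat.
  have -> : ratr (r - s) = (x - ratr s) - (x - ratr r) :> Qp.
    by rewrite !rat_padicE rmorphB/=; ring.
  apply: (le_trans (padic_absB_max _ _)); rewrite ge_max.
  by apply/andP; split; [exact: xs|exact: xr].
move=> /intrP[z zE].
have z1 : (z%:~R : rat) < 1 by rewrite -zE; lra.
have zN1 : (-1 : rat) < z%:~R by rewrite -zE; lra.
have z0 : z = 0.
  have : (-1)%:~R < (z%:~R : rat) by rewrite intrN.
  by move: z1; rewrite ltrz1 ltr_int; lia.
by apply/eqP; rewrite -subr_eq0 zE z0.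
Qed.

Lemma padic_fracP x : is_frac x (padic_frac x).
Proof. by have [r xr] := frac_exists x; exact: (xgetPex 0 (ex_intro _ r xr)). Qed.

Lemma padic_fracE x r : is_frac x r -> padic_frac x = r.
Proof. exact/is_frac_uniq/padic_fracP. Qed.

(** The defect has a power of p as denominator and is a p-adic integer, hence it is an integer,
    which e^(2 pi i r) does not see. *)
Lemma padic_fracD x y :
  padic_frac (x + y) - padic_frac x - padic_frac y \is a Num.int.
Proof.
have [_ [m1 i1] a1] := padic_fracP (x + y).
have [_ [m2 i2] a2] := padic_fracP x.
have [_ [m3 i3] a3] := padic_fracP y.
apply: (@rat_int_of_ratabs _ (m1 + m2 + m3)); last first.
  rewrite -padic_abs_rat.
  have -> : ratr (padic_frac (x + y) - padic_frac x - padic_frac y) =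
     (x - ratr (padic_frac x)) + (y - ratr (padic_frac y))
       - (x + y - ratr (padic_frac (x + y))) :> Qp.
    rewrite !ratr_padicB; move: (ratr _) (ratr _) (ratr _) => u v w; ring.
  apply: (le_trans (padic_absB_max _ _)); rewrite ge_max; apply/andP; split.
    apply: (le_trans (padic_abs_max _ _)); rewrite ge_max; apply/andP; split.
      exact: a2.
    exact: a3.
  exact: a1.
have -> : (padic_frac (x + y) - padic_frac x - padic_frac y) * p%:R ^+ (m1 + m2 + m3)
  = padic_frac (x + y) * p%:R ^+ m1 * p%:R ^+ (m2 + m3)
    - padic_frac x * p%:R ^+ m2 * p%:R ^+ (m1 + m3)
   - padic_frac y * p%:R ^+ m3 * p%:R ^+ (m1 + m2).
  by move: (padic_frac _) (padic_frac _) (padic_frac _) => u v w; rewrite !exprD; ring.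
by rewrite !rpredB// rpredM// -natrX; exact: natr_int.
Qed.

Local Notation C := R[i].

Definition rat_char (r : rat) : C :=
  let t : R := 2 * pi * ratr r in Complex (cos t) (sin t).

Lemma rat_charD r s : rat_char (r + s) = rat_char r * rat_char s.
Proof.
rewrite /rat_char rmorphD mulrDr cosD sinD; apply/eqP.
by rewrite eq_complex/= eqxx/= addrC.
Qed.

Lemma rat_char0 : rat_char 0 = 1.
Proof. by rewrite /rat_char rmorph0 mulr0 cos0 sin0. Qed.

Lemma rat_char1 : rat_char 1 = 1.
Proof.
by rewrite /rat_char rmorph1 mulr1 mulr_natl cos2pi sin2pi.
Qed.

Lemma rat_charN_mul r : rat_char (- r) * rat_char r = 1.
Proof. by rewrite -rat_charD addNr rat_char0. Qed.

Lemma rat_char_int r : r \is a Num.int -> rat_char r = 1.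
Proof.
have nat1 (n : nat) : rat_char n%:R = 1.
  elim: n => [|n IH]; first exact: rat_char0.
  by rewrite -addn1 natrD rat_charD IH rat_char1 mulr1.
move=> /intrP[[n|n] ->]; first exact: nat1.
by have := rat_charN_mul n.+1%:R; rewrite nat1 mulr1 NegzE intrN.
Qed.

Lemma padic_charE x : padic_char x = rat_char (padic_frac x).
Proof. by []. Qed.

Lemma padic_charD x y : padic_char (x + y) = padic_char x * padic_char y.
Proof.
rewrite !padic_charE -rat_charD.
have := padic_fracD x y; move: (padic_frac _) (padic_frac _) (padic_frac _).
move=> c b a abc; have -> : a = (a - b - c) + (b + c) by ring.
by rewrite [LHS]rat_charD rat_char_int// mul1r.
Qed.

Lemma padic_char_le1 x : padic_abs x <= 1 -> padic_char x = 1.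
Proof.
move=> x1; rewrite padic_charE (@padic_fracE x 0) ?rat_char0//; split => //.
  by exists 0%N; rewrite mul0r.
by rewrite rat_padicE rmorph0 subr0.
Qed.

Lemma padic_char0 : padic_char (0 : Qp) = 1.
Proof. by rewrite padic_char_le1// padic_abs0. Qed.

Lemma padic_char_mulN x : padic_char (- x) * padic_char x = 1.
Proof. by rewrite -padic_charD addNr padic_char0. Qed.

Lemma padic_char_norm x :
  complex.Re (padic_char x) ^+ 2 + complex.Im (padic_char x) ^+ 2 = 1.
Proof. by rewrite /= cos2Dsin2. Qed.

Lemma padic_char_pV : padic_char (p%:R^-1 : Qp) != 1.
Proof.
rewrite padic_charE (@padic_fracE _ (p%:R^-1)); last first.
  have p0 : (0 : rat) < p%:R by rewrite ltr0n prime_gt0.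
  split.
  - by rewrite invr_ge0 ltW//= invf_lt1// ltr1n prime_gt1.
  - by exists 1%N; rewrite expr1 mulVf// gt_eqF.
  - by rewrite rat_padicE fmorphV rmorph_nat subrr padic_abs0.
rewrite /rat_char fmorphV/= ratr_nat eq_complex/= negb_and; apply/orP; left.
(* Half of the angle 2 pi / p: as 0 < t < pi, sin t is positive, whereas cos (2 t) = 1 would force
   it to vanish. *)
set t := pi / p%:R : R.
have -> : 2 * pi / p%:R = t + t by rewrite /t; field; rewrite gt_eqF.
rewrite cosD -!expr2 cos2sin2.
have t0 : 0 < t by rewrite divr_gt0// pi_gt0.
have tpi : t < pi by rewrite ltr_pdivrMr// ltr_pMr// pi_gt0.
have : 0 < sin t by apply: sin_gt0_pi; rewrite t0.
move=> s0; have : 0 < sin t ^+ 2 by rewrite exprn_gt0.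
by lra.
Qed.

Lemma padic_char_nontrivial x : 1 < padic_abs x ->
  exists2 y, padic_abs y <= 1 & padic_char (x * y) != 1.
Proof.
move=> x1; have x0 : x != 0 by rewrite -padic_abs_gt0 (lt_trans _ x1).
(* With this y the product x * y is 1 / p, and |x| > 1 means |x| >= p, so that |y| <= 1. *)
exists ((p%:R * x)^-1); last first.
  by rewrite invfM mulrCA divff// mulr1 padic_char_pV.
rewrite padic_absV invf_le1 ?padic_abs_gt0 ?mulf_neq0 ?padic_p_neq0//.
rewrite padic_absM padic_abs_p ler_pdivlMl// mulr1.
have [k xk] := padic_abs_value x0; rewrite xk in x1 *.
rewrite -[X in X <= _](expr1z p%:R) ler_eXz2l//.
by move: x1; rewrite -[X in X < _ ](expr0z p%:R) ltr_eXz2l//; lia.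
Qed.

End PadicNumbers.

(** * Balls and compactness in the p-adic space *)

Section PadicSpace.
Context {R : realType} {p : nat} {p_prime : prime p} {n : nat}.
Local Notation Qp := (padic R p_prime).
Local Notation V := 'rV[Qp]_n.
Let p_gt1 := @prime_gt1R R p p_prime.
Let p_gt0 := @prime_gt0R R p p_prime.
Hint Resolve p_gt1 p_gt0 : core.
Implicit Types x y a b : V.

Lemma pexpz_gt0 (k : int) : 0 < (p%:R : R) ^ k.
Proof. by rewrite exprz_gt0. Qed.
Hint Resolve pexpz_gt0 : core.

Lemma pexpz_ge0 (k : int) : 0 <= (p%:R : R) ^ k.
Proof. exact: ltW. Qed.
Hint Resolve pexpz_ge0 : core.

Lemma le_pexpz (j k : int) : ((p%:R : R) ^ j <= p%:R ^ k) = (j <= k).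
Proof. exact: ler_eXz2l. Qed.

Lemma lt_pexpz (j k : int) : ((p%:R : R) ^ j < p%:R ^ k) = (j < k).
Proof. exact: ltr_eXz2l. Qed.

Lemma pexp_unbounded (M : R) : exists k : nat, M < p%:R ^ k%:Z.
Proof.
have [M0|M0] := leP 0 M; last by exists 0%N; rewrite expr0z (lt_trans M0).
exists (Num.bound M); apply: (lt_le_trans (archi_boundP M0)).
by rewrite -exprnP -natrX ler_nat ltnW// ltn_expl// prime_gt1.
Qed.

Lemma pexp_small (e : R) : 0 < e -> exists k : nat, p%:R ^ (- k%:Z) < e.
Proof.
move=> e0; have [k ek] := pexp_unbounded e^-1; exists k.
by rewrite -exprnN -[e]invrK ltf_pV2 ?posrE ?invr_gt0 ?exprn_gt0// exprnP.
Qed.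

Lemma padic_norm_ge0 x : 0 <= padic_norm x.
Proof. by rewrite /padic_norm; apply: bigmax_ge_id. Qed.
Hint Resolve padic_norm_ge0 : core.

Lemma padic_norm_leP x (e : R) : 0 <= e ->
  padic_norm x <= e <-> forall i, padic_abs (x 0 i) <= e.
Proof.
move=> e0; split=> [/bigmax_leP[_ H] i|H]; first exact: H.
by apply/bigmax_leP; split.
Qed.

Lemma padic_norm_ltP x (e : R) : 0 < e ->
  padic_norm x < e <-> forall i, padic_abs (x 0 i) < e.
Proof.
move=> e0; split=> [/bigmax_ltP[_ H] i|H]; first exact: H.
by apply/bigmax_ltP; split.
Qed.

Lemma padic_abs_le_norm x i : padic_abs (x 0 i) <= padic_norm x.
Proof. exact: (le_bigmax _ (fun i => padic_abs (x 0 i))). Qed.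

Lemma padic_normN x : padic_norm (- x) = padic_norm x.
Proof. by apply: eq_bigr => i _; rewrite mxE padic_absN. Qed.

Lemma padic_norm0 : padic_norm (0 : V) = 0.
Proof.
apply/le_anti; rewrite padic_norm_ge0 andbT; apply/padic_norm_leP => // i.
by rewrite mxE padic_abs0.
Qed.

Lemma padic_norm_max x y :
  padic_norm (x + y) <= Num.max (padic_norm x) (padic_norm y).
Proof.
apply/padic_norm_leP => [|i]; first by rewrite le_max padic_norm_ge0.
rewrite mxE; apply: (le_trans (padic_abs_max _ _)).
by rewrite ge_max !le_max !padic_abs_le_norm orbT.
Qed.

Lemma padic_normD_le x y (e : R) : padic_norm x <= e -> padic_norm y <= e ->
  padic_norm (x + y) <= e.
Proof. by move=> xe ye; apply: (le_trans (padic_norm_max _ _)); rewrite ge_max xe. Qed.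

Lemma padic_normBC x y : padic_norm (x - y) = padic_norm (y - x).
Proof. by rewrite -padic_normN opprB. Qed.

Lemma padic_norm_lt_pred x (k : int) :
  (padic_norm x < p%:R ^ k) = (padic_norm x <= p%:R ^ (k - 1)).
Proof.
apply/idP/idP => [/padic_norm_ltP H|/padic_norm_leP H].
  by apply/padic_norm_leP => // i; rewrite -padic_abs_le_pred H.
by apply/padic_norm_ltP => // i; rewrite padic_abs_le_pred H.
Qed.

Lemma dot_abs_le x y : padic_abs (dot x y) <= padic_norm x * padic_norm y.
Proof.
apply: padic_abs_sum_le => [|i _]; first by rewrite mulr_ge0.
by rewrite padic_absM ler_pM ?padic_abs_ge0// padic_abs_le_norm.
Qed.

Lemma dotDl x y a : dot (x + y) a = dot x a + dot y a.
Proof. by rewrite /dot -big_split; apply: eq_bigr => i _; rewrite mxE mulrDl. Qed.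

Lemma dotDr x y a : dot a (x + y) = dot a x + dot a y.
Proof. by rewrite /dot -big_split; apply: eq_bigr => i _; rewrite mxE mulrDr. Qed.

Lemma dotNr x a : dot a (- x) = - dot a x.
Proof. by rewrite /dot -sumrN; apply: eq_bigr => i _; rewrite mxE mulrN. Qed.

(** Balls are indexed by the exponent of the radius, which may be negative. By [zball_sym] and
    [zball_trans] those of one radius are the cosets of a subgroup, so that two of them coincide or
    are disjoint. *)
Definition zball a (k : int) : set V := [set x | padic_norm (x - a) <= p%:R ^ k].

Lemma zball_center a k : zball a k a.
Proof. by rewrite /zball /= subrr padic_norm0. Qed.

Lemma zball0E k x : zball 0 k x = (padic_norm x <= p%:R ^ k) :> Prop.
Proof. by rewrite /zball/= subr0. Qed.

Lemma zball_sub a (j k : int) : j <= k -> zball a j `<=` zball a k.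
Proof. by move=> jk x /= H; apply: (le_trans H); rewrite le_pexpz. Qed.

Lemma zball_sym a b k : zball a k b -> zball b k a.
Proof. by rewrite /zball/= padic_normBC. Qed.

Lemma zball_trans a b x k : zball a k b -> zball b k x -> zball a k x.
Proof.
rewrite /zball/= => ab bx; have -> : x - a = (x - b) + (b - a) by rewrite subrKA.
exact: padic_normD_le bx ab.
Qed.

Lemma nbhs_normP x (A : set V) :
  nbhs x A <-> exists2 e : R, 0 < e & forall y, padic_norm (y - x) < e -> A y.
Proof.
split=> [/nbhs_ballP|] [e /= e0 H]; last first.
  apply/nbhs_ballP; exists e => // y [_ yx]; apply: H.
  apply/padic_norm_ltP => // i; have := yx 0 i.
  by rewrite /ball/= /padic_dist mxE mxE -padic_absN opprB.
exists e => // y.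
  move=> /(padic_norm_ltP _ e0) yx; apply: H; split=> // i j.
  rewrite /ball/= /padic_dist ord1; have := yx j.
  by rewrite mxE -padic_absN mxE opprB.
Qed.

Lemma nbhs_zballP x (A : set V) :
  nbhs x A <-> exists k : nat, zball x (- k%:Z) `<=` A.
Proof.
rewrite nbhs_normP; split=> [[e e0 H]|[k H]].
  have [k ke] := pexp_small e0; exists k => y xy; apply: H.
  exact: (le_lt_trans xy).
by exists (p%:R ^ (- k%:Z)) => // y /ltW; exact: H.
Qed.

Lemma nbhs_zball x k : nbhs x (zball x k).
Proof. by apply/nbhs_normP; exists (p%:R ^ k) => // y /ltW. Qed.

Lemma zball_open a k : open (zball a k).
Proof.
rewrite openE => x ax; apply: filterS (nbhs_zball x k) => y.
exact: zball_trans ax.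
Qed.

Lemma zball_closed a k : closed (zball a k).
Proof.
rewrite -(setCK (zball a k)); apply: open_closedC; rewrite openE => x ax.
apply: filterS (nbhs_zball x k) => y xy ay; apply: ax.
exact: (zball_trans ay (zball_sym xy)).
Qed.

End PadicSpace.

Opaque padic_norm.

(** * Compactness of balls through p-adic digits *)

Section PadicCompactness.
Context {R : realType} {p : nat} {p_prime : prime p} {n : nat}.
Local Notation Qp := (padic R p_prime).
Local Notation V := 'rV[Qp]_n.
Implicit Types x y a b : V.
Let p_gt1 := @prime_gt1R R p p_prime.
Let p_gt0 := @prime_gt0R R p p_prime.
Let pz_gt0 := @pexpz_gt0 R p p_prime.
Let pz_ge0 := @pexpz_ge0 R p p_prime.
Hint Resolve p_gt1 p_gt0 pz_gt0 pz_ge0 padic_norm_ge0 : core.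

(** The digit is p times the fractional part of z / p: this is congruent to z modulo p, lies in [0,
    p), and is an integer because it belongs to both Z[1/p] and Z_p. *)
Lemma digit_exists (z : Qp) : padic_abs z <= 1 ->
  exists j : 'I_p, padic_abs (z - (j : nat)%:R) < 1.
Proof.
move=> z1; have [/andP[r0 r1] [m rm] zr] := padic_fracP (z / p%:R).
set r := padic_frac _ in r0 r1 rm zr.
have pq0 : (0 : rat) < p%:R by rewrite ltr0n prime_gt0.
have rpE : ratr (r * p%:R) = ratr r * p%:R :> Qp.
  by rewrite !rat_padicE rmorphM/= rmorph_nat.
have zrp : padic_abs (z - ratr (r * p%:R)) <= p%:R^-1.
  have -> : z - ratr (r * p%:R) = (z / p%:R - ratr r) * p%:R.
    by rewrite rpE mulrBl divfK// padic_p_neq0.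
  by rewrite padic_absM padic_abs_p ler_piMl// invr_ge0 ltW.
have pV1 : p%:R^-1 < 1 :> R by rewrite invf_lt1.
have : r * p%:R \is a Num.int.
  apply: (@rat_int_of_ratabs R p p_prime _ m).
    have -> : r * p%:R * p%:R ^+ m = r * p%:R ^+ m * p%:R by ring.
    by rewrite rpredM//; exact: natr_int.
  rewrite -(@padic_abs_rat R p p_prime).
  have -> : ratr (r * p%:R) = z - (z - ratr (r * p%:R)) :> Qp.
    by move: (ratr _) => u; ring.
  apply: (le_trans (padic_absB_max _ _)); rewrite ge_max z1/=.
  exact: (le_trans zrp (ltW pV1)).
move=> /intrP[j rj].
have j0 : 0 <= j by rewrite -(ler0z rat) -rj mulr_ge0// ltW.
have jp : j < p%:Z by rewrite -(ltr_int rat) -rj -[X in _ < X]mul1r ltr_pM2r.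
case: j j0 jp rj => // j _ jp rj.
exists (Ordinal (jp : (j < p)%N)); rewrite /=.
have -> : (j%:R : Qp) = ratr (r * p%:R) by rewrite rj ratr_padic_nat.
exact: (le_lt_trans zrp).
Qed.

Lemma digit_uniq (i j : 'I_p) :
  padic_abs ((i : nat)%:R - (j : nat)%:R : Qp) < 1 -> i = j.
Proof.
wlog ij : i j / (j <= i)%N => [H|].
  have [/H//|/ltnW/H{}H] := leqP j i.
  by rewrite -padic_absN opprB => /H.
rewrite -natrB//.
rewrite -ratr_padic_nat padic_abs_rat => lt1; apply/val_inj/eqP; rewrite /= eqn_leq ij andbT -subn_eq0.
have [//|ij0] := eqVneq (i - j)%N 0%N.
move: lt1; rewrite ratabs_coprime ?ltxx// coprime_sym.
rewrite coprime_sym prime_coprime//; apply/negP => /dvdn_leq.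
rewrite lt0n ij0 => /(_ isT); rewrite leqNgt => /negP; apply.
by rewrite (leq_ltn_trans (leq_subr _ _)).
Qed.

(** Representatives of the p^n cosets of the ball of radius p^k in the ball of radius p^(k+1). *)
Definition zdigit (k : int) (j : {ffun 'I_n -> 'I_p}) : V :=
  \row_i (p%:R ^ (- (k + 1)) * (j i : nat)%:R).

Lemma zball_split x (k : int) : padic_norm x <= p%:R ^ (k + 1) ->
  exists j, zball (zdigit k j) k x.
Proof.
move=> xk; pose c : Qp := p%:R ^ (k + 1).
have c0 : c != 0 by rewrite expfz_neq0// padic_p_neq0.
have cx i : padic_abs (c * x 0 i) <= 1.
  rewrite padic_absM padic_abs_pz -invr_expz ler_pdivrMl// mulr1.
  exact: (le_trans (padic_abs_le_norm _ _)).
have /choice[j jx] : forall i, exists j : 'I_p, padic_abs (c * x 0 i - (j : nat)%:R) < 1.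
  by move=> i; exact: digit_exists.
exists (finfun j); rewrite /zball/=.
(* The digits give a norm strictly below p^(k+1), which by discreteness is a norm of at most p^k. *)
have -> : p%:R ^ k = p%:R ^ (k + 1 - 1) :> R by rewrite addrK.
rewrite -padic_norm_lt_pred; apply/padic_norm_ltP => // i.
rewrite !mxE ffunE -invr_expz -/c.
have -> : x 0 i - c^-1 * (j i : nat)%:R = c^-1 * (c * x 0 i - (j i : nat)%:R).
  by rewrite mulrBr mulKf.
by rewrite padic_absM padic_absV padic_abs_pz -invr_expz invrK gtr_pMr.
Qed.

Lemma zdigit_norm k j : padic_norm (zdigit k j) <= p%:R ^ (k + 1).
Proof.
apply/padic_norm_leP => // i; rewrite mxE padic_absM padic_abs_pz opprK.
by rewrite ler_piMr// padic_abs_nat_le1.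
Qed.

Lemma zdigit_uniq k j j' x :
  zball (zdigit k j) k x -> zball (zdigit k j') k x -> j = j'.
Proof.
move=> xj xj'; apply/ffunP => i; apply: digit_uniq.
have : padic_norm (zdigit k j - zdigit k j') <= p%:R ^ k.
  exact: (zball_trans xj' (zball_sym xj)).
have {1}-> : p%:R ^ k = p%:R ^ (k + 1 - 1) :> R by rewrite addrK.
rewrite -padic_norm_lt_pred => /padic_norm_ltP H.
have := H (pz_gt0 _) i; rewrite !mxE -mulrBr padic_absM padic_abs_pz opprK.
by rewrite -[X in _ < X]mulr1 ltr_pM2l.
Qed.

Lemma zball_cover (N : int) (m : nat) :
  exists s : seq V, forall x, padic_norm x <= p%:R ^ N ->
    exists2 a, a \in s & zball a (N - m%:Z) x.
Proof.
elim: m => [|m [s sP]].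
  by exists [:: 0] => x xN; exists 0; rewrite ?mem_seq1// /zball/= subr0 subr0.
exists [seq a + zdigit (N - m.+1%:Z) j | a <- s, j <- enum {ffun 'I_n -> 'I_p}].
move=> x /sP[a sa xa].
have [|j jx] := @zball_split (x - a) (N - m.+1%:Z).
  by have -> : N - m.+1%:Z + 1 = N - m%:Z by lia.
exists (a + zdigit (N - m.+1%:Z) j).
  by apply/allpairsP; exists (a, j); rewrite mem_enum.
by rewrite /zball/= opprD addrA.
Qed.

(** Rational centres chosen at every scale form a Cauchy sequence in Q, so their class is itself an
    element of Q_p, and it is the required centre. *)
Lemma padic_complete (F : set_system Qp) : ProperFilter F ->
  (forall k : nat, exists a : Qp, F [set z | padic_abs (z - a) <= p%:R ^ (- k%:Z)]) ->
  exists a : Qp, forall k : nat, F [set z | padic_abs (z - a) <= p%:R ^ (- k%:Z)].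
Proof.
move=> FF H.
have /choice[r rP] : forall k : nat, exists r : rat,
    F [set z | padic_abs (z - ratr r) <= p%:R ^ (- k%:Z)].
  move=> k; have [a Fa] := H k; have [r ar] := padic_approx a (pz_gt0 (- k%:Z)).
  exists r; apply: filterS Fa => z /= za.
  have -> : z - ratr r = (z - a) + (a - ratr r) by rewrite subrKA.
  by apply: (le_trans (padic_abs_max _ _)); rewrite ge_max za ltW.
have rr (k m N : nat) : (N <= k)%N -> (N <= m)%N ->
    ratabs R p (r k - r m) <= p%:R ^ (- N%:Z).
  move=> Nk Nm; have [z [zk zm]] := filter_ex (filterI (rP k) (rP m)).
  rewrite -(@padic_abs_rat R p p_prime) ratr_padicB.
  have -> : ratr (r k) - ratr (r m) = (z - ratr (r m)) - (z - ratr (r k)) :> Qp.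
    by move: (ratr _) (ratr _) => u v; ring.
  apply: (le_trans (padic_absB_max _ _)); rewrite ge_max; apply/andP; split.
    by apply: (le_trans zm); rewrite le_pexpz//; lia.
  by apply: (le_trans zk); rewrite le_pexpz//; lia.
have rc : r \in @cauchy_pred R p p_prime.
  apply/asboolP => e e0; have [N Ne] := @pexp_small R p p_prime e e0.
  by exists N => m k Nm Nk; apply: le_lt_trans Ne; exact: rr.
exists (\pi_(padic R p_prime) (CauchySeq rc))%qT => k.
apply: filterS (rP k) => z /= zk.
set a := (\pi_(padic R p_prime) _)%qT.
have ak : padic_abs (a - ratr (r k)) <= p%:R ^ (- k%:Z).
  rewrite rat_padicE /a /rat_padic -padic_piN -padic_piD padic_absE.
  apply: limr_le; first exact: ratabs_cvg.
  by exists k => // m /= km; exact: rr.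
have -> : z - a = (z - ratr (r k)) - (a - ratr (r k)).
  by move: (ratr _) => u; ring.
by apply: (le_trans (padic_absB_max _ _)); rewrite ge_max zk ak.
Qed.

Lemma ultra_seq (T : eqType) (U : Type) (F : set_system U) (s : seq T)
    (D : T -> set U) : UltraFilter F ->
  F [set x | exists2 a, a \in s & D a x] -> exists2 a, a \in s & F (D a).
Proof.
move=> FU; elim: s => [|a s IH] Fs.
  have [x [b]] := filter_ex Fs; by rewrite in_nil.
have [Fa|Fa] := in_ultra_setVsetC (D a) FU.
  by exists a; rewrite ?mem_head.
have [|b bs Fb] := IH.
  apply: (filterS _ (filterI Fs Fa)) => x [[b]].
  by rewrite in_cons => /orP[/eqP -> //|bs Db] _; exists b.
by exists b; rewrite // in_cons bs orbT.
Qed.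

(** An ultrafilter on the ball contains one ball of each small radius, since finitely many balls of
    that radius cover; coordinatewise completeness then supplies the limit. *)
Lemma zball_compact (N : int) : compact (zball (0 : V) N).
Proof.
rewrite compact_ultra => F FU FN.
have Fk (k : nat) : exists a, F (zball a (- k%:Z)).
  (* This many subdivisions bring the radius p^N down to at most p^(-k), whatever the sign of N. *)
  have [s sP] := zball_cover N (`|N|%N + k).
  have [|a _ Fa] := @ultra_seq _ _ F s (fun a => zball a (- k%:Z)) FU.
    apply: filterS FN => x; rewrite zball0E => /sP[a sa xa]; exists a => //.
    by apply: zball_sub xa => //; lia.
  by exists a.
have /choice[l lP] : forall i : 'I_n, exists l : Qp, forall k : nat,
    F [set x | padic_abs (x 0 i - l) <= p%:R ^ (- k%:Z)].
  move=> i; apply: (@padic_complete ((fun x => x 0 i) @ F)) => k.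
  have [a Fa] := Fk k; exists (a 0 i).
  change (F [set x : V | padic_abs (x 0 i - a 0 i) <= p%:R ^ (- k%:Z)]).
  apply: (filterS _ Fa) => x /= xa.
  by apply: le_trans xa; have := padic_abs_le_norm (x - a) i; rewrite !mxE.
pose a : V := \row_i l i.
have Fa (k : nat) : F (zball a (- k%:Z)).
  have : \forall x \near F, forall i : 'I_n, padic_abs ((x : V) 0 i - l i) <= p%:R ^ (- k%:Z).
    by apply: filter_forall => i; exact: lP.
  apply: filterS => x /= H; apply/padic_norm_leP => // i.
  by rewrite !mxE.
have FA : F --> a by move=> A /nbhs_zballP[k ka]; apply: filterS ka (Fa k).
exists a; split => //.
have [x [xN xa]] := filter_ex (filterI FN (Fa `|N|%N)).
apply: (zball_trans xN); apply/zball_sym; apply: zball_sub xa; lia.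
Qed.

End PadicCompactness.

(** * Schwartz-Bruhat functions *)

Lemma seq_int_bounds (T : eqType) (s : seq T) (f : T -> int) :
  exists M : nat, forall a : T, a \in s -> - M%:Z <= f a <= M%:Z.
Proof.
elim: s => [|b s [M MP]]; first by exists 0%N.
exists (M + `|f b|)%N => a; rewrite in_cons => /orP[/eqP ->|/MP]; lia.
Qed.

(** * The real-valued modulus of complex numbers *)

Section ComplexModulus.
Context {R : rcfType}.
Implicit Types x y : R[i].
Local Notation normc := ComplexField.Normc.normc.

Lemma normc_norm x : `|x| = real_complex R (normc x).
Proof. by case: x. Qed.

Lemma normc_ge0 x : 0 <= normc x.
Proof. by case: x => a b; exact: sqrtr_ge0. Qed.

Lemma normcD_le x y : normc (x + y) <= normc x + normc y.
Proof. by rewrite -lecR rmorphD/= -!normc_norm ler_normD. Qed.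

Lemma normcN x : normc (- x) = normc x.
Proof. by apply: complexI; rewrite -!normc_norm normrN. Qed.

Lemma normc_sqr x : normc x ^+ 2 = complex.Re x ^+ 2 + complex.Im x ^+ 2.
Proof. by case: x => a b; rewrite sqr_sqrtr// addr_ge0// sqr_ge0. Qed.

Lemma Re_le_normc x : `|complex.Re x| <= normc x.
Proof.
rewrite -(@ler_pXn2r _ 2)// ?nnegrE ?normc_ge0// normc_sqr real_normK ?num_real//.
by rewrite lerDl sqr_ge0.
Qed.

Lemma Im_le_normc x : `|complex.Im x| <= normc x.
Proof.
rewrite -(@ler_pXn2r _ 2)// ?nnegrE ?normc_ge0// normc_sqr real_normK ?num_real//.
by rewrite lerDr sqr_ge0.
Qed.

Lemma normc_le_ReIm x : normc x <= `|complex.Re x| + `|complex.Im x|.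
Proof.
rewrite -(@ler_pXn2r _ 2)// ?nnegrE ?normc_ge0 ?addr_ge0// normc_sqr sqrrD.
by rewrite !real_normK ?num_real// lerD2r lerDl mulrn_wge0// mulr_ge0.
Qed.

Lemma mul_conjc x : x * x^*%C = real_complex R (normc x ^+ 2).
Proof.
by rewrite normc_sqr; case: x => a b; apply/eqP; rewrite eq_complex/=; apply/andP; split; apply/eqP; ring.
Qed.

End ComplexModulus.

(** * Test functions as combinations of ball indicators *)

Section SchwartzBruhat.
Context {R : realType} {p : nat} {p_prime : prime p} {n : nat}.
Local Notation Qp := (padic R p_prime).
Local Notation V := 'rV[Qp]_n.
Local Notation C := R[i].
Implicit Types (x y a b : V) (phi psi : V -> C).
Let pz_gt0 := @pexpz_gt0 R p p_prime.
Let pz_ge0 := @pexpz_ge0 R p p_prime.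
Hint Resolve pz_gt0 pz_ge0 padic_norm_ge0 : core.

Definition zsupp (N : int) phi := forall x, phi x != 0 -> padic_norm x <= p%:R ^ N.

Definition zinv (K : int) phi := forall x y, padic_norm y <= p%:R ^ K -> phi (x + y) = phi x.

Lemma zsuppW (N N' : int) phi : N <= N' -> zsupp N phi -> zsupp N' phi.
Proof. by move=> NN H x /H /le_trans; apply; rewrite le_pexpz. Qed.

Lemma zinvW (K K' : int) phi : K' <= K -> zinv K phi -> zinv K' phi.
Proof. by move=> KK H x y yK; apply: H; apply: (le_trans yK); rewrite le_pexpz. Qed.

(** A finite subcover of the support turns the local radii of constancy into a single one. *)
Lemma schwartz_bruhatP phi : schwartz_bruhat phi <->
  exists N K : int, zsupp N phi /\ zinv K phi.
Proof.
split=> [[lc]|[N [K [sN iK]]]]; last first.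
  split=> [x|].
    apply: filterS (nbhs_zball x K) => y; rewrite /zball/= => yx.
    by rewrite -(iK x (y - x) yx) addrC subrK.
  apply: (@subclosed_compact _ _ (zball 0 N)); first exact: closed_closure.
    exact: zball_compact.
  have cl := @zball_closed R p p_prime n 0 N.
  rewrite [X in _ `<=` X](closure_id (zball 0 N)).1//; apply: closure_subset => x /sN.
  by rewrite zball0E.
set A := closure _; rewrite compact_cover => cA.
have /choice[k kP] : forall x, exists k : nat, forall y, zball x (- k%:Z) y -> phi y = phi x.
  by move=> x; have /nbhs_zballP[k H] := lc x; exists k.
have [|D DA AD] := cA V A (fun x => zball x (- (k x)%:Z)) (fun x _ => @zball_open R p p_prime n x _).
  by move=> x Ax; exists x => //; exact: zball_center.
have sA x : phi x != 0 -> A x by move=> ?; apply: subset_closure.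
have [M1 M1P] := @seq_int_bounds _ (finmap.enum_fset D) (fun a => (k a)%:Z).
have /choice[j jP] : forall x, exists j : int, padic_norm x <= p%:R ^ j.
  by move=> x; have [j /ltW ?] := @pexp_unbounded R p p_prime (padic_norm x); exists j%:Z.
have [M2 M2P] := @seq_int_bounds _ (finmap.enum_fset D) j.
have cD x : phi x != 0 -> exists2 a, a \in finmap.enum_fset D & zball a (- (k a)%:Z) x.
  by move=> /sA/AD[a /= aD xa]; exists a.
exists M2%:Z, (- M1%:Z); split=> [x /cD[a aD xa]|x y yM].
  rewrite -(subrK a x); apply: padic_normD_le.
    apply: (le_trans xa); rewrite le_pexpz// (@le_trans _ _ 0)// oppr_le0.
  by apply: (le_trans (jP a)); rewrite le_pexpz//; have /andP[] := M2P _ aD.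
have H z t : phi z != 0 -> padic_norm t <= p%:R ^ (- M1%:Z) -> phi (z + t) = phi z.
  move=> /cD[a aD za] tM; rewrite (kP _ _ za); apply: kP.
  apply: (zball_trans za); rewrite /zball/= addrAC subrr add0r.
  by apply: (le_trans tM); rewrite le_pexpz// lerN2; have /andP[] := M1P _ aD.
(* At a zero of phi the roles are exchanged: if phi (x + y) were nonzero, [H] at x + y with
   increment - y would give phi x = phi (x + y). *)
have [x0|x0] := eqVneq (phi x) 0; last exact: H.
have [->//|xy0] := eqVneq (phi (x + y)) 0.
by rewrite -(H (x + y) (- y)) ?addrK// padic_normN.
Qed.

(* Locked, as are other notions below: comparing two different indicator
   functions by conversion would unfold the completion Q_p. *)
Definition zind_def a (k : int) : V -> C := fun x => (`[< zball a k x >])%:R.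
Fact zind_key : unit. Proof. exact: tt. Qed.
Definition zind := locked_with zind_key zind_def.

Lemma zind_val a k x : zind a k x = (`[< zball a k x >])%:R.
Proof. by rewrite /zind locked_withE. Qed.

Lemma zindE a k x : zball a k x -> zind a k x = 1.
Proof. by move=> H; rewrite zind_val asboolT. Qed.

Lemma zindN a k x : ~ zball a k x -> zind a k x = 0.
Proof. by move=> H; rewrite zind_val asboolF. Qed.

Lemma zind_split a k x :
  zind a (k + 1) x = \sum_j zind (a + zdigit k j) k x.
Proof.
have [ax|ax] := pselect (zball a (k + 1) x); last first.
  rewrite zindN// big1// => j _; rewrite zindN// => H; apply: ax.
  apply: (zball_trans (b := a + zdigit k j)).
    by rewrite /zball/= addrAC subrr add0r zdigit_norm.
  by apply: zball_sub H; rewrite lerDl.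
have [j jx] := zball_split ax; rewrite zindE// (bigD1 j)//= zindE; last first.
  by move: jx; rewrite /zball/= opprD addrA.
rewrite big1 ?addr0// => i ij; rewrite zindN// => H.
move/eqP: ij; apply; apply: (zdigit_uniq (x := x - a)) jx.
by move: H; rewrite /zball/= opprD addrA.
Qed.

(* The indicator functions of the cosets of one ball span the functions with
   bounded support that are invariant under it: such a function is cut along
   the p-adic digits. *)
Lemma zinv_ind (K : int) (P : (V -> C) -> Prop) :
  (forall c phi psi, P phi -> P psi -> P (fun x => c * phi x + psi x)) ->
  (forall a, P (zind a K)) ->
  forall (N : int) phi, zsupp N phi -> zinv K phi -> P phi.
Proof.
move=> PD Pi N phi sN iK.
have P0 : P (fun=> 0).
  have := PD (-1) _ _ (Pi 0) (Pi 0).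
  by rewrite (_ : (fun x => _) = fun=> 0)//; apply/funext => x; rewrite mulN1r addNr.
have PZ c psi : P psi -> P (fun x => c * psi x).
  by move=> /(PD c) /(_ P0); under eq_fun do rewrite addr0.
have Psum (I : eqType) (s : seq I) (F : I -> V -> C) : (forall i, P (F i)) ->
    P (fun x => \sum_(i <- s) F i x).
  move=> PF; elim: s => [|i s IH]; first by under eq_fun do rewrite big_nil.
  have := PD 1 _ _ (PF i) IH.
  by under eq_fun do rewrite mul1r; under [in X in _ -> X]eq_fun do rewrite big_cons.
have [M NK] : exists M : nat, N <= K + M%:Z by exists (`|N|%N + `|K|%N)%N; lia.
(* Restrictions of phi to balls of growing radius: for m = 0 phi is constant on the ball, and M
   steps reach a ball that contains the support. *)
have H (m : nat) (a : V) : P (fun x => phi x * zind a (K + m%:Z) x).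
  elim: m a => [|m IH] a.
    rewrite addr0 (_ : (fun x => _) = fun x => phi a * zind a K x); first exact: PZ.
    apply/funext => x; have [ax|ax] := pselect (zball a K x); last first.
      by rewrite zindN// !mulr0.
    by congr (_ * _); rewrite -(subrK a x) addrC iK.
  rewrite (_ : (fun x => _) = fun x =>
      \sum_j phi x * zind (a + zdigit (K + m%:Z) j) (K + m%:Z) x); first exact: Psum.
  apply/funext => x; rewrite -mulr_sumr -zind_split.
  by have -> : K + m.+1%:Z = K + m%:Z + 1 by lia.
have := H M 0; rewrite (_ : (fun x => _) = phi)//; apply/funext => x.
have [->|x0] := eqVneq (phi x) 0; first by rewrite mul0r.
by rewrite zindE ?mulr1// zball0E; exact: (zsuppW NK sN).
Qed.

Lemma schwartz_bruhat_ind (P : (V -> C) -> Prop) :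
  (forall c phi psi, P phi -> P psi -> P (fun x => c * phi x + psi x)) ->
  (forall a k, P (zind a k)) ->
  forall phi, schwartz_bruhat phi -> P phi.
Proof.
by move=> PD Pi phi /schwartz_bruhatP[N [K [sN iK]]]; exact: (zinv_ind PD _ sN iK).
Qed.

Lemma zsuppD (N : int) c phi psi : zsupp N phi -> zsupp N psi ->
  zsupp N (fun x => c * phi x + psi x).
Proof.
move=> f g x; have [f0|/f//] := eqVneq (phi x) 0.
by rewrite f0 mulr0 add0r => /g.
Qed.

Lemma zinvD (K : int) c phi psi : zinv K phi -> zinv K psi ->
  zinv K (fun x => c * phi x + psi x).
Proof. by move=> f g x y yK; rewrite f// g. Qed.

Lemma schwartz_bruhatD c phi psi : schwartz_bruhat phi -> schwartz_bruhat psi ->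
  schwartz_bruhat (fun x => c * phi x + psi x).
Proof.
move=> /schwartz_bruhatP[N [K [a b]]] /schwartz_bruhatP[N' [K' [a' b']]].
apply/schwartz_bruhatP; exists (Num.max N N'), (Num.min K K'); split.
  by apply: zsuppD; [apply: zsuppW a|apply: zsuppW a']; rewrite le_max lexx ?orbT.
by apply: zinvD; [apply: zinvW b|apply: zinvW b']; rewrite ge_min lexx ?orbT.
Qed.

Lemma zind_supp a k : exists N, zsupp N (zind a k).
Proof.
have [j /ltW ja] := @pexp_unbounded R p p_prime (padic_norm a).
exists (Num.max j%:Z k) => x; have [ax _|/zindN ->] := pselect (zball a k x); last by rewrite eqxx.
rewrite -(subrK a x); apply: padic_normD_le.
  by apply: (le_trans ax); rewrite le_pexpz// le_max lexx orbT.
by apply: (le_trans ja); rewrite le_pexpz// le_max lexx.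
Qed.

Lemma zind_inv a k : zinv k (zind a k).
Proof.
move=> x y yk; rewrite !zind_val; suff -> : zball a k (x + y) = zball a k x by [].
apply/propext; have xy : zball x k (x + y) by rewrite /zball/= addrAC subrr add0r.
split=> H; first exact: (zball_trans H (zball_sym xy)).
exact: (zball_trans H xy).
Qed.

Lemma schwartz_bruhat_zind a k : schwartz_bruhat (zind a k).
Proof.
by have [N aN] := zind_supp a k; apply/schwartz_bruhatP; exists N, k; split; [exact: aN|exact: zind_inv].
Qed.

Lemma schwartz_bruhat_bounded phi : schwartz_bruhat phi ->
  exists M : R, forall x, ComplexField.Normc.normc (phi x) <= M.
Proof.
apply: (schwartz_bruhat_ind (P := fun phi => exists M : R,
  forall x, ComplexField.Normc.normc (phi x) <= M)) => [c f g [M1 H1] [M2 H2]|a k].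
  exists (ComplexField.Normc.normc c * M1 + M2) => x.
  apply: (le_trans (normcD_le _ _)).
  by rewrite ComplexField.Normc.normcM lerD// ler_wpM2l// normc_ge0.
exists 1 => x; rewrite zind_val; case: asbool; first by rewrite ComplexField.Normc.normc1.
by rewrite ComplexField.Normc.normc0.
Qed.

End SchwartzBruhat.

(** * Integration and the Fourier transform *)

Section HaarIntegration.
Context {R : realType} {p : nat} {p_prime : prime p} {n : nat}.
Local Notation Qp := (padic R p_prime).
Local Notation V := 'rV[Qp]_n.
Local Notation C := R[i].
Local Notation B := (borelV R p_prime n).
Implicit Types (x y a b : V) (phi psi : V -> C).
Variable mu : {measure set B -> \bar R}.
Hypothesis mu_haar : normalized_haar mu.
Let pz_gt0 := @pexpz_gt0 R p p_prime.
Let pz_ge0 := @pexpz_ge0 R p p_prime.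
Hint Resolve pz_gt0 pz_ge0 padic_norm_ge0 : core.

Lemma open_measurable_borelV (A : set V) : open A -> measurable (A : set B).
Proof. by move=> oA; apply: sub_sigma_algebra. Qed.

Lemma zball_measurable a k : measurable (zball a k : set B).
Proof. by apply: open_measurable_borelV; exact: zball_open. Qed.

Lemma continuous_measurable_borelV (f : V -> R) :
  continuous f -> measurable_fun [set: B] (f : B -> R).
Proof.
move=> cf; apply: (measurability _ (RGenOInfty.measurableE R)) => _ [_ [r ->] <-].
rewrite setTI; apply: open_measurable_borelV.
by apply: open_comp; [move=> x _; exact: cf|exact: interval_open].
Qed.

Lemma haar_translate a k : mu (zball a k) = mu (zball 0 k).
Proof.
have <- : [set a + x | x in zball 0 k] = zball a k.
  apply/seteqP; split=> [_ [x xk <-]|x xk].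
    by move: xk; rewrite /zball/= subr0 addrAC subrr add0r.
  by exists (x - a); [rewrite zball0E|rewrite addrC subrK].
exact: (mu_haar.1 a _ (zball_measurable 0 k)).
Qed.

(** The larger ball is the disjoint union of the p^n translates of the smaller one by the digit
    vectors. *)
Lemma haar_zball_step k : mu (zball 0 (k + 1)) = ((p ^ n)%N%:R%:E * mu (zball 0 k))%E.
Proof.
pose N := #|{ffun 'I_n -> 'I_p}|.
pose F (i : 'I_N) : set B := zball (zdigit k (enum_val i)) k.
have -> : zball 0 (k + 1) = \big[setU/set0]_(i < N) F i.
  apply/seteqP; split=> x.
    rewrite zball0E => /zball_split[j jx]; rewrite -bigcup_seq.
    by exists (enum_rank j); rewrite ?/F ?enum_rankK//= mem_index_enum.
  rewrite -bigcup_seq => -[i _ ix]; rewrite zball0E.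
  rewrite -(subrK (zdigit k (enum_val i)) x); apply: padic_normD_le.
    by apply: (le_trans ix); rewrite le_pexpz// lerDl.
  exact: zdigit_norm.
rewrite (measure_bigsetU_ord _ xpredT)/=; last 2 first.
- by move=> i; exact: zball_measurable.
- move=> i j _ _ [x [xi xj]]; apply: enum_val_inj.
  exact: (zdigit_uniq xi xj).
rewrite (eq_bigr (fun=> mu (zball 0 k))); last by move=> i _; exact: haar_translate.
by rewrite mule_natl big_const_ord -Monoid.iteropE /N card_ffun !card_ord.
Qed.

(** Only the volume of Z_p^n is given; the factor p^n between consecutive radii carries it upwards,
    and downwards after division. *)
Lemma haar_zball a k : mu (zball a k) = ((p%:R ^ k) ^+ n)%:E.
Proof.
rewrite haar_translate.
have mu0 : mu (zball 0 0) = 1%E.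
  rewrite -mu_haar.2; congr (mu _); apply/seteqP; split=> x;
  by rewrite zball0E expr0z.
have pn : (p ^ n)%N%:R != 0 :> R by rewrite pnatr_eq0 -lt0n expn_gt0 prime_gt0.
have pn0 : (p%:R : R) != 0 by rewrite pnatr_eq0 -lt0n prime_gt0.
have pos (m : nat) : mu (zball 0 m%:Z) = ((p%:R ^ m%:Z) ^+ n)%:E.
  elim: m => [|m IH]; first by rewrite mu0 expr0z expr1n.
  have -> : m.+1%:Z = m%:Z + 1 by lia.
  rewrite haar_zball_step IH -EFinM expfzDr// exprMn expr1z natrX.
  by rewrite mulrC.
have neg (m : nat) : mu (zball 0 (- m%:Z)) = ((p%:R ^ (- m%:Z)) ^+ n)%:E.
  elim: m => [|m IH]; first by rewrite oppr0 mu0 expr0z expr1n.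
  have := haar_zball_step (- m.+1%:Z).
  have -> : - m.+1%:Z + 1 = - m%:Z by lia.
  rewrite IH; set u := mu _ => E.
  have : ((p ^ n)%N%:R^-1%:E * ((p%:R ^ (- m%:Z)) ^+ n)%:E = u :> \bar R)%E.
    by rewrite E muleA -EFinM mulVf// mul1e.
  move=> <-; rewrite -EFinM; congr EFin.
  have -> : - m.+1%:Z = - m%:Z + (-1) by lia.
  by rewrite expfzDr// exprMn exprN1 mulrC natrX exprVn.
case: k => m; first exact: pos.
by rewrite NegzE; exact: neg.
Qed.

Definition Cintegrable (g : V -> C) :=
  mu.-integrable setT (fun x => (complex.Re (g x))%:E) /\
  mu.-integrable setT (fun x => (complex.Im (g x))%:E).

Lemma CintegrableD c (f g : V -> C) : Cintegrable f -> Cintegrable g ->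
  Cintegrable (fun x => c * f x + g x).
Proof.
move=> [fR fI] [gR gI]; split.
  have -> : (fun x => (complex.Re (c * f x + g x))%:E) =
    ((fun x => (complex.Re c)%:E * (complex.Re (f x))%:E
      + (- complex.Im c)%:E * (complex.Im (f x))%:E)
      \+ (fun x => (complex.Re (g x))%:E))%E.
    apply/funext => x /=; case: c (f x) (g x) => [c1 c2] [f1 f2] [g1 g2] /=.
    by rewrite -!EFinM -!EFinD mulNr.
  apply: integrableD => //; apply: integrableD => //; exact: integrableZl.
have -> : (fun x => (complex.Im (c * f x + g x))%:E) =
    ((fun x => (complex.Re c)%:E * (complex.Im (f x))%:E
      + (complex.Im c)%:E * (complex.Re (f x))%:E)
      \+ (fun x => (complex.Im (g x))%:E))%E.
  apply/funext => x /=; case: c (f x) (g x) => [c1 c2] [f1 f2] [g1 g2] /=.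
  by rewrite -!EFinM -!EFinD.
apply: integrableD => //; apply: integrableD => //; exact: integrableZl.
Qed.

Lemma CintegralD c (f g : V -> C) : Cintegrable f -> Cintegrable g ->
  Cintegral mu (fun x => c * f x + g x) = c * Cintegral mu f + Cintegral mu g.
Proof.
move=> [fR fI] [gR gI]; rewrite /Cintegral.
have -> : (fun x : V => complex.Re (c * f x + g x)) =
   (fun x => (complex.Re c * complex.Re (f x) + (- complex.Im c) * complex.Im (f x))
      + complex.Re (g x)).
  by apply/funext => x; case: c (f x) (g x) => [c1 c2] [f1 f2] [g1 g2] /=; rewrite mulNr.
have -> : (fun x : V => complex.Im (c * f x + g x)) =
   (fun x => (complex.Re c * complex.Im (f x) + complex.Im c * complex.Re (f x))
      + complex.Im (g x)).
  by apply/funext => x; case: c (f x) (g x) => [c1 c2] [f1 f2] [g1 g2] /=.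
have iZ (r : R) (h : V -> R) : mu.-integrable setT (EFin \o h) ->
    mu.-integrable setT (EFin \o (fun x => r * h x)).
  move=> ih; rewrite (_ : EFin \o _ = fun x => (r%:E * (EFin \o h) x)%E).
    exact: integrableZl.
  by apply/funext.
have iD (h h' : V -> R) : mu.-integrable setT (EFin \o h) ->
    mu.-integrable setT (EFin \o h') ->
    mu.-integrable setT (EFin \o (fun x => h x + h' x)).
  move=> ih ih'; rewrite (_ : EFin \o _ = ((EFin \o h) \+ (EFin \o h'))%E).
    exact: integrableD.
  by apply/funext.
rewrite !RintegralD//; try (by apply: iD; apply: iZ); try exact: iZ.
rewrite !RintegralZl//.
case: c => c1 c2 /=.
by apply/eqP; rewrite eq_complex/= !mulNr !eqxx.
Qed.

Lemma CintegralZ c (f : V -> C) : Cintegrable f ->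
  Cintegral mu (fun x => c * f x) = c * Cintegral mu f.
Proof.
have i0 : Cintegrable (fun=> 0) by split; exact: integrable0.
have c0 : Cintegral mu (fun=> 0) = 0.
  by rewrite /Cintegral /Rintegral /= !integral0.
by move=> fi; have := CintegralD c fi i0; rewrite c0 addr0; under eq_fun do rewrite addr0.
Qed.

Lemma integrable_zball a k :
  mu.-integrable setT (fun x : B => ((\1_(zball a k : set B) : B -> R) x)%:E).
Proof.
have mB := zball_measurable a k.
apply/integrableP; split; first by apply/measurable_EFinP; exact: measurable_indic.
rewrite (eq_integral (fun x : B => ((\1_(zball a k : set B) : B -> R) x)%:E)); last first.
  by move=> t _; rewrite gee0_abs// lee_fin.
by rewrite integral_indic// setIT haar_zball ltry.
Qed.

Lemma Cintegrable_zind a k : Cintegrable (zind a k).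
Proof.
have E : (fun x => (complex.Re (zind a k x))%:E) = EFin \o (\1_(zball a k : set B) : B -> R).
  apply/funext => x /=; congr EFin; rewrite indicE zind_val.
  by have [H|H] := pselect (zball a k x); [rewrite asboolT// mem_set|rewrite asboolF// memNset].
have E0 : (fun x => (complex.Im (zind a k x))%:E) = (fun=> 0%:E).
  by apply/funext => x /=; rewrite zind_val; case: asbool.
split; last by rewrite E0; exact: integrable0.
by rewrite E; exact: integrable_zball.
Qed.

Lemma Cintegral_zind a k :
  Cintegral mu (zind a k) = real_complex R ((p%:R ^ k) ^+ n).
Proof.
rewrite /Cintegral; congr Complex; rewrite /Rintegral.
  have -> : (fun x => (complex.Re (zind a k x))%:E) = EFin \o (\1_(zball a k : set B) : B -> R).
    apply/funext => x /=; congr EFin; rewrite indicE zind_val.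
    by have [H|H] := pselect (zball a k x); [rewrite asboolT// mem_set|rewrite asboolF// memNset].
  by rewrite integral_indic ?setIT ?haar_zball//; exact: zball_measurable.
rewrite (_ : (fun x => _) = fun=> 0%:E) ?integral0//.
by apply/funext => x /=; rewrite zind_val; case: asbool.
Qed.

Lemma schwartz_bruhat_Cintegrable phi : schwartz_bruhat phi -> Cintegrable phi.
Proof.
by apply: schwartz_bruhat_ind => *; [exact: CintegrableD|exact: Cintegrable_zind].
Qed.

Lemma eq_Cintegral (f g : V -> C) : (forall x, f x = g x) ->
  Cintegral mu f = Cintegral mu g.
Proof. by move=> /funext ->. Qed.

(** For a ball this only compares the volumes of two balls of the same radius; other test functions
    follow by linearity. *)
Lemma Cintegral_shift phi b : schwartz_bruhat phi ->
  schwartz_bruhat (fun x => phi (x + b)) /\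
  Cintegral mu (fun x => phi (x + b)) = Cintegral mu phi.
Proof.
(* Membership is carried through the induction, because linearity of the integral needs integrable
   summands. *)
move=> sphi; have [] // : schwartz_bruhat phi /\ (schwartz_bruhat (fun x => phi (x + b)) /\
  Cintegral mu (fun x => phi (x + b)) = Cintegral mu phi).
apply: (schwartz_bruhat_ind (P := fun phi => schwartz_bruhat phi /\ (schwartz_bruhat (fun x => phi (x + b)) /\
  Cintegral mu (fun x => phi (x + b)) = Cintegral mu phi))) sphi.
  move=> c f g [sf [f1 f2]] [sg [g1 g2]]; split; first exact: schwartz_bruhatD.
  split; first exact: (schwartz_bruhatD c f1 g1).
  by rewrite !CintegralD ?f2 ?g2//; apply: schwartz_bruhat_Cintegrable.
move=> a k; have E : (fun x => zind a k (x + b)) = zind (a - b) k.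
  by apply/funext => x; rewrite !zind_val /zball/= opprB addrA.
split; first exact: schwartz_bruhat_zind.
split; first exact: (@eq_ind_r _ _ (@schwartz_bruhat R p p_prime n) (schwartz_bruhat_zind (a - b) k) _ E).
have E2 := congr1 (Cintegral mu) E.
have E3 := Cintegral_zind (a - b) k.
have E4 := Cintegral_zind a k.
exact (etrans E2 (etrans E3 (esym E4))).
Qed.

End HaarIntegration.

(** * Fourier transforms of ball indicators *)

Section FourierTransform.
Context {R : realType} {p : nat} {p_prime : prime p} {n : nat}.
Local Notation Qp := (padic R p_prime).
Local Notation V := 'rV[Qp]_n.
Local Notation C := R[i].
Local Notation B := (borelV R p_prime n).
Implicit Types (x y a b xi : V) (phi psi : V -> C) (s : Qp).
Variable mu : {measure set B -> \bar R}.
Hypothesis mu_haar : normalized_haar mu.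
Let pz_gt0 := @pexpz_gt0 R p p_prime.
Let pz_ge0 := @pexpz_ge0 R p p_prime.
Hint Resolve pz_gt0 pz_ge0 padic_norm_ge0 : core.
Opaque padic_char.

Lemma dotC x y : dot x y = dot y x.
Proof. by apply: eq_bigr => i _; rewrite mulrC. Qed.

(** By [dot_abs_le] the increment of the argument lies in Z_p, where the character is trivial. *)
Lemma char_dot_inv s y (j : int) : padic_abs s <= 1 -> padic_norm y <= p%:R ^ j ->
  zinv (- j) (fun x => padic_char (s * dot x y)).
Proof.
move=> s1 yj x t tj; rewrite dotDl mulrDr padic_charD [X in _ * X]padic_char_le1 ?mulr1//.
rewrite padic_absM -[1 in X in _ <= X]mulr1 ler_pM ?padic_abs_ge0//.
apply: (le_trans (dot_abs_le _ _)).
have -> : 1 = p%:R ^ (- j) * p%:R ^ j :> R.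
  by rewrite -expfzDr ?gt_eqF ?prime_gt0R// addNr expr0z.
exact: (ler_pM (padic_norm_ge0 _) (padic_norm_ge0 _) tj yj).
Qed.

Lemma schwartz_bruhatM (f : V -> C) (K : int) phi : zinv K f -> schwartz_bruhat phi ->
  schwartz_bruhat (fun x => f x * phi x).
Proof.
move=> fK /schwartz_bruhatP[N [K' [sN iK]]]; apply/schwartz_bruhatP.
exists N, (Num.min K K'); split=> [x fx|x y yK].
  by apply: sN; apply: contraNneq fx => ->; rewrite mulr0.
have KK : Num.min K K' <= K by rewrite ge_min lexx.
have KK' : Num.min K K' <= K' by rewrite ge_min lexx orbT.
by rewrite (zinvW KK fK) ?(zinvW KK' iK).
Qed.

Lemma schwartz_bruhat_char s y phi : padic_abs s <= 1 -> schwartz_bruhat phi ->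
  schwartz_bruhat (fun x => padic_char (s * dot x y) * phi x).
Proof.
move=> s1; have [j /ltW yj] := @pexp_unbounded R p p_prime (padic_norm y).
exact: (schwartz_bruhatM (char_dot_inv s1 yj)).
Qed.

(* Fourier transform for s = -1, inverse transform for s = 1. *)
Definition ft_def s phi xi : C := Cintegral mu (fun x => padic_char (s * dot x xi) * phi x).
Fact ft_key : unit. Proof. exact: tt. Qed.
Definition ft := locked_with ft_key ft_def.

Lemma ftE s phi xi :
  ft s phi xi = Cintegral mu (fun x => padic_char (s * dot x xi) * phi x).
Proof. by rewrite /ft locked_withE. Qed.

Lemma fourierE phi : fourier mu phi = ft (-1) phi.
Proof. by apply/funext => xi; rewrite ftE; apply: eq_Cintegral => x; rewrite mulN1r. Qed.

Lemma ftD s c phi psi : padic_abs s <= 1 -> schwartz_bruhat phi -> schwartz_bruhat psi ->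
  ft s (fun x => c * phi x + psi x) = (fun xi => c * ft s phi xi + ft s psi xi).
Proof.
move=> s1 sf sg; apply/funext => xi.
rewrite !ftE -CintegralD; last 2 first.
- exact: (schwartz_bruhat_Cintegrable mu_haar (schwartz_bruhat_char xi s1 sf)).
- exact: (schwartz_bruhat_Cintegrable mu_haar (schwartz_bruhat_char xi s1 sg)).
by apply: eq_Cintegral => x; rewrite mulrDr mulrCA.
Qed.

(** Some coordinate of xi exceeds p^(-k), so its product with a scalar q of absolute value p^k
    leaves Z_p. A p-adic integer y from [padic_char_nontrivial] then detects it, and t is q y along
    that coordinate. *)
Lemma char_dot_nontrivial s xi (k : int) : padic_abs s = 1 ->
  ~ padic_norm xi <= p%:R ^ (- k) ->
  exists2 t : V, padic_norm t <= p%:R ^ k & padic_char (s * dot t xi) != 1.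
Proof.
move=> s1 xik.
have [i ik] : exists i, p%:R ^ (- k) < padic_abs (xi 0 i).
  apply: contrapT => H; apply: xik; apply/padic_norm_leP => // i.
  by rewrite leNgt; apply/negP => ik; apply: H; exists i.
pose q : Qp := p%:R ^ (- k).
have aq : padic_abs q = p%:R ^ k by rewrite padic_abs_pz opprK.
have [|y y1 yn] := @padic_char_nontrivial R p p_prime (s * xi 0 i * q).
  rewrite !padic_absM s1 mul1r aq.
  by rewrite -ltr_pdivrMr// div1r invr_expz.
exists (\row_j (if j == i then q * y else 0)).
  apply/padic_norm_leP => // j; rewrite mxE; case: eqP => _; last by rewrite padic_abs0.
  by rewrite padic_absM aq ler_piMr.
have -> : dot (\row_j (if j == i then q * y else 0)) xi = q * y * xi 0 i.
  rewrite /dot (bigD1 i)//= mxE eqxx big1 ?addr0// => j /negbTE ji.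
  by rewrite mxE ji mul0r.
by have -> : s * (q * y * xi 0 i) = s * xi 0 i * q * y by ring.
Qed.

Opaque dot.

(** Orthogonality of characters: for xi in the dual ball the character is 1 throughout the ball of
    integration; for any other xi a translation of the variable multiplies the integral by a number
    different from 1. *)
Lemma ft_zind0 s k xi : padic_abs s = 1 ->
  ft s (zind 0 k) xi = real_complex R ((p%:R ^ k) ^+ n) * zind 0 (- k) xi.
Proof.
move=> s1; have s1' : padic_abs s <= 1 by rewrite s1.
have [xk|xk] := pselect (zball 0 (- k) xi).
  rewrite (zindE xk) mulr1 -(Cintegral_zind mu_haar 0 k) ftE; apply: eq_Cintegral => x.
  have [kx|kx] := pselect (zball 0 k x); last by rewrite zindN// mulr0.
  rewrite padic_char_le1 ?mul1r// padic_absM s1 mul1r.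
  apply: (le_trans (dot_abs_le _ _)).
  have -> : 1 = p%:R ^ k * p%:R ^ (- k) :> R.
    by rewrite -expfzDr ?gt_eqF ?prime_gt0R// subrr expr0z.
  by move: xk kx; rewrite !zball0E => xk kx; exact: (ler_pM (padic_norm_ge0 _) (padic_norm_ge0 _) kx xk).
rewrite (zindN xk) mulr0.
have [t tk tn] : exists2 t : V, padic_norm t <= p%:R ^ k & padic_char (s * dot t xi) != 1.
  by apply: char_dot_nontrivial => //; rewrite -zball0E.
have sg := schwartz_bruhat_char xi s1' (schwartz_bruhat_zind 0 k).
have [_ E] := Cintegral_shift mu_haar t sg.
have E' : Cintegral mu (fun x => padic_char (s * dot (x + t) xi) * zind 0 k (x + t))
    = padic_char (s * dot t xi) * ft s (zind 0 k) xi.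
  rewrite ftE; apply: (etrans _ (CintegralZ (padic_char (s * dot t xi))
    (schwartz_bruhat_Cintegrable mu_haar sg))).
  apply: eq_Cintegral => x; rewrite (zind_inv 0 _ tk) dotDl mulrDr padic_charD.
  move: (padic_char (s * dot x xi)) (padic_char (s * dot t xi)) (zind 0 k x) => u v z.
  by rewrite -mulrA mulrCA.
have : (padic_char (s * dot t xi) - 1) * ft s (zind 0 k) xi = 0.
  by rewrite mulrBl mul1r -E' E ftE subrr.
by move=> /eqP; rewrite mulf_eq0 subr_eq0 (negbTE tn) => /eqP.
Qed.

Lemma ft_zind s a k xi : padic_abs s = 1 ->
  ft s (zind a k) xi = real_complex R ((p%:R ^ k) ^+ n) *
    (padic_char (s * dot xi a) * zind 0 (- k) xi).
Proof.
move=> s1; have s1' : padic_abs s <= 1 by rewrite s1.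
have sg := schwartz_bruhat_char xi s1' (schwartz_bruhat_zind a k).
have [_ E] := Cintegral_shift mu_haar a sg.
rewrite ftE; apply: (etrans (esym E)).
apply: (@etrans _ _ (padic_char (s * dot xi a) * ft s (zind 0 k) xi)); last first.
  rewrite (ft_zind0 k xi s1).
  move: (padic_char _) (zind _ _ _) (real_complex _ _) => u v w.
  by rewrite mulrCA.
rewrite ftE; apply: (etrans _ (CintegralZ (padic_char (s * dot xi a)) (schwartz_bruhat_Cintegrable
  mu_haar (schwartz_bruhat_char xi s1' (schwartz_bruhat_zind 0 k))))).
apply: eq_Cintegral => x; rewrite dotDl mulrDr padic_charD (dotC a xi).
have -> : zind a k (x + a) = zind 0 k x.
  rewrite !zind_val; suff -> : zball a k (x + a) = zball 0 k x by [].
  by rewrite /zball/= addrK subr0.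
move: (padic_char (s * dot x xi)) (padic_char (s * dot xi a)) (zind 0 k x) => u v z.
by rewrite -mulrA mulrCA.
Qed.

End FourierTransform.

(** * Fourier inversion and the Parseval identity *)

Section FourierInversion.
Context {R : realType} {p : nat} {p_prime : prime p} {n : nat}.
Local Notation Qp := (padic R p_prime).
Local Notation V := 'rV[Qp]_n.
Local Notation C := R[i].
Local Notation B := (borelV R p_prime n).
Local Notation normc := ComplexField.Normc.normc.
Implicit Types (x y a b xi : V) (phi psi f g h : V -> C) (s : Qp).
Variable mu : {measure set B -> \bar R}.
Hypothesis mu_haar : normalized_haar mu.
Let pz_gt0 := @pexpz_gt0 R p p_prime.
Let pz_ge0 := @pexpz_ge0 R p p_prime.
Hint Resolve pz_gt0 pz_ge0 padic_norm_ge0 : core.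
Local Notation vol k := (real_complex R ((p%:R ^ k) ^+ n)).

Lemma schwartz_bruhatZ c phi : schwartz_bruhat phi -> schwartz_bruhat (fun x => c * phi x).
Proof. by apply: (@schwartz_bruhatM _ _ _ _ (fun=> c) 0) => x y _. Qed.

Lemma schwartz_bruhat_mul phi psi : schwartz_bruhat phi -> schwartz_bruhat psi ->
  schwartz_bruhat (fun x => phi x * psi x).
Proof.
move=> /schwartz_bruhatP[N [K [sN iK]]] spsi; exact: (schwartz_bruhatM iK spsi).
Qed.

Lemma schwartz_bruhat_conj phi : schwartz_bruhat phi ->
  schwartz_bruhat (fun x => (phi x)^*%C).
Proof.
move=> /schwartz_bruhatP[N [K [sN iK]]]; apply/schwartz_bruhatP; exists N, K; split.
  by move=> x fx; apply: sN; apply: contraNneq fx => ->; rewrite rmorph0.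
by move=> x y yK; rewrite (iK x y yK).
Qed.

Lemma padic_char_normc (z : Qp) : normc (padic_char z) = 1.
Proof.
have := padic_char_norm z; rewrite -normc_sqr => /eqP.
by rewrite sqrp_eq1 ?normc_ge0// => /eqP.
Qed.

Lemma padic_char_conj (z : Qp) : (padic_char z)^*%C = padic_char (- z).
Proof.
have := mul_conjc (padic_char z); rewrite padic_char_normc expr1n rmorph1 => H.
have := padic_char_mulN z; move: (padic_char z) (padic_char (- z)) H => u v.
move=> uu vu; rewrite -[LHS]mul1r -vu -mulrA.
by rewrite uu mulr1.
Qed.

Lemma ft_zindE s a k : padic_abs s = 1 -> ft mu s (zind a k) =
  fun xi => vol k * (padic_char (s * dot xi a) * zind 0 (- k) xi).
Proof. by move=> s1; apply/funext => xi; exact: ft_zind. Qed.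

Lemma schwartz_bruhat_ft s phi : padic_abs s = 1 -> schwartz_bruhat phi ->
  schwartz_bruhat (ft mu s phi).
Proof.
move=> s1 sphi; suff [] : schwartz_bruhat phi /\ schwartz_bruhat (ft mu s phi) by [].
have s1' : padic_abs s <= 1 by rewrite s1.
apply: (schwartz_bruhat_ind (P := fun phi => schwartz_bruhat phi /\ schwartz_bruhat (ft mu s phi))) sphi.
  move=> c f g [f1 f2] [g1 g2]; rewrite (ftD mu_haar c s1' f1 g1).
  by split; [exact: (schwartz_bruhatD c f1 g1)|exact: (schwartz_bruhatD c f2 g2)].
move=> a k; split; first exact: schwartz_bruhat_zind.
rewrite (ft_zindE a k s1); apply: schwartz_bruhatZ.
exact: (schwartz_bruhat_char a s1' (schwartz_bruhat_zind 0 (- k))).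
Qed.

Lemma vol_mulVN (k : int) : vol k * vol (- k) = 1.
Proof.
rewrite -rmorphM/= -exprMn -expfzDr ?subrr ?expr0z ?expr1n ?rmorph1//.
by rewrite gt_eqF ?prime_gt0R.
Qed.

Lemma zind0B a k x : zind 0 k (a - x) = zind a k x.
Proof.
rewrite !zind_val; suff -> : zball 0 k (a - x) = zball a k x by [].
by rewrite /zball/= subr0 padic_normBC.
Qed.

Lemma zind_conj a k x : (zind a k x)^*%C = zind a k x :> C.
Proof. by rewrite !zind_val; case: asbool; rewrite ?rmorph1 ?rmorph0. Qed.

Lemma zind_sqr a k x : zind a k x * zind a k x = zind a k x :> C.
Proof. by rewrite !zind_val; case: asbool; rewrite ?mul1r ?mul0r. Qed.

(** For the indicator of a ball at a, the second transform is that of the dual ball evaluated at a -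
    x; duality returns to the original radius, and the two volumes cancel. *)
Lemma ft_inversion s phi : padic_abs s = 1 -> schwartz_bruhat phi ->
  ft mu (- s) (ft mu s phi) = phi.
Proof.
move=> s1 sphi; suff [] : schwartz_bruhat phi /\ ft mu (- s) (ft mu s phi) = phi by [].
have s1' : padic_abs s <= 1 by rewrite s1.
have sN1' : padic_abs (- s) <= 1 by rewrite padic_absN s1.
apply: (schwartz_bruhat_ind (P := fun phi => schwartz_bruhat phi /\ ft mu (- s) (ft mu s phi) = phi)) sphi.
  move=> c f g [f1 f2] [g1 g2]; split; first exact: (schwartz_bruhatD c f1 g1).
  rewrite (ftD mu_haar c s1' f1 g1).
  have sf := schwartz_bruhat_ft s1 f1; have sg := schwartz_bruhat_ft s1 g1.
  by rewrite (ftD mu_haar c sN1' sf sg) f2 g2.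
move=> a k; split; first exact: schwartz_bruhat_zind.
rewrite (ft_zindE a k s1); apply/funext => x.
have sz := schwartz_bruhat_char (a - x) s1' (schwartz_bruhat_zind 0 (- k)).
apply: (@etrans _ _ (vol k * ft mu s (zind 0 (- k)) (a - x))); last first.
  rewrite (ft_zind0 mu_haar (- k) (a - x) s1) opprK zind0B.
  move: (vol_mulVN k) (zind a k x) => H z; move: (vol k) (vol (- k)) H => u v uv.
  by rewrite mulrA uv mul1r.
rewrite !ftE; apply: (etrans _ (CintegralZ (vol k) (schwartz_bruhat_Cintegrable mu_haar sz))).
apply: eq_Cintegral => y.
have -> : padic_char (s * dot y (a - x)) =
    padic_char (- s * dot y x) * padic_char (s * dot y a).
  rewrite dotDr dotNr mulrDr padic_charD mulrN mulNr.
  by move: (padic_char (s * dot y a)) (padic_char (- (s * dot y x))) => u v; rewrite mulrC.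
move: (padic_char (- s * dot y x)) (padic_char (s * dot y a)) (zind _ _ _) (vol k) => u v z w.
by rewrite mulrCA (mulrA u).
Qed.

Let parseval s phi psi :=
  Cintegral mu (fun xi => ft mu s phi xi * (ft mu s psi xi)^*%C) =
  Cintegral mu (fun x => phi x * (psi x)^*%C).

(** Balls of one radius coincide or are disjoint, so the product of the two indicators is
    [zind b k a] times one of them. On the Fourier side the characters combine to the transform of
    the dual ball at b - a. *)
Lemma parseval_zind s a b k : padic_abs s = 1 -> parseval s (zind b k) (zind a k).
Proof.
move=> s1; have s1' : padic_abs s <= 1 by rewrite s1.
rewrite /parseval.
have za (x : V) : zind b k x * (zind a k x)^*%C = zind b k a * zind b k x :> C.
  have [ax|ax] := pselect (zball a k x); last first.
    have E1 : zind a k x = 0 :> C := zindN ax.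
    have E2 : zind b k a * zind b k x = 0 :> C.
      have [ba|ba] := pselect (zball b k a).
        have bx : ~ zball b k x by move=> bx; exact: (ax (zball_trans (zball_sym ba) bx)).
        by have -> : zind b k x = 0 :> C := zindN bx; exact: mulr0.
      by have -> : zind b k a = 0 :> C := zindN ba; exact: mul0r.
    rewrite E1 E2 conjc0; exact (mulr0 _).
  have E1 : zind a k x = 1 :> C := zindE ax.
  have -> : zind b k a = zind b k x :> C.
    have [bx|bx] := pselect (zball b k x).
      have ba : zball b k a := zball_trans bx (zball_sym ax).
      exact: (etrans (zindE ba) (esym (zindE bx))).
    have ba : ~ zball b k a by move=> ba; exact: (bx (zball_trans ba ax)).
    exact: (etrans (zindN ba) (esym (zindN bx))).
  rewrite E1 conjc1 zind_sqr; exact (mulr1 _).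
apply: (@etrans _ _ (zind b k a * vol k)); last first.
  rewrite -(Cintegral_zind mu_haar b k).
  apply: (etrans (esym (CintegralZ (zind b k a) (schwartz_bruhat_Cintegrable mu_haar (schwartz_bruhat_zind b k))))).
  exact (esym (eq_Cintegral mu za)).
rewrite (ft_zindE a k s1) (ft_zindE b k s1).
have sz := schwartz_bruhat_char (b - a) s1' (schwartz_bruhat_zind 0 (- k)).
apply: (@etrans _ _ (vol k * vol k * ft mu s (zind 0 (- k)) (b - a))); last first.
  rewrite (ft_zind0 mu_haar (- k) (b - a) s1) opprK zind0B.
  move: (vol_mulVN k) (zind b k a) => H z; move: (vol k) (vol (- k)) H => u v uv.
  by rewrite mulrA -(mulrA u) uv mulr1 mulrC.
rewrite ftE; apply: (etrans _ (CintegralZ (vol k * vol k) (schwartz_bruhat_Cintegrable mu_haar sz))).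
apply: eq_Cintegral => y.
have -> : padic_char (s * dot y (b - a)) =
    padic_char (s * dot y b) * (padic_char (s * dot y a))^*%C.
  by rewrite padic_char_conj dotDr dotNr mulrDr padic_charD mulrN.
have vv : (vol k)^*%C = vol k by rewrite /= oppr0.
move: vv (zind_conj 0 (- k) y) (zind_sqr 0 (- k) y).
move: (padic_char (s * dot y b)) (padic_char (s * dot y a)) (zind 0 (- k) y) (vol k).
move=> u v z w ww zz z2; rewrite !rmorphM/= ww zz -[in RHS]z2.
by move: (v^*)%C => v'; ring.
Qed.

(** Both functions are invariant under the smaller of their two balls. Applying [zinv_ind] at this
    common radius to each argument leaves only pairs of balls of equal radius. *)
Lemma ft_parseval s phi psi : padic_abs s = 1 ->
  schwartz_bruhat phi -> schwartz_bruhat psi -> parseval s phi psi.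
Proof.
move=> s1 /schwartz_bruhatP[N [K [sN iK]]] /schwartz_bruhatP[N' [K' [sN' iK']]].
have s1' : padic_abs s <= 1 by rewrite s1.
have Cint f g : schwartz_bruhat f -> schwartz_bruhat g ->
    Cintegrable mu (fun x => f x * (g x)^*%C).
  move=> sf sg; apply: (schwartz_bruhat_Cintegrable mu_haar).
  exact: (schwartz_bruhat_mul sf (schwartz_bruhat_conj sg)).
pose K0 := Num.min K K'.
have iK0 : zinv K0 phi by apply: (zinvW _ iK); rewrite ge_min lexx.
have iK0' : zinv K0 psi by apply: (zinvW _ iK'); rewrite ge_min lexx orbT.
have H1 a : schwartz_bruhat phi /\ parseval s phi (zind a K0).
  apply: (zinv_ind (P := fun phi => schwartz_bruhat phi /\ parseval s phi (zind a K0)) _ _ sN iK0).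
    move=> c f g [f1 f2] [g1 g2]; split; first exact: (schwartz_bruhatD c f1 g1).
    have sa := schwartz_bruhat_zind a K0.
    have hf := schwartz_bruhat_ft s1 f1; have hg := schwartz_bruhat_ft s1 g1.
    have ha := schwartz_bruhat_ft s1 sa.
    rewrite /parseval (ftD mu_haar c s1' f1 g1).
    apply: (@etrans _ _ (c * Cintegral mu (fun x => f x * (zind a K0 x)^*%C)
       + Cintegral mu (fun x => g x * (zind a K0 x)^*%C))).
      rewrite -f2 -g2; apply: (etrans _ (CintegralD c (Cint _ _ hf ha) (Cint _ _ hg ha))).
      apply: eq_Cintegral => x; cbv beta.
      by move: (ft _ _ f x) (ft _ _ g x) (ft _ _ (zind a K0) x) => u v w; rewrite mulrDl mulrA.
    apply: (etrans (esym (CintegralD c (Cint _ _ f1 sa) (Cint _ _ g1 sa)))).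
    apply: eq_Cintegral => x.
    by move: (f x) (g x) (zind _ _ x) => u v w; rewrite mulrDl mulrA.
  by move=> b; split; [exact: schwartz_bruhat_zind|exact: parseval_zind].
have sphi := (H1 0).1; have hphi := schwartz_bruhat_ft s1 sphi.
suff [] : schwartz_bruhat psi /\ parseval s phi psi by [].
apply: (zinv_ind (P := fun psi => schwartz_bruhat psi /\ parseval s phi psi) _ _ sN' iK0').
  move=> c f g [f1 f2] [g1 g2]; split; first exact: (schwartz_bruhatD c f1 g1).
  have hf := schwartz_bruhat_ft s1 f1; have hg := schwartz_bruhat_ft s1 g1.
  rewrite /parseval (ftD mu_haar c s1' f1 g1).
  apply: (@etrans _ _ (c^*%C * Cintegral mu (fun x => phi x * (f x)^*%C)
       + Cintegral mu (fun x => phi x * (g x)^*%C))).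
    rewrite -f2 -g2.
    apply: (etrans _ (CintegralD c^*%C (Cint _ _ hphi hf) (Cint _ _ hphi hg))).
    apply: eq_Cintegral => x; cbv beta.
    move: (ft _ _ phi x) (ft _ _ f x) (ft _ _ g x) => u v w.
    by rewrite rmorphD rmorphM/= mulrDr mulrCA.
  apply: (etrans (esym (CintegralD c^*%C (Cint _ _ sphi f1) (Cint _ _ sphi g1)))).
  apply: eq_Cintegral => x.
  move: (phi x) (f x) (g x) => u v w.
  by rewrite rmorphD rmorphM/= mulrDr mulrCA.
by move=> a; split; [exact: schwartz_bruhat_zind|exact: (H1 a).2].
Qed.

Definition rintegral (f : V -> R) : R := Rintegral mu setT (fun x : B => f x).

Lemma Re_Cintegral f : complex.Re (Cintegral mu f) = rintegral (fun x => complex.Re (f x)).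
Proof. by []. Qed.

Lemma ft_plancherel s phi : padic_abs s = 1 -> schwartz_bruhat phi ->
  rintegral (fun xi => normc (ft mu s phi xi) ^+ 2) = rintegral (fun x => normc (phi x) ^+ 2).
Proof.
move=> s1 sphi; have /(congr1 (@complex.Re R)) := ft_parseval s1 sphi sphi.
have E (f : V -> C) : complex.Re (Cintegral mu (fun x => f x * (f x)^*%C)) =
    rintegral (fun x => normc (f x) ^+ 2).
  rewrite Re_Cintegral; congr rintegral; apply/funext => x.
  by rewrite mul_conjc.
move=> H; exact: (etrans (esym (E _)) (etrans H (E _))).
Qed.

End FourierInversion.

(** * Estimates of quasielliptic symbols *)

Section QuasiellipticBounds.
Context {R : realType} {p : nat} {p_prime : prime p} {n : nat}.
Local Notation Qp := (padic R p_prime).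
Local Notation V := 'rV[Qp]_n.
Implicit Types (x y a b xi eta : V).
Let p_gt1 := @prime_gt1R R p p_prime.
Let p_gt0 := @prime_gt0R R p p_prime.
Let pz_gt0 := @pexpz_gt0 R p p_prime.
Let pz_ge0 := @pexpz_ge0 R p p_prime.
Hint Resolve p_gt1 p_gt0 pz_gt0 pz_ge0 padic_norm_ge0 padic_abs_ge0 : core.

Lemma padic_abs_bigprod (I : Type) (s : seq I) (F : I -> Qp) :
  padic_abs (\prod_(i <- s) F i) = \prod_(i <- s) padic_abs (F i).
Proof. exact: (big_morph _ (@padic_absM R p p_prime) padic_abs1). Qed.

Lemma prod_le1 (I : Type) (s : seq I) (F : I -> R) : (forall i, 0 <= F i <= 1) ->
  0 <= \prod_(i <- s) F i <= 1.
Proof.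
move=> F1; elim/big_rec: _ => [|i y _ /andP[y0 y1]]; first by rewrite ler01 lexx.
by have /andP[f0 f1] := F1 i; rewrite mulr_ge0//= mulr_ile1.
Qed.

(** Telescoping; as the inequality is ultrametric, nothing is lost with the number of factors. *)
Lemma padic_prod_lip (I : Type) (s : seq I) (F G : I -> Qp) (e : R) : 0 <= e ->
  (forall i, padic_abs (F i) <= 1) -> (forall i, padic_abs (G i) <= 1) ->
  (forall i, padic_abs (F i - G i) <= e) ->
  padic_abs (\prod_(i <- s) F i - \prod_(i <- s) G i) <= e.
Proof.
move=> e0 F1 G1 FG; elim: s => [|i s IH]; first by rewrite !big_nil subrr padic_abs0.
rewrite !big_cons; set P := \prod_(_ <- _) _ in IH *; set Q := \prod_(_ <- _) _ in IH *.
have P1 : padic_abs P <= 1.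
  rewrite /P padic_abs_bigprod.
  by have /andP[] := prod_le1 s (fun i => introT andP (conj (padic_abs_ge0 (F i)) (F1 i))).
have -> : F i * P - G i * Q = (F i - G i) * P + G i * (P - Q).
  by move: (F i) (G i) => u v; ring.
apply: (le_trans (padic_abs_max _ _)); rewrite ge_max !padic_absM; apply/andP; split.
  by rewrite -[e]mulr1; exact: (ler_pM (padic_abs_ge0 _) (padic_abs_ge0 _) (FG i) P1).
by rewrite -[e]mul1r; exact: (ler_pM (padic_abs_ge0 _) (padic_abs_ge0 _) (G1 i) IH).
Qed.

Lemma padic_pow_lip (u v : Qp) (m : nat) (e : R) : 0 <= e ->
  padic_abs u <= 1 -> padic_abs v <= 1 -> padic_abs (u - v) <= e ->
  padic_abs (u ^+ m - v ^+ m) <= e.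
Proof.
move=> e0 u1 v1 uv; rewrite -[m]card_ord -!prodr_const.
exact: (padic_prod_lip _ e0 (fun=> u1) (fun=> v1) (fun=> uv)).
Qed.

Lemma padic_abs_expr_le1 (u : Qp) (m : nat) : padic_abs u <= 1 -> padic_abs (u ^+ m) <= 1.
Proof. by move=> u1; rewrite padic_absX exprn_ile1 ?padic_abs_ge0. Qed.

Variables (f : mpoly n Qp) (d : nat) (w : 'I_n -> nat).
Hypothesis fw : quasielliptic f d w.

Lemma poly_evalE xi :
  poly_eval f xi = \sum_(m <- msupp f) mcoeff m f * \prod_i xi 0 i ^+ m i.
Proof. exact: mevalE. Qed.

Lemma quasielliptic_weight_gt0 i : (0 < w i)%N.
Proof. by case: fw. Qed.

Lemma quasielliptic_dim_gt0 : (0 < n)%N.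
Proof.
case: fw => _ fC _ _ _; rewrite lt0n; apply: contra_notN (fC (mcoeff (@mnm0 n) f)) => n0.
apply/mpolyP => m; rewrite mcoeffC.
have -> : m = (@mnm0 n) by apply/mnmP => i; have := ltn_ord i; rewrite [X in (_ < X)%N](eqP n0).
by rewrite eqxx mulr1.
Qed.

Lemma quasielliptic_eq0 xi : poly_eval f xi = 0 <-> xi = 0.
Proof. by case: fw. Qed.

Lemma quasielliptic_hom (l : Qp) xi : l != 0 ->
  poly_eval f (\row_i (l ^+ w i * xi 0 i)) = l ^+ d * poly_eval f xi.
Proof. by case: fw => _ _ _ H _; exact: H. Qed.

Lemma padic_abs_seqsum_le (I : Type) (s : seq I) (F : I -> Qp) (e : R) : 0 <= e ->
  (forall i, padic_abs (F i) <= e) -> padic_abs (\sum_(i <- s) F i) <= e.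
Proof.
move=> e0 Fe; elim/big_rec: _ => [|i y _ ye]; first by rewrite padic_abs0.
by apply: (le_trans (padic_abs_max _ _)); rewrite ge_max Fe.
Qed.

Lemma poly_eval_le1 xi : padic_norm xi <= 1 -> padic_abs (poly_eval f xi) <= 1.
Proof.
move=> /(padic_norm_leP _ ler01) x1; case: fw => _ _ f1 _ _.
rewrite poly_evalE; apply: padic_abs_seqsum_le => // m.
rewrite padic_absM mulr_ile1 ?padic_abs_ge0//.
rewrite padic_abs_bigprod.
by have /andP[] := prod_le1 (index_enum 'I_n) (fun i => introT andP
  (conj (padic_abs_ge0 (xi 0 i ^+ m i)) (padic_abs_expr_le1 (m i) (x1 i)))).
Qed.

(** Coefficients in Z_p make each term 1-Lipschitz on Z_p^n, and an ultrametric sum is no worse than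
    its worst term. *)
Lemma poly_eval_lip x y : padic_norm x <= 1 -> padic_norm y <= 1 ->
  padic_abs (poly_eval f x - poly_eval f y) <= padic_norm (x - y).
Proof.
move=> /(padic_norm_leP _ ler01) x1 /(padic_norm_leP _ ler01) y1.
case: fw => _ _ f1 _ _; rewrite !poly_evalE -sumrB.
apply: padic_abs_seqsum_le => // m; rewrite -mulrBr padic_absM -[X in _ <= X]mul1r.
apply: (ler_pM (padic_abs_ge0 _) (padic_abs_ge0 _) (f1 m)); apply: padic_prod_lip => //.
- by move=> i; apply: padic_abs_expr_le1.
- by move=> i; apply: padic_abs_expr_le1.
- move=> i; apply: padic_pow_lip => //.
  by have := padic_abs_le_norm (x - y) i; rewrite !mxE.
Qed.

Lemma poly_eval_abs_eq x y : padic_norm x <= 1 -> padic_norm y <= 1 ->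
  padic_norm (y - x) < padic_abs (poly_eval f x) ->
  padic_abs (poly_eval f y) = padic_abs (poly_eval f x).
Proof.
move=> x1 y1 xy.
have -> : poly_eval f y = poly_eval f x + (poly_eval f y - poly_eval f x).
  by move: (poly_eval f y) (poly_eval f x) => u v; rewrite addrC subrK.
by apply: padic_absD_lt; apply: le_lt_trans xy; exact: poly_eval_lip.
Qed.

(** What remains of Z_p^n after removing its image under the dilation of the coordinates by
    p^(w_i). *)
Definition wsphere xi := padic_norm xi <= 1 /\
  exists i, p%:R ^ (- (w i)%:Z) < padic_abs (xi 0 i).

(* Compactness: on a fundamental domain of the action of the powers of p, the
   nowhere vanishing continuous function |f| is bounded below. *)
Lemma wsphere_bound : exists2 c : R, 0 < c &
  forall xi, wsphere xi -> c <= padic_abs (poly_eval f xi).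
Proof.
have := @zball_compact R p p_prime n 0; rewrite compact_cover => cA.
pose W (x : V) := forall i, padic_abs (x 0 i) <= p%:R ^ (- (w i)%:Z).
(* The cover is of all of Z_p^n: around a point of [W], outside the sphere, the chosen ball stays in
   [W]; around any other point its radius is below |f|, so that |f| is constant on its part in
   Z_p^n. *)
have /choice[k kP] : forall x, exists k : nat,
    (W x -> forall y, zball x (- k%:Z) y -> W y) /\
    (~ W x -> p%:R ^ (- k%:Z) < padic_abs (poly_eval f x)).
  move=> x; have [Wx|Wx] := pselect (W x).
    exists (\max_i w i)%N; split=> // _ y xy i.
    have -> : y 0 i = (y - x) 0 i + x 0 i by rewrite !mxE subrK.
    apply: (le_trans (padic_abs_max _ _)); rewrite ge_max; apply/andP; split; last exact: (Wx i).
    apply: (le_trans (padic_abs_le_norm _ _)); apply: (le_trans xy).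
    by rewrite le_pexpz// lerN2 lez_nat; exact: (leq_bigmax_cond (F := w)).
  have fx0 : 0 < padic_abs (poly_eval f x).
    rewrite padic_abs_gt0; apply/eqP => /quasielliptic_eq0 x0; apply: Wx => i.
    by rewrite x0 mxE padic_abs0.
  by have [k kf] := @pexp_small R p p_prime _ fx0; exists k.
have [|D DA AD] := cA V (zball 0 0) (fun x => zball x (- (k x)%:Z))
    (fun x _ => @zball_open R p p_prime n x _).
  by move=> x Ax; exists x => //; exact: zball_center.
have [M MP] := seq_int_bounds (finmap.enum_fset D) (fun a => (k a)%:Z).
exists (p%:R ^ (- M%:Z)) => // xi [xi1 [i xii]].
have [|a /= aD xia] := AD xi; first by rewrite zball0E expr0z.
have Aa : zball 0 0 a by have := DA a aD; rewrite inE.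
have Wa : ~ W a.
  by move=> /(kP a).1/(_ xi xia)/(_ i); rewrite leNgt xii.
have kfa := (kP a).2 Wa.
rewrite (@poly_eval_abs_eq a xi)//; last 2 first.
- by move: Aa; rewrite zball0E expr0z.
- exact: (le_lt_trans xia).
apply: (le_trans _ (ltW kfa)); rewrite le_pexpz// lerN2.
by have /andP[] := MP _ aD.
Qed.

(** For d = 0 the nonzero value f(1, ..., 1) would be repeated at points tending to 0, against the
    Lipschitz bound and f(0) = 0. *)
Lemma quasielliptic_deg_gt0 : (0 < d)%N.
Proof.
rewrite lt0n; apply/eqP => d0.
have [c c0 cP] := wsphere_bound.
have i0 : 'I_n by exact: (Ordinal quasielliptic_dim_gt0).
pose e : V := \row_i 1.
have fe : 0 < padic_abs (poly_eval f e).
  rewrite padic_abs_gt0; apply/eqP => /quasielliptic_eq0/rowP/(_ i0)/eqP.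
  by rewrite !mxE oner_eq0.
have [k kf] := @pexp_small R p p_prime _ fe.
have := quasielliptic_hom e (expf_neq0 k (padic_p_neq0)).
rewrite d0 expr0 mul1r; set l := p%:R ^+ k => E.
have al : padic_abs l = p%:R ^ (- k%:Z).
  by rewrite /l exprnP padic_abs_pz.
have ll : padic_abs l <= 1.
  by rewrite al -(expr0z p%:R) le_pexpz// oppr_le0.
have f0 : poly_eval f 0 = 0 by apply/quasielliptic_eq0.
have n1 : padic_norm (\row_i (l ^+ w i * e 0 i) - 0 : V) <= p%:R ^ (- k%:Z).
  apply/padic_norm_leP => // i; rewrite !mxE mulr1 subr0 padic_absX -al.
  by rewrite ler_iXnr ?padic_abs_ge0 ?quasielliptic_weight_gt0.
have n2 : padic_norm (\row_i (l ^+ w i * e 0 i) : V) <= 1.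
  by rewrite -[X in padic_norm X]subr0 (le_trans n1)// -al.
have n3 : padic_norm (0 : V) <= 1 by rewrite padic_norm0.
have := poly_eval_lip n2 n3; rewrite f0 subr0 E => /le_trans/(_ n1).
by rewrite leNgt kf.
Qed.

End QuasiellipticBounds.

(** * Comparison of the symbol with Xi *)

Section SymbolBounds.
Context {R : realType} {p : nat} {p_prime : prime p} {n : nat}.
Local Notation Qp := (padic R p_prime).
Local Notation V := 'rV[Qp]_n.
Implicit Types (x y a b xi eta : V).
Let p_gt1 := @prime_gt1R R p p_prime.
Let p_gt0 := @prime_gt0R R p p_prime.
Let pz_gt0 := @pexpz_gt0 R p p_prime.
Let pz_ge0 := @pexpz_ge0 R p p_prime.
Hint Resolve p_gt1 p_gt0 pz_gt0 pz_ge0 padic_norm_ge0 padic_abs_ge0 : core.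

Variables (f : mpoly n Qp) (d : nat) (w : 'I_n -> nat).
Hypothesis fw : quasielliptic f d w.
Let w_gt0 := quasielliptic_weight_gt0 fw.
Let n_gt0 := quasielliptic_dim_gt0 fw.
Let d_gt0 := quasielliptic_deg_gt0 fw.

(** The exponent j is that of the smallest weighted box containing xi. *)
Lemma weighted_scale xi : xi != 0 -> exists j : int,
  (forall i, padic_abs (xi 0 i) <= p%:R ^ (j * (w i)%:Z)) /\
  exists i, p%:R ^ ((j - 1) * (w i)%:Z) < padic_abs (xi 0 i).
Proof.
move=> xi0.
have [j1 /ltW j1P] := @pexp_unbounded R p p_prime (padic_norm xi).
have [i0 i0P] : exists i, xi 0 i != 0.
  apply: contrapT => H; move/eqP: xi0; apply; apply/rowP => i; rewrite mxE.
  by apply/eqP; apply: contrapT => /negP xi0; apply: H; exists i.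
have a0 : 0 < padic_abs (xi 0 i0) by rewrite padic_abs_gt0.
have [j0 j0P] := @pexp_small R p p_prime _ a0.
(* The exponent may be negative, so the search over naturals is shifted by j0, chosen such that the
   box of exponent -j0 is already too small for the coordinate i0. *)
pose Q (m : nat) := [forall i, padic_abs (xi 0 i) <= p%:R ^ ((m%:Z - j0%:Z) * (w i)%:Z)].
have exQ : exists m, Q m.
  exists (j1 + j0)%N; apply/forallP => i; have wi := w_gt0 i.
  apply: (le_trans (padic_abs_le_norm _ _)); apply: (le_trans j1P).
  have -> : (j1 + j0)%N%:Z - j0%:Z = j1%:Z by lia.
  by rewrite le_pexpz//; nia.
case: (ex_minnP exQ) => -[|m] Qm mmin.
  have := forallP Qm i0; rewrite leNgt => /negP[].
  apply: le_lt_trans j0P; rewrite le_pexpz//; have := w_gt0 i0; nia.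
exists (m.+1%:Z - j0%:Z); split; first by move=> i; exact: (forallP Qm).
have : ~~ Q m by apply/negP => /mmin; rewrite ltnn.
have -> : m.+1%:Z - j0%:Z - 1 = m%:Z - j0%:Z by lia.
move=> /negP nQ; apply: contrapT => H; apply: nQ; apply/forallP => i.
by rewrite leNgt; apply/negP => ij; apply: H; exists i.
Qed.

(** The dilation by l = p^j, of absolute value p^(-j), moves xi into [wsphere] and multiplies f by
    l^d; on the sphere |f| lies between c and 1. *)
Lemma weighted_scale_eval (c : R) :
  (forall xi, wsphere w xi -> c <= padic_abs (poly_eval f xi)) ->
  forall xi (j : int),
  (forall i, padic_abs (xi 0 i) <= p%:R ^ (j * (w i)%:Z)) ->
  (exists i, p%:R ^ ((j - 1) * (w i)%:Z) < padic_abs (xi 0 i)) ->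
  c * p%:R ^ (j * d%:Z) <= padic_abs (poly_eval f xi) <= p%:R ^ (j * d%:Z).
Proof.
move=> cP xi j le_j [i ij].
pose l : Qp := p%:R ^ j; have l0 : l != 0 by rewrite expfz_neq0// padic_p_neq0.
pose eta : V := \row_i (l ^+ w i * xi 0 i).
have al m : padic_abs l ^+ m = p%:R ^ (- (j * m%:Z)).
  by rewrite padic_abs_pz exprnP exprz_exp mulNr.
have aeta i' : padic_abs (eta 0 i') = p%:R ^ (- (j * (w i')%:Z)) * padic_abs (xi 0 i').
  by rewrite mxE padic_absM padic_absX al.
have fE : padic_abs (poly_eval f xi) = padic_abs (poly_eval f eta) * p%:R ^ (j * d%:Z).
  rewrite /eta (quasielliptic_hom fw _ l0) padic_absM padic_absX al mulrAC.
  by rewrite -expfzDr ?gt_eqF// addNr expr0z mul1r.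
have eta1 : padic_norm eta <= 1.
  apply/padic_norm_leP => // i'; rewrite aeta -invr_expz ler_pdivrMl// mulr1; exact: le_j.
have weta : wsphere w eta.
  split => //; exists i; rewrite aeta -[X in _ < X]mulrC -ltr_pdivrMr//.
  apply: le_lt_trans ij; rewrite invr_expz -expfzDr ?gt_eqF// le_pexpz//; nia.
rewrite fE; apply/andP; split; first by rewrite ler_pM2r// cP.
by rewrite ler_piMl// (poly_eval_le1 fw).
Qed.

(** The exponents d / w_i in Xi are those that make all coordinates scale alike. *)
Lemma powR_weight (j : int) i :
  (p%:R ^ (j * (w i)%:Z)) `^ (d%:R / (w i)%:R) = p%:R ^ (j * d%:Z) :> R.
Proof.
have wi : (w i)%:R != 0 :> R by rewrite pnatr_eq0 -lt0n w_gt0.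
rewrite -!powR_intmul ?ltW// -powRrM; congr (_ `^ _).
by rewrite !intrM; field.
Qed.

Lemma Xi_scale xi (j : int) :
  (forall i, padic_abs (xi 0 i) <= p%:R ^ (j * (w i)%:Z)) ->
  (exists i, p%:R ^ ((j - 1) * (w i)%:Z) < padic_abs (xi 0 i)) ->
  p%:R ^ ((j - 1) * d%:Z) <= Xi d w xi <= n%:R * p%:R ^ (j * d%:Z).
Proof.
move=> le_j [i /ltW ij]; apply/andP; split.
  rewrite /Xi (bigD1 i)//= -(powR_weight _ i) -[X in X <= _]addr0 lerD//.
    by rewrite ge0_ler_powR ?nnegrE ?divr_ge0 ?padic_abs_ge0.
  by apply: sumr_ge0 => k _; exact: powR_ge0.
rewrite /Xi -[X in X%:R * _]card_ord -sumr_const mulr_suml.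
apply: ler_sum => k _; rewrite mul1r -(powR_weight _ k).
by rewrite ge0_ler_powR ?nnegrE ?divr_ge0 ?padic_abs_ge0.
Qed.

(** A dilation by p^N brings xi and its neighbours into Z_p^n, where [poly_eval_abs_eq] applies. *)
Lemma poly_eval_loc_const xi : xi != 0 ->
  exists k : nat, forall y, zball xi (- k%:Z) y ->
    padic_abs (poly_eval f y) = padic_abs (poly_eval f xi).
Proof.
move=> xi0; have [N /ltW NP] := @pexp_unbounded R p p_prime (padic_norm xi).
pose l : Qp := p%:R ^ N%:Z; have l0 : l != 0 by rewrite expfz_neq0// padic_p_neq0.
have al : padic_abs l = p%:R ^ (- N%:Z) by rewrite padic_abs_pz.
pose T y : V := \row_i (l ^+ w i * y 0 i).
have al1 : padic_abs l <= 1 by rewrite al -(expr0z p%:R) le_pexpz// oppr_le0.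
have TN y : padic_norm (T y) <= p%:R ^ (- N%:Z) * padic_norm y.
  apply/padic_norm_leP => [|i]; first by rewrite mulr_ge0 ?padic_norm_ge0.
  rewrite mxE padic_absM padic_absX.
  apply: ler_pM; rewrite ?exprn_ge0 ?padic_abs_ge0 ?padic_abs_le_norm//.
  by rewrite -al ler_iXnr ?padic_abs_ge0.
have TN1 y : padic_norm y <= p%:R ^ N%:Z -> padic_norm (T y) <= 1.
  by move=> yN; apply: (le_trans (TN y)); rewrite -invr_expz ler_pdivrMl// mulr1.
have TB x y : T x - T y = T (x - y).
  by apply/rowP => i; rewrite !mxE mulrBr.
have fT y : padic_abs (poly_eval f (T y)) = (p%:R ^ (- N%:Z)) ^+ d * padic_abs (poly_eval f y).
  by rewrite /T (quasielliptic_hom fw _ l0) padic_absM padic_absX al.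
have fTxi : 0 < padic_abs (poly_eval f (T xi)).
  rewrite fT mulr_gt0 ?exprn_gt0// padic_abs_gt0; apply/eqP => /(quasielliptic_eq0 fw) x0.
  by rewrite x0 eqxx in xi0.
have [k kP] := @pexp_small R p p_prime _ fTxi.
exists k => y xy.
have yN : padic_norm y <= p%:R ^ N%:Z.
  rewrite -(subrK xi y); apply: padic_normD_le NP.
  by apply: (le_trans xy); rewrite le_pexpz// (@le_trans _ _ 0)// oppr_le0.
have H : padic_abs (poly_eval f (T y)) = padic_abs (poly_eval f (T xi)).
  apply: (poly_eval_abs_eq fw (TN1 _ NP) (TN1 _ yN)); apply: le_lt_trans kP.
  rewrite TB; apply: (le_trans (TN _)); apply: le_trans xy.
  by rewrite ler_piMl ?padic_norm_ge0// -al.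
apply: (mulfI (lt0r_neq0 (exprn_gt0 d (pz_gt0 (- N%:Z))))); exact (etrans (esym (fT y)) (etrans H (fT xi))).
Qed.

Lemma mmap1_weight_le xi (j : int) (k : multinom n) :
  (forall i, padic_abs (xi 0 i) <= p%:R ^ (j * (w i)%:Z)) ->
  padic_abs (mmap1 (fun i => xi 0 i) k) <= p%:R ^ (j * (weight w k)%:Z).
Proof.
move=> le_j; rewrite /mmap1 padic_abs_bigprod.
have -> : p%:R ^ (j * (weight w k)%:Z) = \prod_(i < n) (p%:R ^ (j * (w i)%:Z)) ^+ k i :> R.
  rewrite /weight (big_morph Posz PoszD (erefl 0%:Z)) mulr_sumr.
  rewrite (big_morph (fun z : int => (p%:R : R) ^ z) (id1 := 1) (op1 := *%R)) ?expr0z//; last first.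
    by move=> z1 z2; rewrite expfzDr// gt_eqF.
  by apply: eq_bigr => i _; rewrite exprnP exprz_exp; congr (_ ^ _); rewrite PoszM; ring.
apply: ler_prod => i _; rewrite padic_abs_ge0 padic_absX lerXn2r ?nnegrE ?padic_abs_ge0//.
Qed.

(* For large frequencies the lower order terms are strictly dominated by f, so
   by the ultrametric inequality |F(xi, x)| = |f(xi)| does not depend on x. *)
Lemma symbol_bounds (c : multinom n -> V -> Qp) :
  (forall k, (weight w k < d)%N -> exists M : R, forall x : V, padic_abs (c k x) <= M) ->
  exists M0 : nat, exists A0 A1 : R, [/\ 0 < A0, 0 < A1 &
    forall xi, p%:R ^+ M0 <= padic_norm xi ->
      A0 * Xi d w xi <= padic_abs (poly_eval f xi) <= A1 * Xi d w xi /\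
      forall x, padic_abs (symbol f d w c xi x) = padic_abs (poly_eval f xi)].
Proof.
move=> cB; have [c0 c0_gt0 c0P] := wsphere_bound fw.
have /choice[M MP] : forall k : bmultinom n d, exists M : R, 0 <= M /\
    ((weight w k < d)%N -> forall x : V, padic_abs (c k x) <= M).
  move=> k; have [kd|kd] := boolP (weight w k < d)%N; last by exists 0.
  have [M MP] := cB k kd; exists (Num.max 0 M); split; first by rewrite le_max lexx.
  by move=> _ x; rewrite le_max MP orbT.
pose Ms := \sum_k M k.
have MsP k : M k <= Ms.
  by rewrite /Ms (bigD1 k)//= lerDl sumr_ge0// => i _; case: (MP i).
have Ms0 : 0 <= Ms by apply: sumr_ge0 => i _; case: (MP i).
have [J JP] := @pexp_unbounded R p p_prime (Ms / c0).
pose wm := (\max_i w i)%N.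
have n0 : 0 < n%:R :> R by rewrite ltr0n.
(* J makes c0 p^J exceed all coefficients. M0 forces j >= J, since j < J would bound every
   coordinate by p^(J wm), below p^M0. The constants compare c0 p^(jd) <= |f| <= p^(jd) with
   p^((j-1)d) <= Xi <= n p^(jd). *)
exists (J * wm).+1, (c0 / n%:R), (p%:R ^ d%:Z); split => // [|xi xiM].
  by rewrite divr_gt0.
have xi0 : xi != 0.
  apply: contraTneq xiM => ->; rewrite padic_norm0 -ltNge exprn_gt0//.
have [j [le_j ij]] := weighted_scale xi0.
have /andP[f1 f2] := weighted_scale_eval c0P le_j ij.
have /andP[X1 X2] := Xi_scale le_j ij.
have Jj : J%:Z <= j.
  rewrite leNgt; apply/negP => jJ; move: xiM; rewrite leNgt => /negP; apply.
  apply: (@le_lt_trans _ _ (p%:R ^ (J * wm)%N%:Z)); last by rewrite exprnP lt_pexpz// ltz_nat.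
  apply/padic_norm_leP => // i; apply: (le_trans (le_j i)); rewrite le_pexpz//.
  have wi : (w i <= wm)%N by exact: (leq_bigmax_cond (F := w)).
  apply: (@le_trans _ _ (J%:Z * (w i)%:Z)).
    by rewrite ler_pM2r ?ltz_nat ?w_gt0// ltW.
  by rewrite -PoszM lez_nat leq_mul2l wi orbT.
split.
  apply/andP; split.
    apply: le_trans f1; rewrite -mulrA ler_pM2l// ler_pdivrMl//.
  apply: (le_trans f2).
  have -> : p%:R ^ (j * d%:Z) = p%:R ^ d%:Z * p%:R ^ ((j - 1) * d%:Z) :> R.
    by rewrite -expfzDr ?gt_eqF//; congr (_ ^ _); ring.
  by rewrite ler_pM2l.
move=> x; rewrite /symbol; apply: padic_absD_lt; apply: padic_abs_sum_lt.
  by apply: lt_le_trans f1; rewrite mulr_gt0.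
move=> k kd; apply: lt_le_trans f1; rewrite padic_absM.
apply: (@le_lt_trans _ _ (Ms * p%:R ^ (j * (weight w k)%:Z))).
  apply: ler_pM; rewrite ?padic_abs_ge0//; last exact: mmap1_weight_le.
  by apply: le_trans (MsP k); exact: (MP k).2.
apply: (@lt_le_trans _ _ (c0 * p%:R ^ J%:Z * p%:R ^ (j * (weight w k)%:Z))).
  by rewrite ltr_pM2r// mulrC -ltr_pdivrMr.
(* The weight is at most d - 1, which leaves a spare factor p^j to absorb p^J. *)
rewrite -mulrA ler_pM2l// -expfzDr ?gt_eqF// le_pexpz//.
apply: (@le_trans _ _ (j * ((weight w k)%:Z + 1))).
  by rewrite mulrDr mulr1 addrC lerD2l.
by rewrite ler_wpM2l ?(le_trans _ Jj)// lezD1 ltz_nat.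
Qed.

(** The smallest exponent d / w_i belongs to the largest weight; this is the growth guaranteed in
    every direction, and it decides how large beta must be for the inverse weight to be
    integrable. *)
Lemma Xi_norm_ge xi (j : nat) : p%:R ^ j%:Z <= padic_norm xi ->
  (p%:R ^ j%:Z) `^ (d%:R / (\max_i w i)%N%:R) <= Xi d w xi.
Proof.
move=> jxi; pose wm := (\max_i w i)%N.
have [i ij] : exists i, p%:R ^ j%:Z <= padic_abs (xi 0 i).
  apply: contrapT => H; move: jxi; apply/negP; rewrite -ltNge; apply/padic_norm_ltP => // i.
  by rewrite ltNge; apply/negP => ij; apply: H; exists i.
have wi : (w i <= wm)%N by exact: (leq_bigmax_cond (F := w)).
have wi0 : 0 < (w i)%:R :> R by rewrite ltr0n w_gt0.
rewrite /Xi [X in _ <= X](bigD1 i)//=.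
apply: (@le_trans _ _ (padic_abs (xi 0 i) `^ (d%:R / (w i)%:R))); last first.
  by rewrite lerDl; apply: sumr_ge0 => k _; exact: powR_ge0.
apply: (@le_trans _ _ ((p%:R ^ j%:Z) `^ (d%:R / (w i)%:R))).
  apply: ler_powR; first by rewrite -(expr0z p%:R) le_pexpz.
  by rewrite ler_pM2l ?ltr0n// lef_pV2 ?posrE ?ltr0n ?ler_nat// (leq_trans _ wi)// w_gt0.
by rewrite ge0_ler_powR ?nnegrE ?divr_ge0 ?padic_abs_ge0.
Qed.

Lemma Xi_ge1 xi : 1 <= padic_norm xi -> 1 <= Xi d w xi.
Proof. by move=> xi1; have := @Xi_norm_ge xi 0; rewrite expr0z powR1; exact. Qed.

End SymbolBounds.

(** * Extension of isomorphisms to completions *)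

Section RealNorm.
Context {R : realType} {H : normedModType R[i]}.
Implicit Types (x y : H).
Local Notation normc := ComplexField.Normc.normc.

(** Norms of modules over R[i] take values in R[i]; by [rnormE] the real part loses nothing, and
    estimates can be made in R. *)
Definition rnorm x : R := complex.Re `|x|.

Lemma rnormE x : `|x| = real_complex R (rnorm x).
Proof.
have : 0 <= `|x| by exact: normr_ge0.
by rewrite /rnorm lecE/=; case: (`|x|) => a b /= /andP[/eqP -> _].
Qed.

Lemma rnorm_ge0 x : 0 <= rnorm x.
Proof. by rewrite -lecR -rnormE normr_ge0. Qed.

Lemma rnormD x y : rnorm (x + y) <= rnorm x + rnorm y.
Proof. by rewrite -lecR rmorphD/= -!rnormE ler_normD. Qed.

Lemma rnormZ (c : R[i]) x : rnorm (c *: x) = normc c * rnorm x.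
Proof. by apply: complexI; rewrite rmorphM/= -!rnormE normrZ normc_norm. Qed.

Lemma rnormN x : rnorm (- x) = rnorm x.
Proof. by rewrite /rnorm normrN. Qed.

Lemma rnormBC x y : rnorm (x - y) = rnorm (y - x).
Proof. by rewrite -rnormN opprB. Qed.

Lemma rnorm0 : rnorm (0 : H) = 0.
Proof. by rewrite /rnorm normr0. Qed.

Lemma rnorm_eq0 x : rnorm x = 0 -> x = 0.
Proof. by move=> x0; apply/eqP; rewrite -normr_eq0 rnormE x0. Qed.

Lemma rnorm_triangle y x z : rnorm (x - z) <= rnorm (x - y) + rnorm (y - z).
Proof. by rewrite -[X in rnorm X <= _](subrKA y) rnormD. Qed.

Lemma gt0_realcomplex (e : R[i]) : 0 < e -> exists2 r : R, 0 < r & e = real_complex R r.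
Proof.
by rewrite ltcE/=; case: e => a b /= /andP[/eqP -> a0]; exists a.
Qed.

Lemma nbhs_rnormP x (A : set H) :
  nbhs x A <-> exists2 e : R, 0 < e & forall y, rnorm (x - y) < e -> A y.
Proof.
split=> [/nbhs_ballP|] [e /= e0 HA].
  have [r r0 er] := gt0_realcomplex e0; exists r => // y xy; apply: HA.
  by rewrite -ball_normE /ball_/= er rnormE ltcR.
apply/nbhs_ballP; exists (real_complex R e) => /=; first by rewrite ltcR.
by move=> y; rewrite -ball_normE /ball_/= rnormE ltcR => /HA.
Qed.

Lemma dense_rnorm (A : set H) : dense A ->
  forall x (e : R), 0 < e -> exists2 y, A y & rnorm (y - x) < e.
Proof.
move=> dA x e e0; pose O : set H := [set y | rnorm (x - y) < e].
have oO : open O.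
  rewrite openE => y xy; apply/nbhs_rnormP; exists (e - rnorm (x - y)).
    by rewrite subr_gt0.
  by move=> z; rewrite ltrBrDl; apply: le_lt_trans; exact: rnorm_triangle.
have [|y [yO Ay]] := dA O _ oO.
  by exists x; rewrite /O/= subrr rnorm0.
by exists y; rewrite // rnormBC.
Qed.

Lemma cvg_rnormP (u : nat -> H) x : u @ \oo --> x <->
  forall e : R, 0 < e -> exists N, forall k, (N <= k)%N -> rnorm (x - u k) < e.
Proof.
split=> [ux e e0|ux A /nbhs_rnormP[e e0 eA]].
  have /ux[N _ NP] : nbhs x [set y | rnorm (x - y) < e] by apply/nbhs_rnormP; exists e.
  by exists N => k; exact: NP.
by have [N NP] := ux e e0; exists N => // k /= /NP/eA.
Qed.

End RealNorm.

Lemma rnorm_cauchy_cvg (R : realType) (H : completeNormedModType R[i]) (u : nat -> H) :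
  (forall e : R, 0 < e -> exists N, forall k l, (N <= k)%N -> (N <= l)%N ->
     rnorm (u k - u l) < e) -> exists x : H, u @ \oo --> x.
Proof.
move=> cu; suff : cvgn u by move=> uc; exists (limn u).
apply: cauchy_cvg; apply: cauchy_exP => e e0.
have [r r0 er] := gt0_realcomplex e0; have [N NP] := cu r r0.
exists (u N); exists N => // k /= Nk.
by rewrite -ball_normE /ball_/= er rnormE ltcR NP.
Qed.

(* The closure of the graph of a linear map that is bounded above and below
   on a dense subspace is the graph of an isomorphism of the completions. *)
Section DenseExtension.
Context {R : realType} {U : Type} (D : set U).
Local Notation normc := ComplexField.Normc.normc.

Definition graph_closure (H H' : normedModType R[i]) (e : U -> H) (e' : U -> H')
    (x : H) (y : H') := forall r : R, 0 < r ->
  exists2 u, D u & rnorm (e u - x) < r /\ rnorm (e' u - y) < r.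

(** U carries no linear structure; t stands for c u + v under both maps at once. *)
Definition compatible (H H' : normedModType R[i]) (e : U -> H) (e' : U -> H') :=
  forall c u v, D u -> D v -> exists2 t, D t &
    e t = c *: e u + e v /\ e' t = c *: e' u + e' v.

Lemma graph_closureC (H H' : normedModType R[i]) (e : U -> H) (e' : U -> H') x y :
  graph_closure e e' x y -> graph_closure e' e y x.
Proof. by move=> G r /G[u Du []]; exists u. Qed.

Lemma graph_closure_lin (H H' : normedModType R[i]) (e : U -> H) (e' : U -> H') c x y x' y' :
  compatible e e' -> graph_closure e e' x y -> graph_closure e e' x' y' ->
  graph_closure e e' (c *: x + x') (c *: y + y').
Proof.
move=> comp G G' r r0; pose M := normc c + 1.
have M0 : 0 < M by rewrite ltr_pwDr ?normc_ge0.
have [u Du [u1 u2]] := G _ (divr_gt0 r0 (mulr_gt0 (ltr0n R 2) M0)).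
have [v Dv [v1 v2]] := G' _ (divr_gt0 r0 (ltr0n R 2)).
have [t Dt [t1 t2]] := comp c u v Du Dv; exists t => //; rewrite t1 t2.
have H1 (K : normedModType R[i]) (a b a' b' : K) :
    rnorm (a - b) < r / (2 * M) -> rnorm (a' - b') < r / 2 ->
    rnorm (c *: a + a' - (c *: b + b')) < r.
  move=> ab ab'; rewrite opprD addrACA -scalerBr.
  apply: (le_lt_trans (rnormD _ _)); rewrite rnormZ.
  have -> : r = r / 2 + r / 2 by lra.
  apply: ler_ltD => //; apply: (@le_trans _ _ (M * (r / (2 * M)))).
    by apply: ler_pM; rewrite ?normc_ge0 ?rnorm_ge0// ?lerDl// ltW.
  by rewrite le_eqVlt; apply/orP; left; apply/eqP; field; rewrite gt_eqF.
by split; exact: H1.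
Qed.

(** The bound survives in the closure. At x = 0 it makes the second coordinate unique, and on
    differences it gives continuity. *)
Lemma graph_closure_le (H H' : normedModType R[i]) (e : U -> H) (e' : U -> H') (C : R) x y :
  0 <= C -> (forall u, D u -> rnorm (e' u) <= C * rnorm (e u)) ->
  graph_closure e e' x y -> rnorm y <= C * rnorm x.
Proof.
move=> C0 bnd G; apply/ler_addgt0Pr => r r0.
have r0' : 0 < r / (C + 1) by rewrite divr_gt0// ltr_wpDl.
have [u Du [u1 u2]] := G _ r0'.
have y1 : rnorm y <= rnorm (e' u) + r / (C + 1).
  rewrite -[y](subrK (e' u)) addrC; apply: (le_trans (rnormD _ _)).
  by rewrite lerD2l rnormBC ltW.
have u3 : rnorm (e u) <= rnorm x + r / (C + 1).
  rewrite -[e u](subrK x) addrC; apply: (le_trans (rnormD _ _)).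
  by rewrite lerD2l ltW.
apply: (le_trans y1); apply: (le_trans (lerD (bnd u Du) (lexx _))).
have := ler_wpM2l C0 u3; set q := r / (C + 1) => H1.
apply: (@le_trans _ _ (C * (rnorm x + q) + q)); first by rewrite lerD2r.
have : (C + 1) * q = r by rewrite /q mulrC divfK// gt_eqF// ltr_wpDl.
by move=> <-; lra.
Qed.

(** The bound turns a sequence in D approximating x into one whose images are Cauchy, and the target
    is complete. *)
Lemma graph_closure_total (H : normedModType R[i]) (H' : completeNormedModType R[i])
    (e : U -> H) (e' : U -> H') (C : R) :
  compatible e e' -> dense (e @` D) -> 0 <= C ->
  (forall u, D u -> rnorm (e' u) <= C * rnorm (e u)) ->
  forall x, exists y, graph_closure e e' x y.
Proof.
move=> comp De C0 bnd x.
have /choice[u uP] : forall k : nat, exists u, D u /\ rnorm (e u - x) < k.+1%:R^-1.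
  move=> k; have k0 : 0 < k.+1%:R^-1 :> R by rewrite invr_gt0.
  by have [_ [u Du <-] ux] := dense_rnorm De x k0; exists u.
have small (r : R) : 0 < r -> exists N, forall k, (N <= k)%N -> rnorm (e (u k) - x) < r.
  move=> r0; exists (Num.bound r^-1) => k Nk; apply: (lt_le_trans (uP k).2).
  rewrite -[r]invrK lef_pV2 ?posrE ?invr_gt0//.
  have rV0 : 0 <= r^-1 by rewrite invr_ge0 ltW.
  by rewrite (le_trans (ltW (archi_boundP rV0)))// ler_nat (leq_trans Nk).
have [|y uy] := @rnorm_cauchy_cvg R H' (e' \o u).
  move=> r r0; have r0' : 0 < r / (2 * (C + 1)) by rewrite divr_gt0// mulr_gt0// ltr_wpDl.
  have [N NP] := small _ r0'; exists N => k l Nk Nl.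
  have [t Dt [t1 t2]] := comp (-1) (u l) (u k) (uP l).1 (uP k).1.
  have -> : (e' \o u) k - (e' \o u) l = e' t by rewrite t2 scaleN1r addrC.
  apply: (le_lt_trans (bnd t Dt)); rewrite t1 scaleN1r addrC.
  have H1 : rnorm (e (u k) - e (u l)) <= r / (2 * (C + 1)) + r / (2 * (C + 1)).
    apply: (le_trans (rnorm_triangle x _ _)); rewrite [X in _ + X]rnormBC.
    by apply: lerD; apply: ltW; exact: NP.
  apply: (le_lt_trans (ler_wpM2l C0 H1)).
  have -> : r / (2 * (C + 1)) + r / (2 * (C + 1)) = r / (C + 1).
    by field; rewrite gt_eqF// ltr_wpDl.
  by rewrite mulrCA -[X in _ < X]mulr1 ltr_pM2l// ltr_pdivrMr ?mul1r ?ltrDl// ltr_wpDl.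
exists y => r r0.
have [N1 N1P] := small r r0.
have /cvg_rnormP/(_ r r0)[N2 N2P] := uy.
exists (u (maxn N1 N2)); first exact: (uP _).1.
split; first by apply: N1P; rewrite leq_maxl.
by rewrite rnormBC; apply: N2P; rewrite leq_maxr.
Qed.

Lemma lipschitz_continuous (H H' : normedModType R[i]) (C : R) (T : H -> H') :
  0 <= C -> (forall x y, rnorm (T x - T y) <= C * rnorm (x - y)) -> continuous T.
Proof.
move=> C0 TC x A /nbhs_rnormP[e e0 eA]; apply/nbhs_rnormP.
exists (e / (C + 1)); first by rewrite divr_gt0// ltr_wpDl.
move=> y; rewrite ltr_pdivlMr ?ltr_wpDl// => xy; apply: eA.
apply: le_lt_trans (TC x y) _; apply: le_lt_trans xy.
by rewrite mulrC ler_wpM2l ?rnorm_ge0// lerDl.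
Qed.

(** The hypotheses are symmetric in the two maps: the bounds make the closed graph single-valued in
    both directions, and its transpose is the graph of the inverse. *)
Lemma dense_extension (H H' : completeNormedModType R[i]) (e : U -> H) (e' : U -> H')
    (C C' : R) :
  compatible e e' -> dense (e @` D) -> dense (e' @` D) -> 0 <= C -> 0 <= C' ->
  (forall u, D u -> rnorm (e' u) <= C * rnorm (e u)) ->
  (forall u, D u -> rnorm (e u) <= C' * rnorm (e' u)) ->
  exists T : {linear H -> H'},
    [/\ forall u, D u -> T (e u) = e' u, continuous T &
        exists S : H' -> H, [/\ cancel T S, cancel S T & continuous S]].
Proof.
move=> comp De De' C0 C'0 le1 le2.
have comp' : compatible e' e.
  by move=> c u v Du Dv; have [t Dt [t1 t2]] := comp c u v Du Dv; exists t.
pose G := graph_closure e e'.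
have /choice[T TP] := graph_closure_total comp De C0 le1.
have /choice[S SP'] := graph_closure_total comp' De' C'0 le2.
have SP y : G (S y) y by apply: graph_closureC; exact: SP'.
have Glin c x y x' y' : G x y -> G x' y' -> G (c *: x + x') (c *: y + y').
  exact: graph_closure_lin.
have uniqT x y y' : G x y -> G x y' -> y = y'.
  move=> G1 G2; have := Glin (-1) _ _ _ _ G1 G2.
  rewrite !scaleN1r addNr => /(graph_closure_le C0 le1); rewrite rnorm0 mulr0 => H1.
  have : - y + y' = 0 by apply: rnorm_eq0; apply/le_anti; rewrite H1 rnorm_ge0.
  by move/eqP; rewrite addrC subr_eq0 => /eqP.
have uniqS x x' y : G x y -> G x' y -> x = x'.
  move=> G1 G2; have := graph_closureC (Glin (-1) _ _ _ _ G1 G2).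
  rewrite !scaleN1r addNr => /(graph_closure_le C'0 le2); rewrite rnorm0 mulr0 => H1.
  have : - x + x' = 0 by apply: rnorm_eq0; apply/le_anti; rewrite H1 rnorm_ge0.
  by move/eqP; rewrite addrC subr_eq0 => /eqP.
have Tlin : linear T.
  by move=> c x x'; exact: (uniqT _ _ _ (TP _) (Glin c _ _ _ _ (TP x) (TP x'))).
pose T' : {linear H -> H'} := HB.pack T (GRing.isLinear.Build R[i] H H' *:%R T Tlin).
exists T'; split.
- move=> u Du; apply: (uniqT _ _ _ (TP (e u))) => r r0.
  by exists u; rewrite // !subrr !rnorm0.
- apply: (lipschitz_continuous C0) => x y; apply: (graph_closure_le C0 le1).
  by have := Glin (-1) _ _ _ _ (TP y) (TP x); rewrite !scaleN1r addrC [X in G _ X]addrC.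
exists S; split.
- by move=> x; exact: (uniqS _ _ _ (SP (T x)) (TP x)).
- by move=> y; exact: (uniqT _ _ _ (TP (S y)) (SP y)).
- apply: (lipschitz_continuous C'0) => x y; apply: (graph_closure_le C'0 le2).
  apply: graph_closureC.
  by have := Glin (-1) _ _ _ _ (SP y) (SP x); rewrite !scaleN1r addrC [X in G _ X]addrC.
Qed.

End DenseExtension.

(** * Sobolev norms and Fourier multipliers *)

Section SobolevNorms.
Context {R : realType} {p : nat} {p_prime : prime p} {n : nat}.
Local Notation Qp := (padic R p_prime).
Local Notation V := 'rV[Qp]_n.
Local Notation C := R[i].
Local Notation B := (borelV R p_prime n).
Local Notation normc := ComplexField.Normc.normc.
Implicit Types (x y a b xi : V) (phi psi f g h : V -> C).
Variable mu : {measure set B -> \bar R}.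
Hypothesis mu_haar : normalized_haar mu.
Let pz_gt0 := @pexpz_gt0 R p p_prime.
Let pz_ge0 := @pexpz_ge0 R p p_prime.
Hint Resolve pz_gt0 pz_ge0 : core.
Variables (d : nat) (w : 'I_n -> nat).

Lemma padic_abs_sub_le (u v : Qp) : `|padic_abs u - padic_abs v| <= padic_abs (u - v).
Proof.
have H (s t : Qp) : padic_abs s - padic_abs t <= padic_abs (s - t).
  by rewrite lerBlDr; have := padic_absD (s - t) t; rewrite subrK.
rewrite ler_norml H andbT lerNl opprB.
by apply: (le_trans (H v u)); rewrite -padic_absN opprB.
Qed.

Lemma coord_abs_continuous (i : 'I_n) : continuous (fun xi : V => padic_abs (xi 0 i)).
Proof.
move=> xi A /nbhs_ballP[e /= e0 eA]; apply/nbhs_normP; exists e => // y ye.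
apply: eA; rewrite -ball_normE /ball_/=; apply: (le_lt_trans (padic_abs_sub_le _ _)); rewrite -padic_absN opprB.
by apply: le_lt_trans ye; have := padic_abs_le_norm (y - xi) i; rewrite !mxE.
Qed.

Lemma measurable_Xi : measurable_fun [set: B] (Xi d w : B -> R).
Proof.
apply: measurable_sum => i.
apply: (measurableT_comp (measurable_powR (d%:R / (w i)%:R))).
exact: (continuous_measurable_borelV (@coord_abs_continuous i)).
Qed.

Definition Xi_weight_def (beta : R) xi : R := Num.max 1 (Xi d w xi) `^ (2 * beta).
Fact Xi_weight_key : unit. Proof. exact: tt. Qed.
Definition Xi_weight := locked_with Xi_weight_key Xi_weight_def.

Lemma Xi_weightE beta xi : Xi_weight beta xi = Num.max 1 (Xi d w xi) `^ (2 * beta).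
Proof. by rewrite /Xi_weight locked_withE. Qed.

Lemma Xi_weight_gt0 beta xi : 0 < Xi_weight beta xi.
Proof. by rewrite Xi_weightE powR_gt0// lt_max ltr01. Qed.

Lemma Xi_weight_ge0 beta xi : 0 <= Xi_weight beta xi.
Proof. exact: ltW (Xi_weight_gt0 _ _). Qed.

Lemma Xi_weight_ge1 beta xi : 0 <= beta -> 1 <= Xi_weight beta xi.
Proof.
move=> b0; rewrite Xi_weightE.
apply: (@le_trans _ _ (1 `^ (2 * beta))); first by rewrite powR1.
by rewrite ge0_ler_powR ?mulr_ge0// ?nnegrE ?le_max ?ler01// lexx.
Qed.

Lemma measurable_Xi_weight beta : measurable_fun [set: B] (Xi_weight beta : B -> R).
Proof.
have -> : Xi_weight beta = (fun xi => Num.max 1 (Xi d w xi) `^ (2 * beta)).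
  by apply/funext => xi; exact: Xi_weightE.
apply: (measurableT_comp (measurable_powR (2 * beta))).
by apply: measurable_maxr => //; exact: measurable_Xi.
Qed.

Lemma Xi_weight_bounded beta (N : int) : 0 <= beta ->
  exists M : R, forall xi, padic_norm xi <= p%:R ^ N -> Xi_weight beta xi <= M.
Proof.
move=> b0; pose X := \sum_(i < n) (p%:R ^ N : R) `^ (d%:R / (w i)%:R).
exists (Num.max 1 X `^ (2 * beta)) => xi xiN; rewrite Xi_weightE.
have XX : Xi d w xi <= X.
  apply: ler_sum => i _; rewrite ge0_ler_powR ?nnegrE ?divr_ge0 ?padic_abs_ge0//.
  exact: (le_trans (padic_abs_le_norm _ _)).
have mX : Num.max 1 (Xi d w xi) <= Num.max 1 X by rewrite ge_max !le_max lexx XX orbT.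
have m0 z : 0 <= Num.max 1 z :> R by rewrite le_max ler01.
by apply: (ge0_ler_powR _ _ _ mX); rewrite ?mulr_ge0 ?nnegrE.
Qed.

Lemma integrable_dominated (h : V -> R) (N : int) (M : R) :
  measurable_fun [set: B] (h : B -> R) ->
  (forall xi, h xi != 0 -> padic_norm xi <= p%:R ^ N) ->
  (forall xi, padic_norm xi <= p%:R ^ N -> `|h xi| <= M) ->
  mu.-integrable [set: B] (fun xi : B => (h xi)%:E).
Proof.
move=> mh sh hM; pose I : B -> R := \1_(zball 0 N : set B).
have iI : mu.-integrable [set: B] (fun xi : B => (M%:E * (I xi)%:E)%E).
  by apply: integrableZl => //; exact: integrable_zball.
apply: (le_integrable _ _ _ iI) => //; first exact/measurable_EFinP.
move=> xi _; rewrite -EFinM !abse_EFin lee_fin /I indicE.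
have [h0|h0] := eqVneq (h xi) 0; first by rewrite h0 normr0.
have xN := sh xi h0; rewrite mem_set; last by rewrite zball0E.
by rewrite mulr1; apply: (le_trans (hM xi xN)); exact: ler_norm.
Qed.

Lemma measurable_normc2 g : schwartz_bruhat g ->
  measurable_fun [set: B] (fun xi : B => normc (g xi) ^+ 2).
Proof.
move=> /(schwartz_bruhat_Cintegrable mu_haar)[/measurable_int/measurable_EFinP mR].
move=> /measurable_int/measurable_EFinP mI.
under eq_fun do rewrite normc_sqr.
by apply: measurable_funD; apply: (measurableT_comp (exprn_measurable 2)).
Qed.

Lemma integrable_weighted beta g : 0 <= beta -> schwartz_bruhat g ->
  mu.-integrable [set: B] (fun xi : B => (Xi_weight beta xi * normc (g xi) ^+ 2)%:E).
Proof.
move=> b0 sg; have [G GP] := schwartz_bruhat_bounded sg.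
have [N [K [sN _]]] := (schwartz_bruhatP g).1 sg.
have [M MP] := Xi_weight_bounded N b0.
apply: (@integrable_dominated _ N (M * G ^+ 2)).
- apply: measurable_funM; first exact: measurable_Xi_weight.
  exact: measurable_normc2.
- move=> xi h0; apply: sN; apply: contraNneq h0 => ->.
  by rewrite ComplexField.Normc.normc0 expr0n mulr0.
- move=> xi xiN; rewrite ger0_norm; last by apply: mulr_ge0; [exact: Xi_weight_ge0|exact: sqr_ge0].
  apply: (ler_pM (Xi_weight_ge0 _ _) (sqr_ge0 _) (MP xi xiN)).
  apply: lerXn2r; rewrite ?nnegrE; [exact: normc_ge0| |exact: GP].
  exact: (le_trans (normc_ge0 (g xi)) (GP xi)).
Qed.

Definition weighted_norm2 beta g : R :=
  rintegral mu (fun xi => Xi_weight beta xi * normc (g xi) ^+ 2).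

Lemma weighted_norm2_ge0 beta g : 0 <= weighted_norm2 beta g.
Proof.
by apply: Rintegral_ge0 => xi _; apply: mulr_ge0; [exact: Xi_weight_ge0|exact: sqr_ge0].
Qed.

Lemma sobolev_normE beta phi :
  sobolev_norm mu d w beta phi = Num.sqrt (weighted_norm2 beta (ft mu (-1) phi)).
Proof.
rewrite /sobolev_norm /weighted_norm2 /rintegral fourierE; congr Num.sqrt.
by congr Rintegral; apply/funext => xi; rewrite Xi_weightE.
Qed.

Lemma le_weighted_norm2 beta beta' (K : R) g h : 0 <= beta -> 0 <= beta' ->
  schwartz_bruhat g -> schwartz_bruhat h ->
  (forall xi, Xi_weight beta' xi * normc (h xi) ^+ 2 <=
     K * (Xi_weight beta xi * normc (g xi) ^+ 2)) ->
  weighted_norm2 beta' h <= K * weighted_norm2 beta g.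
Proof.
move=> b0 b0' sg sh gh.
have ig := integrable_weighted b0 sg.
have ih := integrable_weighted b0' sh.
rewrite /weighted_norm2 /rintegral -RintegralZl//.
have iK : mu.-integrable [set: B]
    (fun xi : B => (K * (Xi_weight beta xi * normc (g xi) ^+ 2))%:E).
  exact: (integrableZl measurableT K ig).
by apply: le_Rintegral.
Qed.

End SobolevNorms.

(** * The Fourier multiplier on test functions *)

Section MultiplierOperator.
Context {R : realType} {p : nat} {p_prime : prime p} {n : nat}.
Local Notation Qp := (padic R p_prime).
Local Notation V := 'rV[Qp]_n.
Local Notation C := R[i].
Local Notation B := (borelV R p_prime n).
Local Notation normc := ComplexField.Normc.normc.
Implicit Types (x y a b xi : V) (phi psi g h : V -> C).
Variable mu : {measure set B -> \bar R}.
Hypothesis mu_haar : normalized_haar mu.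
Let pz_gt0 := @pexpz_gt0 R p p_prime.
Let pz_ge0 := @pexpz_ge0 R p p_prime.
Hint Resolve pz_gt0 pz_ge0 : core.
Variables (f : mpoly n Qp) (d : nat) (w : 'I_n -> nat).
Hypothesis fw : quasielliptic f d w.
Variable M0 : nat.

Let abs1 : padic_abs (1 : Qp) = 1 := padic_abs1.
Let absN1 : padic_abs (-1 : Qp) = 1.
Proof. by rewrite padic_absN padic_abs1. Qed.

Lemma Phi_spaceP phi : Phi_space mu M0 phi <-> schwartz_bruhat phi /\
  forall xi, padic_norm xi <= p%:R ^+ M0 -> ft mu (-1) phi xi = 0.
Proof. by rewrite /Phi_space /= fourierE. Qed.

Lemma Phi_space_ft g : schwartz_bruhat g ->
  (forall xi, padic_norm xi <= p%:R ^+ M0 -> g xi = 0) -> Phi_space mu M0 (ft mu 1 g).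
Proof.
move=> sg g0; apply/Phi_spaceP; split; first exact: schwartz_bruhat_ft.
by rewrite ft_inversion.
Qed.

Lemma Phi_spaceD c phi psi : Phi_space mu M0 phi -> Phi_space mu M0 psi ->
  Phi_space mu M0 (fun x => c * phi x + psi x).
Proof.
move=> /Phi_spaceP[s1 v1] /Phi_spaceP[s2 v2]; apply/Phi_spaceP; split.
  exact: schwartz_bruhatD.
move=> xi xiM; rewrite ftD ?absN1//.
by rewrite v1// v2// mulr0 addr0.
Qed.

Definition multiplier_def (alpha : R) g xi : C :=
  real_complex R (padic_abs (poly_eval f xi) `^ alpha) * g xi.
Fact multiplier_key : unit. Proof. exact: tt. Qed.
Definition multiplier := locked_with multiplier_key multiplier_def.

Lemma multiplierE alpha g xi : multiplier alpha g xi =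
  real_complex R (padic_abs (poly_eval f xi) `^ alpha) * g xi.
Proof. by rewrite /multiplier locked_withE. Qed.

(** Off the origin |f|^alpha is locally constant for every real alpha, negative ones included; near
    the origin g vanishes and so does the product. *)
Lemma schwartz_bruhat_multiplier alpha g : schwartz_bruhat g ->
  (forall xi, padic_norm xi <= p%:R ^+ M0 -> g xi = 0) ->
  schwartz_bruhat (multiplier alpha g).
Proof.
move=> [lg cg] g0; split=> [x|]; last first.
  apply: (subclosed_compact _ cg); first exact: closed_closure.
  by apply: closure_subset => x /=; rewrite multiplierE mulf_eq0 negb_or => /andP[].
have [x0|x0] := eqVneq x 0.
  apply/nbhs_zballP; exists 0%N => y; rewrite oppr0 x0 zball0E expr0z => y1.
  have M1 : 1 <= p%:R ^+ M0 :> R by rewrite exprn_ege1// ltW// prime_gt1R.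
  have E z : padic_norm z <= p%:R ^+ M0 -> multiplier alpha g z = 0.
    by move=> zM; rewrite multiplierE (g0 z zM) mulr0.
  have n0 : padic_norm (0 : V) <= p%:R ^+ M0 by rewrite padic_norm0 (le_trans ler01 M1).
  exact (etrans (E y (le_trans y1 M1)) (esym (E 0 n0))).
have [k kP] := poly_eval_loc_const fw x0.
have /nbhs_zballP[k' k'P] := lg x.
apply/nbhs_zballP; exists (maxn k k') => y xy.
have kk : - (maxn k k')%:Z <= - k%:Z by rewrite lerN2 lez_nat leq_maxl.
have kk' : - (maxn k k')%:Z <= - k'%:Z by rewrite lerN2 lez_nat leq_maxr.
rewrite /=; apply: (etrans (multiplierE _ _ _)); rewrite (kP _ (zball_sub kk xy)).
by rewrite (k'P _ (zball_sub kk' xy)) multiplierE.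
Qed.

Lemma normc_multiplier alpha g xi : normc (multiplier alpha g xi) ^+ 2 =
  padic_abs (poly_eval f xi) `^ (2 * alpha) * normc (g xi) ^+ 2.
Proof.
rewrite multiplierE ComplexField.Normc.normcM exprMn; congr (_ * _).
rewrite normc_sqr/= expr0n/= addr0 mulrC powRrM powR_mulrn//.
exact: powR_ge0.
Qed.

Variables A0 A1 : R.
Hypotheses (A0_gt0 : 0 < A0) (A1_gt0 : 0 < A1).
Hypothesis f_bounds : forall xi, p%:R ^+ M0 <= padic_norm xi ->
  A0 * Xi d w xi <= padic_abs (poly_eval f xi) <= A1 * Xi d w xi.

(** Where g is nonzero the norm of xi exceeds p^M0 >= 1, hence Xi >= 1 and the Sobolev weight is a
    pure power of Xi; [f_bounds] raised to the power 2 alpha trades |f| for Xi. *)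
Lemma multiplier_weight_bounds alpha beta g xi : 0 <= alpha ->
  (padic_norm xi <= p%:R ^+ M0 -> g xi = 0) ->
  A0 `^ (2 * alpha) * (Xi_weight d w beta xi * normc (g xi) ^+ 2) <=
    Xi_weight d w (beta - alpha) xi * normc (multiplier alpha g xi) ^+ 2 <=
  A1 `^ (2 * alpha) * (Xi_weight d w beta xi * normc (g xi) ^+ 2).
Proof.
move=> a0 g0; rewrite normc_multiplier.
have [gx|gx] := eqVneq (g xi) 0.
  by rewrite gx ComplexField.Normc.normc0 expr0n/= !mulr0 lexx.
have xiM : p%:R ^+ M0 <= padic_norm xi.
  by rewrite leNgt; apply: contra gx => /ltW/g0 ->.
have xi1 : 1 <= padic_norm xi.
  by apply: le_trans xiM; rewrite exprn_ege1// ltW// prime_gt1R.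
have X1 := Xi_ge1 fw xi1; have /andP[b1 b2] := f_bounds xiM.
rewrite !Xi_weightE (max_idPr X1).
set X := Xi d w xi in X1 b1 b2 *; set a := padic_abs _ in b1 b2 *.
set G := normc _ ^+ 2.
have G0 : 0 <= G by exact: sqr_ge0.
have Xgt0 : 0 < X by exact: lt_le_trans X1.
have -> : X `^ (2 * beta) = X `^ (2 * (beta - alpha)) * X `^ (2 * alpha).
  rewrite -powRD; last by apply/implyP => _; rewrite gt_eqF.
  by congr (_ `^ _); ring.
set Y := X `^ (2 * (beta - alpha)); have Y0 : 0 <= Y by exact: powR_ge0.
have a2 : 0 <= 2 * alpha by rewrite mulr_ge0.
have H1 : A0 `^ (2 * alpha) * X `^ (2 * alpha) <= a `^ (2 * alpha).
  rewrite -(powRM _ (ltW A0_gt0) (ltW Xgt0)).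
  by apply: (ge0_ler_powR a2 _ _ b1); rewrite nnegrE ?padic_abs_ge0// mulr_ge0// ltW.
have H2 : a `^ (2 * alpha) <= A1 `^ (2 * alpha) * X `^ (2 * alpha).
  rewrite -(powRM _ (ltW A1_gt0) (ltW Xgt0)).
  by apply: (ge0_ler_powR a2 _ _ b2); rewrite nnegrE ?padic_abs_ge0// mulr_ge0// ltW.
move: (a `^ _) (A0 `^ _) (A1 `^ _) (X `^ _) H1 H2 => u s t z H1 H2.
have YG : 0 <= Y * G by exact: mulr_ge0.
have -> : s * (Y * z * G) = Y * G * (s * z) by ring.
have -> : t * (Y * z * G) = Y * G * (t * z) by ring.
have -> : Y * (u * G) = Y * G * u by ring.
by rewrite !ler_wpM2l.
Qed.

Definition multiplier_op alpha phi : V -> C := ft mu 1 (multiplier alpha (ft mu (-1) phi)).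

Lemma Phi_space_multiplier_op alpha phi : Phi_space mu M0 phi ->
  Phi_space mu M0 (multiplier_op alpha phi).
Proof.
move=> /Phi_spaceP[sphi v]; apply: Phi_space_ft.
  by apply: schwartz_bruhat_multiplier => //; exact: schwartz_bruhat_ft.
by move=> xi xiM; rewrite multiplierE v// mulr0.
Qed.

Lemma ft_multiplier_op alpha phi : Phi_space mu M0 phi ->
  ft mu (-1) (multiplier_op alpha phi) = multiplier alpha (ft mu (-1) phi).
Proof.
move=> /Phi_spaceP[sphi v]; rewrite /multiplier_op ft_inversion//.
by apply: schwartz_bruhat_multiplier => //; exact: schwartz_bruhat_ft.
Qed.

Lemma multiplier_opD alpha c phi psi : Phi_space mu M0 phi -> Phi_space mu M0 psi ->
  multiplier_op alpha (fun x => c * phi x + psi x) =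
  (fun x => c * multiplier_op alpha phi x + multiplier_op alpha psi x).
Proof.
move=> /Phi_spaceP[s1 v1] /Phi_spaceP[s2 v2]; rewrite /multiplier_op ftD ?absN1//.
have h1 := schwartz_bruhat_ft mu_haar absN1 s1.
have h2 := schwartz_bruhat_ft mu_haar absN1 s2.
have m1 := schwartz_bruhat_multiplier alpha h1 v1.
have m2 := schwartz_bruhat_multiplier alpha h2 v2.
rewrite -(ftD mu_haar c _ m1 m2) ?abs1//; congr ft; apply/funext => xi.
rewrite !multiplierE.
by move: (ft _ _ phi xi) (ft _ _ psi xi) (real_complex _ _) => u v z; ring.
Qed.

(** The preimage comes from the exponent - alpha; the powers cancel since f does not vanish off the
    origin. Surjectivity is what makes the image dense in the target completion. *)
Lemma multiplier_op_surj alpha psi : Phi_space mu M0 psi ->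
  exists2 phi, Phi_space mu M0 phi & multiplier_op alpha phi = psi.
Proof.
move=> /Phi_spaceP[spsi v].
have h := schwartz_bruhat_ft mu_haar absN1 spsi.
have m := schwartz_bruhat_multiplier (- alpha) h v.
exists (ft mu 1 (multiplier (- alpha) (ft mu (-1) psi))).
  by apply: Phi_space_ft => // xi xiM; rewrite multiplierE v// mulr0.
rewrite /multiplier_op ft_inversion//.
have -> : multiplier alpha (multiplier (- alpha) (ft mu (-1) psi)) = ft mu (-1) psi.
  apply/funext => xi; rewrite !multiplierE.
  have [xiM|xiM] := leP (padic_norm xi) (p%:R ^+ M0); first by rewrite v// !mulr0.
  rewrite mulrA -rmorphM/= -powRD ?subrr; last first.
    rewrite eqxx/= gt_eqF// padic_abs_gt0; apply/eqP => /(quasielliptic_eq0 fw) x0.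
    by move: xiM; rewrite x0 padic_norm0 ltNge exprn_ge0// ltW// prime_gt0R.
  by rewrite powRr0 rmorph1 mul1r.
by have := ft_inversion mu_haar absN1 spsi; rewrite opprK.
Qed.

Lemma sobolev_norm_multiplier_op alpha beta phi : 0 <= alpha -> alpha <= beta ->
  Phi_space mu M0 phi ->
  sobolev_norm mu d w (beta - alpha) (multiplier_op alpha phi) <=
    Num.sqrt (A1 `^ (2 * alpha)) * sobolev_norm mu d w beta phi /\
  sobolev_norm mu d w beta phi <=
    Num.sqrt ((A0 `^ (2 * alpha))^-1) *
    sobolev_norm mu d w (beta - alpha) (multiplier_op alpha phi).
Proof.
move=> a0 ab Pphi; have /Phi_spaceP[sphi v] := Pphi.
have h := schwartz_bruhat_ft mu_haar absN1 sphi.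
have m := schwartz_bruhat_multiplier alpha h v.
have b0 : 0 <= beta by exact: le_trans ab.
have ba : 0 <= beta - alpha by rewrite subr_ge0.
have A00 : 0 < A0 `^ (2 * alpha) by exact: powR_gt0.
have H xi := multiplier_weight_bounds beta a0 (v xi).
rewrite !sobolev_normE ft_multiplier_op// -!sqrtrM ?powR_ge0 ?invr_ge0 ?powR_ge0//; split.
  apply: ler_wsqrtr; apply: le_weighted_norm2 => // xi.
  by have /andP[] := H xi.
apply: ler_wsqrtr; apply: le_weighted_norm2 => // xi.
by rewrite ler_pdivlMl//; have /andP[] := H xi.
Qed.

(** Where the symbol could still depend on x, the transform of phi is zero. *)
Lemma pseudo_diffE (F : V -> V -> Qp) alpha phi :
  (forall xi, p%:R ^+ M0 <= padic_norm xi -> forall x,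
     padic_abs (F xi x) = padic_abs (poly_eval f xi)) ->
  Phi_space mu M0 phi -> pseudo_diff mu F alpha phi = multiplier_op alpha phi.
Proof.
move=> FE /Phi_spaceP[sphi v]; apply/funext => x.
rewrite /pseudo_diff /multiplier_op ftE; apply: eq_Cintegral => xi.
have E : 1 * dot xi x = dot x xi := etrans (mul1r _) (dotC xi x).
rewrite E fourierE multiplierE.
have [xiM|xiM] := leP (padic_norm xi) (p%:R ^+ M0); last first.
  by rewrite (FE xi (ltW xiM) x) -mulrA.
have c0 (s t u z : C) : z = 0 -> s * t * z = s * (u * z) by move=> ->; rewrite !mulr0.
exact (c0 _ _ _ _ (v xi xiM)).
Qed.

End MultiplierOperator.

(** * Uniform continuity *)

Section SupBound.
Context {R : realType} {p : nat} {p_prime : prime p} {n : nat}.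
Local Notation Qp := (padic R p_prime).
Local Notation V := 'rV[Qp]_n.
Local Notation C := R[i].
Local Notation B := (borelV R p_prime n).
Local Notation normc := ComplexField.Normc.normc.
Implicit Types (x y a b xi : V) (phi psi g h : V -> C).
Variable mu : {measure set B -> \bar R}.
Hypothesis mu_haar : normalized_haar mu.
Let pz_gt0 := @pexpz_gt0 R p p_prime.
Let pz_ge0 := @pexpz_ge0 R p p_prime.
Hint Resolve pz_gt0 pz_ge0 : core.
Variables (f : mpoly n Qp) (d : nat) (w : 'I_n -> nat).
Hypothesis fw : quasielliptic f d w.
Variable beta : R.
Hypothesis beta_gt : (n * \max_(i < n) w i)%N%:R / (2 * d%:R) < beta.

(* Cut off at radius p^L to be trivially integrable; the integrals turn out to
   be bounded uniformly in L. *)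
Definition cutoff_weight_def (L : nat) xi : R :=
  Xi_weight d w (- beta) xi * \1_(zball 0 L%:Z) xi.
Fact cutoff_weight_key : unit. Proof. exact: tt. Qed.
Definition cutoff_weight := locked_with cutoff_weight_key cutoff_weight_def.

Lemma cutoff_weightE L xi : cutoff_weight L xi =
  if `[< padic_norm xi <= p%:R ^ L%:Z >] then Xi_weight d w (- beta) xi else 0.
Proof.
rewrite /cutoff_weight locked_withE /cutoff_weight_def indicE.
have -> : (xi \in zball 0 L%:Z) = `[< padic_norm xi <= p%:R ^ L%:Z >].
  by apply/idP/asboolP; rewrite inE zball0E.
by case: ifP; rewrite ?mulr1 ?mulr0.
Qed.

Let beta0 : 0 <= beta.
Proof. by apply: le_trans (ltW beta_gt); rewrite divr_ge0. Qed.

Lemma Xi_weightN xi : Xi_weight d w (- beta) xi = (Xi_weight d w beta xi)^-1.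
Proof. by rewrite !Xi_weightE mulrN powRN. Qed.

Lemma Xi_weightN_le1 xi : Xi_weight d w (- beta) xi <= 1.
Proof. by rewrite Xi_weightN invf_le1 ?Xi_weight_gt0 ?Xi_weight_ge1. Qed.

Lemma cutoff_weight_ge0 L xi : 0 <= cutoff_weight L xi.
Proof. by rewrite cutoff_weightE; case: ifP => // _; exact: Xi_weight_ge0. Qed.

Lemma cutoff_weight_le1 L xi : cutoff_weight L xi <= 1.
Proof. by rewrite cutoff_weightE; case: ifP => // _; exact: Xi_weightN_le1. Qed.

Lemma integrable_cutoff_weight L :
  mu.-integrable [set: B] (fun xi : B => (cutoff_weight L xi)%:E).
Proof.
apply: (@integrable_dominated _ _ _ _ mu mu_haar _ L%:Z 1).
- have -> : cutoff_weight L = fun xi : V => Xi_weight d w (- beta) xi * \1_(zball 0 L%:Z) xi.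
    by rewrite /cutoff_weight locked_withE.
  apply: measurable_funM; first exact: measurable_Xi_weight.
  by apply: measurable_indic; exact: zball_measurable.
- by move=> xi; rewrite cutoff_weightE; case: asboolP => //; rewrite eqxx.
- by move=> xi _; rewrite ger0_norm ?cutoff_weight_ge0// cutoff_weight_le1.
Qed.

(* Bound for the ratio of the integrals of max(1, Xi)^(-2 beta) over consecutive
   shells; q < 1 is exactly the hypothesis on beta. *)
Let q : R := p%:R `^ (n%:R - 2 * beta * (d%:R / (\max_(i < n) w i)%N%:R)).

Let q_ge0 : 0 <= q. Proof. exact: powR_ge0. Qed.

Let wm_gt0 : (0 < \max_(i < n) w i)%N.
Proof.
have i : 'I_n by exact: (Ordinal (quasielliptic_dim_gt0 fw)).
apply: (@leq_trans (w i)); first exact: (quasielliptic_weight_gt0 fw).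
exact: (leq_bigmax_cond (F := w)).
Qed.

Let q_lt1 : q < 1.
Proof.
have d0 : 0 < d%:R :> R by rewrite ltr0n (quasielliptic_deg_gt0 fw).
have m0 : 0 < (\max_(i < n) w i)%N%:R :> R by rewrite ltr0n.
have e0 : n%:R - 2 * beta * (d%:R / (\max_(i < n) w i)%N%:R) < 0.
  rewrite subr_lt0; move: beta_gt; rewrite ltr_pdivrMr ?mulr_gt0// natrM.
  have -> : 2 * beta * (d%:R / (\max_(i < n) w i)%N%:R) =
      beta * (2 * d%:R) / (\max_(i < n) w i)%N%:R by ring.
  by rewrite ltr_pdivlMr.
have p0 : 0 < p%:R :> R := prime_gt0R (p_prime := p_prime).
have p1 : 1 < p%:R :> R := prime_gt1R (p_prime := p_prime).
suff : q < p%:R `^ 0 by rewrite powRr0.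
by rewrite /q /powR gt_eqF//= ltr_expR mul0r nmulr_rlt0// ln_gt0.
Qed.

(** By [Xi_norm_ge] the inverse weight is at most p to the power -2 beta L d / max w_i, and the ball
    has volume p^(L n); the exponents add up to L times that of q. *)
Lemma shell_weight (L : nat) xi : p%:R ^ L%:Z <= padic_norm xi ->
  Xi_weight d w (- beta) xi * (p%:R ^ L%:Z) ^+ n <= q ^+ L.
Proof.
move=> xiL; have p0 : 0 < p%:R :> R := prime_gt0R (p_prime := p_prime).
have pL : 1 <= p%:R ^ L%:Z :> R by rewrite -exprnP exprn_ege1// ltW// prime_gt1R.
have X1 := Xi_ge1 fw (le_trans pL xiL).
have := Xi_norm_ge fw xiL; set e := d%:R / _ => XL.
have XW : ((p%:R ^ L%:Z) `^ e) `^ (2 * beta) <= Xi_weight d w beta xi.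
  rewrite Xi_weightE (max_idPr X1).
  apply: (ge0_ler_powR _ _ _ XL); rewrite ?nnegrE ?mulr_ge0 ?powR_ge0//.
  exact: le_trans X1.
rewrite Xi_weightN ler_pdivrMl ?Xi_weight_gt0//.
apply: (@le_trans _ _ (((p%:R ^ L%:Z) `^ e) `^ (2 * beta) * q ^+ L)); last first.
  by rewrite ler_wpM2r// exprn_ge0.
have -> : p%:R ^ L%:Z = p%:R `^ L%:R :> R by rewrite -exprnP powR_mulrn// ltW.
have -> : (p%:R `^ L%:R) ^+ n = p%:R `^ (L%:R * n%:R) :> R.
  by rewrite powRrM [RHS]powR_mulrn// powR_ge0.
have -> : q ^+ L = p%:R `^ ((n%:R - 2 * beta * e) * L%:R).
  by rewrite powRrM [RHS]powR_mulrn// powR_ge0.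
rewrite -!powRrM -powRD; last by apply/implyP => _; rewrite gt_eqF.
by rewrite le_eqVlt; apply/orP; left; apply/eqP; congr (_ `^ _); ring.
Qed.

Lemma cutoff_weight_step (L : nat) :
  rintegral mu (cutoff_weight L.+1) <= rintegral mu (cutoff_weight L) + q ^+ L.+1.
Proof.
(* The height at which the indicator of the ball has integral q^(L+1). On the shell of radius
   p^(L+1), where alone the two cutoffs differ, it dominates the inverse weight. *)
pose K := q ^+ L.+1 / (p%:R ^ L.+1%:Z) ^+ n.
have K0 : 0 <= K by rewrite divr_ge0 ?exprn_ge0.
have vol0 : 0 < (p%:R ^ L.+1%:Z) ^+ n :> R by rewrite exprn_gt0.
pose I : B -> R := \1_(zball 0 L.+1%:Z : set B).
have iI : mu.-integrable [set: B] (fun xi : B => (K * I xi)%:E).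
  exact: (integrableZl measurableT K (integrable_zball mu_haar 0 L.+1%:Z)).
have vI : Rintegral mu setT (fun xi : B => K * I xi) = q ^+ L.+1.
  rewrite RintegralZl//; last exact: integrable_zball.
  rewrite /Rintegral /I integral_indic ?setIT ?(haar_zball mu_haar)//=; last exact: zball_measurable.
  by rewrite /K divfK// gt_eqF.
rewrite -vI /rintegral -RintegralD//; last exact: integrable_cutoff_weight.
have iS : mu.-integrable [set: B] (fun xi : B => (cutoff_weight L xi + K * I xi)%:E).
  exact: (integrableD measurableT (integrable_cutoff_weight L) iI).
apply: le_Rintegral => //; first exact: integrable_cutoff_weight.
move=> xi _; rewrite !cutoff_weightE /I indicE.
have I0 : 0 <= K * (xi \in zball 0 L.+1%:Z)%:R by rewrite mulr_ge0.
have [xL|xL] := asboolP (padic_norm xi <= p%:R ^ L%:Z).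
  rewrite asboolT ?lerDl//.
  by apply: (le_trans xL); rewrite le_pexpz// lez_nat.
have [xL1|xL1] := asboolP (padic_norm xi <= p%:R ^ L.+1%:Z); last by rewrite add0r.
rewrite mem_set ?zball0E// mulr1 add0r /K ler_pdivlMr//; apply: shell_weight.
rewrite leNgt; apply/negP => H; apply: xL.
have E : L.+1%:Z - 1 = L%:Z by rewrite -addn1 PoszD addrK.
by rewrite padic_norm_lt_pred E in H.
Qed.

Lemma cutoff_weight_bounded : exists2 A : R, 0 <= A & forall L, rintegral mu (cutoff_weight L) <= A.
Proof.
have q1 : 0 < 1 - q by rewrite subr_gt0.
exists ((1 - q)^-1); first by rewrite invr_ge0 ltW.
(* The right-hand side is the partial sum 1 + q + ... + q^L, which is what the induction needs. *)
suff H L : rintegral mu (cutoff_weight L) <= (1 - q ^+ L.+1) / (1 - q).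
  move=> L; apply: (le_trans (H L)); rewrite ler_pdivrMr// mulVf ?gt_eqF//.
  by rewrite gerDl oppr_le0 exprn_ge0.
elim: L => [|L IH].
  rewrite expr1 divff ?gt_eqF//.
  have iI := integrable_zball mu_haar 0 0%:Z.
  have <- : Rintegral mu setT (fun xi : B => (\1_(zball 0 0%:Z : set B) : B -> R) xi) = 1.
    rewrite /Rintegral integral_indic ?setIT ?(haar_zball mu_haar)//=; last exact: zball_measurable.
    by rewrite expr0z expr1n.
  apply: le_Rintegral => //; first exact: integrable_cutoff_weight.
  move=> xi _; rewrite indicE; have [x0|x0] := asboolP (padic_norm xi <= p%:R ^ 0%:Z).
    by rewrite mem_set ?zball0E// cutoff_weight_le1.
  by rewrite cutoff_weightE asboolF.
apply: (le_trans (cutoff_weight_step L)); apply: (le_trans (lerD IH (lexx _))).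
rewrite [q ^+ L.+2]exprS le_eqVlt; apply/orP; left; apply/eqP; field.
by rewrite gt_eqF.
Qed.

(** The inverse transform is controlled by the integral of |g|. The parameter t splits |g| into the
    integrable inverse weight and the square that the Sobolev norm controls: this is Cauchy-Schwarz
    before optimizing in t. *)
Lemma ft_sup_bound : exists2 A : R, 0 <= A & forall g, schwartz_bruhat g ->
  forall (t : R) x, 0 < t ->
  normc (ft mu 1 g x) <= t * A + t^-1 * weighted_norm2 mu d w beta g.
Proof.
have [A A0 AP] := cutoff_weight_bounded; exists A => // g sg t x t0.
have [N [K [sN _]]] := (schwartz_bruhatP g).1 sg.
have [L NL] : exists L : nat, N <= L%:Z by exists `|N|%N; lia.
have s1 : padic_abs (1 : Qp) <= 1 by rewrite padic_abs1.
have sh := schwartz_bruhat_char x s1 sg.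
rewrite ftE; set h := fun xi => _ in sh *.
have hg xi : normc (h xi) = normc (g xi).
  by rewrite /h ComplexField.Normc.normcM padic_char_normc mul1r.
(* The halves pay for the factor two lost by estimating the real and the imaginary part
   separately. *)
pose F xi := t / 2 * cutoff_weight L xi + t^-1 / 2 * (Xi_weight d w beta xi * normc (g xi) ^+ 2).
have iW := integrable_weighted mu_haar d w beta0 sg.
have i1 : mu.-integrable [set: B] (fun xi : B => (t / 2 * cutoff_weight L xi)%:E).
  exact: (integrableZl measurableT (t / 2) (integrable_cutoff_weight L)).
have i2 : mu.-integrable [set: B]
    (fun xi : B => (t^-1 / 2 * (Xi_weight d w beta xi * normc (g xi) ^+ 2))%:E).
  exact: (integrableZl measurableT (t^-1 / 2) iW).
have iF : mu.-integrable [set: B] (fun xi : B => (F xi)%:E).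
  exact: (integrableD measurableT i1 i2).
have intF : Rintegral mu setT (fun xi : B => F xi) =
    t / 2 * rintegral mu (cutoff_weight L) + t^-1 / 2 * weighted_norm2 mu d w beta g.
  rewrite /F RintegralD// !RintegralZl//; exact: integrable_cutoff_weight.
have gF xi : normc (g xi) <= F xi.
  have [g0|g0] := eqVneq (g xi) 0.
    rewrite g0 ComplexField.Normc.normc0 /F addr_ge0//.
      by rewrite mulr_ge0 ?cutoff_weight_ge0// divr_ge0// ltW.
    apply: mulr_ge0; first by rewrite divr_ge0// invr_ge0 ltW.
    by apply: mulr_ge0; [exact: Xi_weight_ge0|exact: sqr_ge0].
  have xL : padic_norm xi <= p%:R ^ L%:Z := zsuppW NL sN g0.
  rewrite /F cutoff_weightE asboolT// Xi_weightN.
  have W0 := Xi_weight_gt0 d w beta xi.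
  move: (Xi_weight d w beta xi) (normc (g xi)) W0 => W u W0.
  rewrite -subr_ge0.
  (* AM-GM: [u <= (t / W + W u ^ 2 / t) / 2]. *)
  have -> : t / 2 * W^-1 + t^-1 / 2 * (W * u ^+ 2) - u = (t / W - u) ^+ 2 * (W / (2 * t)).
    by field; rewrite !gt_eqF.
  by rewrite mulr_ge0 ?sqr_ge0// divr_ge0 ?mulr_ge0// ltW.
have [iR iI] := schwartz_bruhat_Cintegrable mu_haar sh.
have bnd (k : V -> R) : mu.-integrable [set: B] (fun xi : B => (k xi)%:E) ->
    (forall xi, `|k xi| <= normc (h xi)) ->
    `|Rintegral mu setT (fun xi : B => k xi)| <= Rintegral mu setT (fun xi : B => F xi).
  move=> ik kh; apply: (le_trans (le_normr_Rintegral measurableT ik)).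
  apply: le_Rintegral => //; first exact: (integrable_norm ik).
  by move=> xi _; apply: (le_trans (kh xi)); rewrite hg.
apply: (le_trans (normc_le_ReIm _)).
apply: (le_trans (lerD (bnd _ iR (fun xi => Re_le_normc (h xi))) (bnd _ iI (fun xi => Im_le_normc (h xi))))).
rewrite intF; set I := rintegral _ _; set W := weighted_norm2 _ _ _ _ _.
have -> : t / 2 * I + t^-1 / 2 * W + (t / 2 * I + t^-1 / 2 * W) = t * I + t^-1 * W.
  by field; rewrite gt_eqF.
by rewrite lerD2r ler_pM2l// AP.
Qed.

Lemma sobolev_norm_ge0 phi : 0 <= sobolev_norm mu d w beta phi.
Proof. exact: sqrtr_ge0. Qed.

Lemma sobolev_sup (e : R) : 0 < e -> exists2 r : R, 0 < r & forall phi,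
  schwartz_bruhat phi -> sobolev_norm mu d w beta phi < r -> forall x, normc (phi x) < e.
Proof.
move=> e0; have [A A0 AP] := ft_sup_bound.
(* This t makes the first term of [ft_sup_bound] at most e / 2; the radius, the square root of e t /
   2, makes the squared norm divided by t less than e / 2. A may be zero, hence A + 1. *)
pose t := e / (2 * (A + 1)).
have A1 : 0 < A + 1 by rewrite ltr_wpDl.
have t0 : 0 < t by rewrite divr_gt0// mulr_gt0.
exists (Num.sqrt (e * t / 2)); first by rewrite sqrtr_gt0 divr_gt0// mulr_gt0.
move=> phi sphi; rewrite sobolev_normE.
have N1 : padic_abs (-1 : Qp) = 1 by rewrite padic_absN padic_abs1.
have h := schwartz_bruhat_ft mu_haar N1 sphi.
rewrite ltr_sqrt; last by rewrite divr_gt0// mulr_gt0.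
set W := weighted_norm2 _ _ _ _ _ => WP x.
have <- : ft mu 1 (ft mu (-1) phi) = phi.
  by have := ft_inversion mu_haar N1 sphi; rewrite opprK.
apply: (le_lt_trans (AP _ h t x t0)); rewrite -/W.
have H1 : t * A <= e / 2.
  rewrite /t -mulrA ler_pM2l// ler_pdivrMl ?mulr_gt0//.
  lra.
have H2 : t^-1 * W < e / 2 by rewrite ltr_pdivrMl// mulrA (mulrC t).
have -> : e = e / 2 + e / 2 by lra.
exact: ler_ltD.
Qed.

(** Plancherel, and a Sobolev weight that is at least 1 because beta >= 0. *)
Lemma L2_le_sobolev_norm phi : schwartz_bruhat phi ->
  (\int[mu]_x ((normc (phi x) ^+ 2)%:E) <= ((sobolev_norm mu d w beta phi) ^+ 2)%:E)%E.
Proof.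
move=> sphi; have N1 : padic_abs (-1 : Qp) = 1 by rewrite padic_absN padic_abs1.
have h := schwartz_bruhat_ft mu_haar N1 sphi.
have W0 xi : Xi_weight d w 0 xi = 1 by rewrite Xi_weightE mulr0 powRr0.
have := integrable_weighted mu_haar d w (lexx 0) sphi.
under eq_fun do rewrite W0 mul1r.
move=> iphi; rewrite -[X in (X <= _)%E]fineK; last exact: integrable_fin_num.
rewrite lee_fin sobolev_normE sqr_sqrtr; last exact: weighted_norm2_ge0.
have := ft_plancherel mu_haar N1 sphi; rewrite /rintegral /Rintegral => <-.
rewrite -[X in _ <= X]mul1r.
have := @le_weighted_norm2 _ _ _ _ mu mu_haar d w beta 0 1 _ _ beta0 (lexx 0) h h.
rewrite /weighted_norm2 /rintegral => H; apply: le_trans (H _).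
  by rewrite /Rintegral; under [X in _ <= fine X]eq_integral do rewrite W0 mul1r.
by move=> xi; rewrite mul1r ler_wpM2r ?sqr_ge0// W0 Xi_weight_ge1.
Qed.

End SupBound.

(** One limit inherits every Cauchy estimate with its own e and N. Limits chosen separately at each
    point thereby keep the estimates that are uniform in the point. *)
Lemma real_cauchy_limit (R : realType) (v : nat -> R) :
  (forall e : R, 0 < e -> exists N, forall k l, (N <= k)%N -> (N <= l)%N ->
     `|v k - v l| < e) ->
  exists z : R, forall (e : R) N, (forall k l, (N <= k)%N -> (N <= l)%N ->
     `|v k - v l| < e) -> forall k, (N <= k)%N -> `|v k - z| <= e.
Proof.
move=> cv; have vc : cvgn v.
  apply: cauchy_cvg; apply: cauchy_exP => e e0; have [N NP] := cv e e0.
  by exists (v N); exists N => // k /= Nk; rewrite -ball_normE /ball_/= NP.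
exists (limn v) => e N NP k Nk.
have c : (fun l => `|v k - v l|) @ \oo --> `|v k - limn v|.
  by apply: cvg_norm; apply: cvgB => //; exact: cvg_cst.
rewrite -(cvg_lim _ c)//; apply: limr_le; first by apply/cvg_ex; eexists; exact: c.
by exists N => // l /= Nl; apply: ltW; exact: NP.
Qed.

(** * Uniform limits of complex-valued functions *)

Section UniformLimits.
Context {R : realType} {T : Type}.
Local Notation normc := ComplexField.Normc.normc.

Lemma uniform_cauchy_limit (phi : nat -> T -> R[i]) :
  (forall e : R, 0 < e -> exists N, forall k l, (N <= k)%N -> (N <= l)%N ->
     forall x, normc (phi k x - phi l x) < e) ->
  exists h : T -> R[i], forall e : R, 0 < e -> exists N, forall k, (N <= k)%N ->
     forall x, normc (phi k x - h x) < e.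
Proof.
move=> cphi.
have ReB (u v : R[i]) : complex.Re (u - v) = complex.Re u - complex.Re v by case: u v => [? ?] [? ?].
have ImB (u v : R[i]) : complex.Im (u - v) = complex.Im u - complex.Im v by case: u v => [? ?] [? ?].
have cR N (e : R) : (forall k l, (N <= k)%N -> (N <= l)%N ->
     forall x, normc (phi k x - phi l x) < e) -> forall x k l, (N <= k)%N -> (N <= l)%N ->
     `|complex.Re (phi k x) - complex.Re (phi l x)| < e.
  by move=> H x k l Nk Nl; rewrite -ReB (le_lt_trans (Re_le_normc _))// H.
have cI N (e : R) : (forall k l, (N <= k)%N -> (N <= l)%N ->
     forall x, normc (phi k x - phi l x) < e) -> forall x k l, (N <= k)%N -> (N <= l)%N ->
     `|complex.Im (phi k x) - complex.Im (phi l x)| < e.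
  by move=> H x k l Nk Nl; rewrite -ImB (le_lt_trans (Im_le_normc _))// H.
have /choice[a aP] : forall x, exists z : R, forall (e : R) N, (forall k l, (N <= k)%N -> (N <= l)%N ->
     `|complex.Re (phi k x) - complex.Re (phi l x)| < e) -> forall k, (N <= k)%N ->
     `|complex.Re (phi k x) - z| <= e.
  move=> x; apply: real_cauchy_limit => e e0; have [N NP] := cphi e e0.
  by exists N => k l; exact: cR.
have /choice[b bP] : forall x, exists z : R, forall (e : R) N, (forall k l, (N <= k)%N -> (N <= l)%N ->
     `|complex.Im (phi k x) - complex.Im (phi l x)| < e) -> forall k, (N <= k)%N ->
     `|complex.Im (phi k x) - z| <= e.
  move=> x; apply: real_cauchy_limit => e e0; have [N NP] := cphi e e0.
  by exists N => k l; exact: cI.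
exists (fun x => Complex (a x) (b x)) => e e0.
(* Real and imaginary part each cost at most e / 3, so that their sum stays strictly below e. *)
have e30 : 0 < e / 3 by rewrite divr_gt0.
have [N NP] := cphi _ e30; exists N => k Nk x.
apply: (le_lt_trans (normc_le_ReIm _)); rewrite ReB ImB /=.
apply: (le_lt_trans (lerD (aP x _ _ (cR N _ NP x) k Nk) (bP x _ _ (cI N _ NP x) k Nk))).
by lra.
Qed.

Lemma normcB_le (u v : R[i]) : `|normc u - normc v| <= normc (u - v).
Proof.
have H (s t : R[i]) : normc s - normc t <= normc (s - t).
  by rewrite lerBlDr; have := normcD_le (s - t) t; rewrite subrK.
rewrite ler_norml H andbT lerNl opprB.
by apply: (le_trans (H v u)); rewrite -normcN opprB.
Qed.

End UniformLimits.

(** * Continuous representatives of elements of the completion *)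

Section CompletionRepresentatives.
Context {R : realType} {p : nat} {p_prime : prime p} {n : nat}.
Local Notation Qp := (padic R p_prime).
Local Notation V := 'rV[Qp]_n.
Local Notation C := R[i].
Local Notation B := (borelV R p_prime n).
Local Notation normc := ComplexField.Normc.normc.
Implicit Types (x y : V) (phi psi h : V -> C).
Variable mu : {measure set B -> \bar R}.
Hypothesis mu_haar : normalized_haar mu.
Variables (d : nat) (w : 'I_n -> nat) (M0 : nat) (beta : R).
Variable H : sobolev_completion mu d w M0 beta.

Lemma rnorm_sobolev_emb phi : Phi_space mu M0 phi ->
  rnorm (sobolev_emb H phi) = sobolev_norm mu d w beta phi.
Proof. by move=> Pphi; rewrite /rnorm sobolev_emb_norm. Qed.

Lemma sobolev_embB phi psi : Phi_space mu M0 phi -> Phi_space mu M0 psi ->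
  sobolev_emb H (fun x => -1 * psi x + phi x) = sobolev_emb H phi - sobolev_emb H psi.
Proof.
by move=> Pphi Ppsi; rewrite sobolev_emb_linear// scaleN1r addrC.
Qed.

Lemma schwartz_bruhat_measurable phi : schwartz_bruhat phi ->
  measurable_fun [set: B] (fun x : B => complex.Re (phi x)) /\
  measurable_fun [set: B] (fun x : B => complex.Im (phi x)).
Proof.
move=> /(schwartz_bruhat_Cintegrable mu_haar)[/measurable_int/measurable_EFinP mR].
by move=> /measurable_int/measurable_EFinP mI.
Qed.

Lemma represents_emb phi : Phi_space mu M0 phi -> represents (sobolev_emb H phi) phi.
Proof.
move=> Pphi; have [mR mI] := schwartz_bruhat_measurable Pphi.1; split => //.
exists (fun=> phi); split => //; first exact: cvg_cst.
under eq_fun do under eq_integral do rewrite subrr ComplexField.Normc.normc0 expr0n.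
by rewrite integral0; exact: cvg_cst.
Qed.

Definition uniform_modulus h := forall r : R, 0 < r -> exists K : int,
  forall x y, padic_norm (y - x) <= p%:R ^ K -> normc (h x - h y) < r.

Lemma uniform_modulus_continuous h : uniform_modulus h ->
  unif_continuous (h : V -> R[i]^o).
Proof.
move=> hu A; rewrite -entourage_ballE => -[e /= e0 eA].
have [r r0 er] := gt0_realcomplex e0.
have [K KP] := hu r r0.
rewrite /= -entourage_ballE; exists (p%:R ^ K); first exact: pexpz_gt0.
move=> [x y] /= [_ xy]; apply: eA => /=.
rewrite -ball_normE /ball_/= er normc_norm ltcR; apply: KP.
apply/padic_norm_leP => [|i]; first exact/ltW/pexpz_gt0.
apply: ltW; have := xy 0 i; rewrite /ball/= /padic_dist -padic_absN opprB.
by rewrite !mxE.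
Qed.

Lemma uniform_modulus_measurable h : uniform_modulus h ->
  measurable_fun [set: B] (fun x : B => complex.Re (h x)) /\
  measurable_fun [set: B] (fun x : B => complex.Im (h x)).
Proof.
move=> hu.
have ct (k : V -> R) : (forall x y, `|k x - k y| <= normc (h x - h y)) ->
    measurable_fun [set: B] (k : B -> R).
  move=> kh; apply: continuous_measurable_borelV => x A /nbhs_ballP[e /= e0 eA].
  have [K KP] := hu e e0; apply/nbhs_normP; exists (p%:R ^ K); first exact: pexpz_gt0.
  move=> y /ltW yK; apply: eA; rewrite -ball_normE /ball_/=.
  exact: (le_lt_trans (kh x y) (KP x y yK)).
split; apply: ct => x y.
  have := Re_le_normc (h x - h y); case: (h x) (h y) => [? ?] [? ?]; exact.
have := Im_le_normc (h x - h y); case: (h x) (h y) => [? ?] [? ?]; exact.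
Qed.

Variable f : mpoly n Qp.
Hypothesis fw : quasielliptic f d w.
Hypothesis beta_gt : (n * \max_(i < n) w i)%N%:R / (2 * d%:R) < beta.

Lemma completion_uniform_limit (u : H) : exists h : V -> C,
  represents u h /\ uniform_modulus h.
Proof.
have /choice[phi phiP] : forall k : nat, exists phi, Phi_space mu M0 phi /\
    rnorm (sobolev_emb H phi - u) < k.+1%:R^-1.
  move=> k; have k0 : 0 < k.+1%:R^-1 :> R by rewrite invr_gt0.
  by have [_ [g Pg <-] gu] := dense_rnorm (@sobolev_emb_dense _ _ _ _ _ _ _ _ _ H) u k0; exists g.
have Pphi k := (phiP k).1.
have small (r : R) : 0 < r -> exists N, forall k, (N <= k)%N -> rnorm (sobolev_emb H (phi k) - u) < r.
  move=> r0; exists (Num.bound r^-1) => k Nk; apply: (lt_le_trans (phiP k).2).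
  rewrite -[r]invrK lef_pV2 ?posrE ?invr_gt0//.
  have rV0 : 0 <= r^-1 by rewrite invr_ge0 ltW.
  by rewrite (le_trans (ltW (archi_boundP rV0)))// ler_nat (leq_trans Nk).
pose D k l : V -> C := fun x => -1 * phi l x + phi k x.
have DE k l x : D k l x = phi k x - phi l x by rewrite /D mulN1r addrC.
have PD k l : Phi_space mu M0 (D k l) := Phi_spaceD mu_haar (-1) (Pphi l) (Pphi k).
have cauchy (r : R) : 0 < r -> exists N, forall k l, (N <= k)%N -> (N <= l)%N ->
    sobolev_norm mu d w beta (D k l) < r.
  move=> r0; have r20 : 0 < r / 2 by rewrite divr_gt0.
  have [N NP] := small _ r20; exists N => k l Nk Nl.
  rewrite -rnorm_sobolev_emb// sobolev_embB//.
  apply: (le_lt_trans (rnorm_triangle u _ _)); rewrite [X in _ + X]rnormBC.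
  by have := ltrD (NP k Nk) (NP l Nl); rewrite -splitr.
have [h hP] : exists h : V -> C, forall e : R, 0 < e -> exists N, forall k, (N <= k)%N ->
     forall x, normc (phi k x - h x) < e.
  apply: uniform_cauchy_limit => e e0.
  have [r r0 rP] := sobolev_sup mu_haar fw beta_gt e0.
  have [N NP] := cauchy r r0; exists N => k l Nk Nl x.
  by rewrite -DE; apply: rP; [exact: (PD k l).1|exact: NP].
have hmod : uniform_modulus h.
  (* The approximant phi N is exactly invariant under some ball, so within it only the two errors of
     approximation remain. *)
  move=> r r0; have r30 : 0 < r / 3 by rewrite divr_gt0.
  have [N NP] := hP _ r30; have hN := NP N (leqnn N).
  have [N' [K [_ iK]]] := (schwartz_bruhatP (phi N)).1 (Pphi N).1.
  exists K => x y yx.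
  have E : phi N y = phi N x by rewrite -(iK x (y - x) yx) addrC subrK.
  have -> : h x - h y = (phi N y - h y) - (phi N x - h x).
    by rewrite E; move: (phi N x) (h x) (h y) => s t z; ring.
  apply: (le_lt_trans (normcD_le _ _)); rewrite normcN.
  by have := ltrD (hN y) (hN x); move: (normc _) (normc _) => s t; lra.
exists h; split => //.
have [mR mI] := uniform_modulus_measurable hmod; split => //.
exists phi; split => //.
  apply/cvg_rnormP => e e0; have [N NP] := small e e0; exists N => k Nk.
  by rewrite rnormBC NP.
(* Fatou's lemma, since L^2 norms are bounded by Sobolev norms (Plancherel). *)
have bound (e : R) : 0 < e -> exists N, forall k, (N <= k)%N ->
    (\int[mu]_x ((normc (phi k x - h x) ^+ 2)%:E) <= (e ^+ 2)%:E)%E.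
  move=> e0; have [N NP] := cauchy e e0; exists N => k Nk.
  (* Here k is fixed and the limit is taken in l; the shift by N makes every term obey the Cauchy
     bound. *)
  pose F (l : nat) (x : B) : \bar R := (normc (D k (N + l)%N x) ^+ 2)%:E.
  have mF l : measurable_fun [set: B] (F l).
    by apply/measurable_EFinP; exact: (measurable_normc2 mu_haar (PD k _).1).
  have F0 l x : [set: B] x -> (0 <= F l x)%E by move=> _; rewrite lee_fin sqr_ge0.
  have Fcvg x : F ^~ x @ \oo --> (normc (phi k x - h x) ^+ 2)%:E.
    have c1 : (fun l => normc (D k (N + l)%N x)) @ \oo --> normc (phi k x - h x).
      apply/cvgrPdist_lt => r r0; have [N1 N1P] := hP r r0.
      exists N1 => // l /= Nl; apply: (le_lt_trans (normcB_le _ _)).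
      rewrite DE; have -> : phi k x - h x - (phi k x - phi (N + l)%N x) =
        phi (N + l)%N x - h x.
        by move: (phi k x) (h x) (phi _ x) => s t z; ring.
      by apply: N1P; rewrite (leq_trans Nl)// leq_addl.
    by apply: cvg_EFin; [exact: nearW|exact: (cvgM c1 c1)].
  have -> : (\int[mu]_x ((normc (phi k x - h x) ^+ 2)%:E) =
      \int[mu]_(x in [set: B]) limn_einf (F^~ x))%E.
    by apply: eq_integral => x _; rewrite (cvg_limn_einf_sup (Fcvg x)).1.
  apply: (le_trans (fatou mu measurableT mF F0)); rewrite limn_einf_lim.
  apply: lime_le; first exact: is_cvg_einfs.
  apply: nearW => l; apply: (@le_trans _ _ (\int[mu]_x F l x)%E).
    by apply: ereal_inf_lbound; exists l => /=.
  have sF := L2_le_sobolev_norm mu_haar (d := d) (w := w) beta_gt (PD k (N + l)%N).1.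
  apply: (le_trans sF); rewrite lee_fin lerXn2r ?nnegrE ?sobolev_norm_ge0// ?ltW//.
  by apply: NP => //; rewrite leq_addr.
have int_ge0 k : (0 <= \int[mu]_x ((normc (phi k x - h x) ^+ 2)%:E))%E.
  by apply: integral_ge0 => x _; rewrite lee_fin sqr_ge0.
apply/fine_cvgP; split.
  have [N NP] := bound 1 ltr01; exists N => // k /= Nk.
  by rewrite ge0_fin_numE// (le_lt_trans (NP k Nk))// ltry.
apply/cvgrPdist_le => e e0.
have se0 : 0 < Num.sqrt e by rewrite sqrtr_gt0.
have [N NP] := bound _ se0; exists N => // k /= Nk.
rewrite sub0r normrN ger0_norm ?fine_ge0//.
have := NP k Nk; rewrite (sqr_sqrtr (ltW e0)) => H1.
by rewrite -lee_fin fineK// ge0_fin_numE// (le_lt_trans H1)// ltry.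
Qed.

End CompletionRepresentatives.

(** * The operator as an isomorphism of the completions *)

Theorem theorem7p4 (R : realType) (p : nat) (p_prime : prime p) (n : nat)
    (mu : {measure set (borelV R p_prime n) -> \bar R})
    (mu_haar : normalized_haar mu)
    (f : mpoly n (padic R p_prime)) (d : nat) (w : 'I_n -> nat)
    (c : multinom n -> 'rV[padic R p_prime]_n -> padic R p_prime)
    (F_semi_quasielliptic : semi_quasielliptic f d w c) :
  exists M0 : nat,
    (exists A0 A1 : R, [/\ 0 < A0, 0 < A1 &
       forall x xi : 'rV[padic R p_prime]_n, p%:R ^+ M0 <= padic_norm xi ->
         A0 * Xi d w xi <= padic_abs (symbol f d w c xi x) <= A1 * Xi d w xi]) /\
    forall alpha beta : R, 0 < alpha -> alpha <= beta ->
    forall (H : sobolev_completion mu d w M0 beta)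
           (H' : sobolev_completion mu d w M0 (beta - alpha)),
      (exists T : {linear H -> H'},
         [/\ forall phi, Phi_space mu M0 phi ->
               represents (T (sobolev_emb H phi))
                 (pseudo_diff mu (symbol f d w c) alpha phi),
             continuous T &
             exists S : H' -> H, [/\ cancel T S, cancel S T & continuous S]]) /\
      (alpha + (n * \max_(i < n) w i)%N%:R / (2 * d%:R) < beta ->
       forall phi : H, exists h : 'rV[padic R p_prime]_n -> R[i]^o,
         represents phi h /\ unif_continuous h).
Proof.
have [fw cB] := F_semi_quasielliptic.
have [M0 [A0 [A1 [A00 A10 AP]]]] := symbol_bounds fw cB.
exists M0; split.
  exists A0, A1; split => // x xi xiM.
  by have [H1 H2] := AP xi xiM; rewrite H2.
move=> alpha beta alpha0 ab H H'; split; last first.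
  move=> beta_gt u.
  have bgt : (n * \max_(i < n) w i)%N%:R / (2 * d%:R) < beta.
    by apply: le_lt_trans beta_gt; rewrite lerDr ltW.
  have [h [uh hmod]] := completion_uniform_limit mu_haar fw bgt u.
  by exists h; split => //; exact: uniform_modulus_continuous.
have f_bounds xi (xiM : p%:R ^+ M0 <= padic_norm xi) := (AP xi xiM).1.
have fE xi (xiM : p%:R ^+ M0 <= padic_norm xi) := (AP xi xiM).2.
pose P := multiplier_op mu f alpha.
have PP phi : Phi_space mu M0 phi -> Phi_space mu M0 (P phi).
  exact: (Phi_space_multiplier_op mu_haar fw alpha).
have a0 := ltW alpha0.
(* Both completions are seen over the same domain [Phi_space mu M0]: it is embedded in H directly,
   and in H' after applying the multiplier. *)
have [|||||||T [TE cT ST]] := @dense_extension R _ (Phi_space mu M0) H H' (sobolev_emb H)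
  (fun phi => sobolev_emb H' (P phi)) (Num.sqrt (A1 `^ (2 * alpha)))
  (Num.sqrt ((A0 `^ (2 * alpha))^-1)).
- move=> c0 phi psi Pphi Ppsi; exists (fun x => c0 * phi x + psi x).
    exact: Phi_spaceD.
  rewrite sobolev_emb_linear//; split => //.
  rewrite /P (multiplier_opD mu_haar fw alpha c0 Pphi Ppsi).
  by apply: sobolev_emb_linear; exact: PP.
- exact: sobolev_emb_dense.
(* The multiplier maps the domain onto itself, so this image is that of the plain embedding in
   H'. *)
- rewrite (_ : _ @` _ = sobolev_emb H' @` Phi_space mu M0); first exact: sobolev_emb_dense.
  apply/seteqP; split=> [_ [phi Pphi <-]|_ [psi Ppsi <-]].
    by exists (P phi) => //; exact: PP.
  have [phi Pphi E] := multiplier_op_surj mu_haar fw alpha Ppsi.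
  by exists phi; rewrite //= /P E.
- exact: sqrtr_ge0.
- exact: sqrtr_ge0.
- move=> phi Pphi; rewrite !rnorm_sobolev_emb//; last exact: PP.
  exact: (sobolev_norm_multiplier_op mu_haar fw A00 A10 f_bounds a0 ab Pphi).1.
- move=> phi Pphi; rewrite !rnorm_sobolev_emb//; last exact: PP.
  exact: (sobolev_norm_multiplier_op mu_haar fw A00 A10 f_bounds a0 ab Pphi).2.
exists T; split=> [phi Pphi| |].
- rewrite TE// (pseudo_diffE alpha fE Pphi).
  exact: (represents_emb mu_haar H' (PP _ Pphi)).
- exact: cT.
- exact: ST.
Qed.
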